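(* There is a deterministic online algorithm that outputs a fractional solution for the $(h,k)$-server problem when the metric $(X,d)$ is a tree metric, with competitive ratio $O(D\log(1/\varepsilon))$, where $k/h=1+\varepsilon$ and $D$ is the hop-diameter of the tree. For the case of HSTs, one gets a bound of $O(\min\{D,\log k\}\log(1/\varepsilon))$, and the fractional solution can be rounded to give a randomized algorithm with the same asymptotic competitive ratio.
   Context: The $(h,k)$-server problem, $h\le k$: requests $r_1,r_2,\ldots$ (points of a metric space $(X,d)$) arrive online; the algorithm maintains $k$ servers (a set $A_t\subseteq X$, $|A_t|=k$, $r_t\in A_t$) and pays the total distance moved by the servers, but its cost is compared to the cost of an optimal offline solution using only $h$ servers. A tree metric is the shortest-path metric of a tree with nonnegative edge lengths; the hop-diameter is the maximum number of edges on a simple path. A fractional solution maintains at each time a vector of nonnegative server masses on the points with mass $1$ at the requested point, with cost the sum of earthmover distances between consecutive mass vectors. An HST (a $\tau$-HST for some $\tau>1$) is a rooted tree whose edge lengths decrease by a factor $\tau$ along any root-to-leaf path, with the shortest-path metric on its leaves. Competitive ratio $\alpha$: for every request sequence, the (expected) cost is at most $\alpha$ times the optimal $h$-server cost plus an additive term independent of the request sequence. *)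

(* Defs.v *)
(* MathComp / MathComp-Analysis. *)
From HB Require Import structures.
From mathcomp Require Import all_boot all_order all_algebra.
From mathcomp Require Import all_classical all_reals all_analysis.
Set Implicit Arguments.
Unset Strict Implicit.
Unset Printing Implicit Defensive.
Import Order.TTheory GRing.Theory Num.Theory.
Local Open Scope classical_set_scope.
Local Open Scope ring_scope.

Section Trees.
Context {R : realType} {V : finType}.
Implicit Types (e : rel V) (len : V -> V -> R) (r : V).

Definition is_tree e :=
  [/\ symmetric e, irreflexive e, forall x y, connect e x y
    & forall c : seq V, (2 < size c)%N -> ~ ucycle e c].

Definition edge_lengths e len :=
  forall x y, e x y -> 0 <= len x y /\ len x y = len y x.

Definition path_length len x (p : seq V) : R :=
  \sum_(l <- pairmap len x p) l.

Definition shortest_path e len (x y : V) : R :=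
  inf [set path_length len x p | p in
        [set p : seq V | path e x p /\ last x p = y]].

(* A simple path visits at most #|V| vertices, so it has fewer than #|V|
   edges. *)
Definition hop_diameter e : nat :=
  (\max_(n < #|V| | [exists x : V, exists p : n.-tuple V,
                       path e x p && uniq (x :: p)]) n)%N.

(* A non-root vertex has exactly one neighbour that is not one of its
   children. *)
Definition leaf e r : pred V := fun v => (#|e v| <= (v != r))%N.

Definition is_HST (tau : R) e len r :=
  [/\ is_tree e, edge_lengths e len
    & forall p : seq V, path e r p -> uniq (r :: p) ->
        sorted (fun a b : R => a == tau * b) (pairmap len r p)].

Definition leaf_metric e len r (x y : {v : V | leaf e r v}) : R :=
  shortest_path e len (val x) (val y).

End Trees.

Arguments leaf_metric {R V} e len r x y.

Section Servers.
Context {R : realType} {X : finType}.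
Implicit Types (d : X -> X -> R) (h k : nat) (s : seq X).

(* Least total distance moved by servers going from A to B; meant for sets
   of the same cardinality. *)
Definition move_cost d (A B : {set X}) : R :=
  inf [set \sum_(x in A) d x (f x) | f in
        [set f : {ffun X -> X} |
           {in A &, injective f} /\ (f @: A = B)%SET]].

Definition transport_plan (p q : X -> R) (g : X -> X -> R) :=
  [/\ forall x y, 0 <= g x y,
      forall x, \sum_y g x y = p x
    & forall y, \sum_x g x y = q y].

Definition earthmover d (p q : X -> R) : R :=
  inf [set \sum_x \sum_y d x y * g x y | g in
        [set g : X -> X -> R | transport_plan p q g]].

Definition trajectory_cost (C : Type) (dist : C -> C -> R)
    (S : nat -> C) (T : nat) : R :=
  \sum_(t < T) dist (S t) (S t.+1).

(* S 0 is the initial configuration, chosen freely, and S t.+1 serves the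
   request number t of s (counting from 0). *)
Definition offline_solution h s (S : nat -> {set X}) :=
  (forall t, #|S t| = h) /\
  (forall t x, onth s t = Some x -> x \in S t.+1).

Definition offline_opt d h s : R :=
  inf [set trajectory_cost (move_cost d) S (size s) | S in
        [set S | offline_solution h s S]].

(* An online algorithm maps the sequence of the requests seen so far to the
   configuration held after serving the last of them; its value at [::] is
   the initial configuration. *)
Definition online_cost (C : Type) (dist : C -> C -> R) (A : seq X -> C) s : R :=
  trajectory_cost dist (fun t => A (take t s)) (size s).

Definition server_algorithm k (A : seq X -> {set X}) :=
  (forall s, #|A s| = k) /\ (forall s x, x \in A (rcons s x)).

Definition fractional_algorithm k (F : seq X -> X -> R) :=
  [/\ forall s x, 0 <= F s x,
      forall s, \sum_x F s x = k%:R
    & forall s x, F (rcons s x) x = 1].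

(* A randomized algorithm is a random choice of a deterministic one. *)
Definition randomized_algorithm k (dO : measure_display)
    (Omega : measurableType dO) (A : Omega -> seq X -> {set X}) :=
  (forall w, server_algorithm k (A w)) /\
  (forall s (B : {set X}), measurable [set w | A w s = B]).

Definition rounding (dO : measure_display) (Omega : measurableType dO)
    (P : probability Omega R) (A : Omega -> seq X -> {set X})
    (F : seq X -> X -> R) :=
  forall s x, P [set w | x \in A w s] = (F s x)%:E.

Definition competitive d h (alpha : R) (cost : seq X -> \bar R) :=
  exists c : R, forall s, (cost s <= (alpha * offline_opt d h s + c)%:E)%E.

End Servers.

(* The factor log(1/eps) of the asymptotic bounds; truncated below because
   log(1/eps) tends to 0 and then becomes negative as eps reaches and
   exceeds 1. *)
Definition log_inv {R : realType} (eps : R) : R := Num.max 1 (ln eps^-1).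

(* Main.v *)
Require Import Defs.
From HB Require Import structures.
From mathcomp Require Import all_boot all_order all_algebra.
From mathcomp Require Import all_classical all_reals all_analysis.
From mathcomp Require Import measurable_realfun.
From mathcomp Require Import ring lra zify.
Import Order.TTheory GRing.Theory Num.Theory.
Import numFieldNormedType.Exports.
Local Open Scope ring_scope.


(** A fractional configuration of [H] servers is given by the extents [z (u, i)]
    to which the subtree of [u] contains an [i]-th server.  In a
    potential, [ln ((1 + delta) / (1 + delta - z (u, i)))] has weight [delta] when
    more than [i] offline servers are below [u] and weight 1 otherwise, so that an
    offline move raises the potential by at most [ln ((1 + delta) / delta)] times
    its cost.  A request is served by minimising
    the potential among the configurations whose cost is paid for by its
    decrease; multipliers given by Gordan's theorem show that the minimiser has
    mass at least [1 - d0] at the request.  The labels [lo] and [up], which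
    decrease by about [1 / D] along each edge, make the cost count with a factor
    of that order.  With [1 - d0 = H / k], scaling by [k / H] turns this into [k]
    servers.

    On an HST the mass of one designated child of each vertex is determined by
    the others, so that only the light edges count.  Masses decrease
    geometrically along light edges and negligible masses are evicted; hence [D]
    may be replaced by [ln k].  The rounding maintains a law on [k]-sets, any two
    of which differ by at most one server in every subtree; the geometric weights
    allow to follow a fractional move at a proportional cost, and the resulting
    couplings are realised on the unit interval. *)

Set Implicit Arguments.
Unset Strict Implicit.
Unset Printing Implicit Defensive.

(** The offline set [A] is unknown, so a move must be paid for by the potentials of all admissible
    sets at once. Hence the minimisation has a constraint for each [A]: at a stuck point the
    multipliers mix the sets into one averaged weight [Q], and the linear inequality that holds for
    integral configurations passes to averages. The signs of the mass changes are mixed as well, so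
    a stuck point only sees some label [beta] between [lo] and [up]. The gap [up - lo] is the rate
    at which movement can be charged; since labels must not increase from a vertex to its children
    and stay between [4^-1] and [2^-1] on the way to the request, the rate is limited by the number
    of charged edges. With a label of at least [4^-1] and [delta = d0 / 4], an item of weight
    [delta] and extent below [1 - d0] still profits from growing. The rounding needs siblings of
    equal weight. Below the root this follows from the geometric weights, but the edges at the root
    of an HST are unrelated, so the metric is first embedded with constant distortion in another
    tree. *)

Section Farkas.
Context {R : realType} {I : finType}.
Implicit Types (a : nat -> I -> R) (c x : I -> R).

Let dot c x := \sum_i c i * x i.

(** Farkas' lemma by induction on the number of constraints. If the direction [x0] found for the
    first [n] of them violates the next one, all forms are projected along [a n] so as to vanish at
    [x0]; either alternative for the projected system lifts to the original one. *)
Lemma farkas_nat n a c :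
  (exists x, (forall j, (j < n)%N -> 0 <= dot (a j) x) /\ dot c x < 0) \/
  (exists l : nat -> R, (forall j, 0 <= l j) /\
     forall i, c i = \sum_(j < n) l j * a j i).
Proof.
elim: n a c => [|n IH] a c.
  have [c0|/existsNP[i /eqP ci]] := pselect (forall i, c i = 0).
    by right; exists (fun=> 0); split=> // i; rewrite big_ord0.
  left; exists (fun i => - c i); split=> //.
  rewrite /dot (eq_bigr (fun i => - (c i ^+ 2))); last by move=> j _; rewrite mulrN.
  rewrite sumrN oppr_lt0 (bigD1 i) //= ltr_pwDl ?exprn_even_gt0 //.
  by apply: sumr_ge0 => j _; exact: sqr_ge0.
case: (IH a c) => [[x0 [ax0 cx0]]|[l [l0 lc]]]; last first.
  right; exists (fun j => if (j < n)%N then l j else 0); split=> [j|i].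
    by case: ifP.
  rewrite big_ord_recr /= ltnn mul0r addr0 lc; apply: eq_bigr => j _.
  by rewrite ltn_ord.
have [an|an] := leP 0 (dot (a n) x0).
  left; exists x0; split=> // j; rewrite ltnS leq_eqVlt => /orP[/eqP->//|].
  exact: ax0.
set s := dot (a n) x0 in an *; have sn0 : s != 0 by rewrite lt_eqF.
pose a' j i := a j i - dot (a j) x0 / s * a n i.
pose c' i := c i - dot c x0 / s * a n i.
have dotB (u : I -> R) t x : dot (fun i => u i - t * a n i) x = dot u x - t * dot (a n) x.
  rewrite /dot mulr_sumr -sumrB; apply: eq_bigr => i _; ring.
case: (IH a' c') => [[x1 [ax1 cx1]]|[l [l0 lc]]].
  left; pose t := dot (a n) x1 / s.
  have dotx (u : I -> R) : dot u (fun i => x1 i - t * x0 i) = dot u x1 - t * dot u x0.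
    rewrite /dot mulr_sumr -sumrB; apply: eq_bigr => i _; ring.
  exists (fun i => x1 i - t * x0 i); split.
    move=> j; rewrite ltnS leq_eqVlt => /orP[/eqP->|jn].
      by rewrite dotx /t -/s divfK // subrr.
    rewrite dotx /t; move: (ax1 j jn); rewrite /a' dotB.
    by congr (_ <= _); field.
  rewrite dotx /t; move: cx1; rewrite /c' dotB.
  by congr (_ < _); field.
right.
(* This multiplier of the last constraint is nonnegative because [dot c x0] and [s] are negative
   while the other forms are nonnegative at [x0]. *)
pose m := dot c x0 / s - \sum_(j < n) l j * (dot (a j) x0 / s).
have m0 : 0 <= m.
  rewrite /m -sumrN addr_ge0 //.
    by rewrite mulr_le0 ?invr_le0 // ltW.
  apply: sumr_ge0 => j _; rewrite oppr_ge0 mulr_ge0_le0 //.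
  by rewrite mulr_ge0_le0 ?invr_le0 ?ax0 // ltW.
exists (fun j => if (j < n)%N then l j else m); split=> [j|i].
  by case: ifP.
rewrite big_ord_recr /= ltnn.
under eq_bigr do rewrite ltn_ord.
have : c' i = \sum_(j < n) l j * a' j i by rewrite lc.
rewrite /c' /a' => /(canRL (subrK _)) ->.
have sumE (q : nat -> R) t : \sum_(j < n) l j * (a j i - q j * t) =
    \sum_(j < n) l j * a j i - (\sum_(j < n) l j * q j) * t.
  by rewrite mulr_suml -sumrB; apply: eq_bigr => j _; rewrite mulrBr mulrA.
rewrite (sumE (fun j => dot (a j) x0 / s)) /m.
set P := \sum_(j < n) l j * a j i; set Q := \sum_(j < n) _.
ring.
Qed.

End Farkas.

Section FarkasFin.
Context {R : realType} {I J : finType}.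

Lemma farkas (a : J -> I -> R) (c : I -> R) :
  (exists x : I -> R, (forall j, 0 <= \sum_i a j i * x i) /\ \sum_i c i * x i < 0) \/
  (exists l : J -> R, (forall j, 0 <= l j) /\ forall i, c i = \sum_j l j * a j i).
Proof.
pose a' n i := if insub n is Some k then a (enum_val (k : 'I_#|J|)) i else 0.
have a'E (k : 'I_#|J|) i : a' k i = a (enum_val k) i by rewrite /a' valK.
case: (farkas_nat #|J| a' c) => [[x [ax cx]]|[l [l0 lc]]]; [left|right].
  exists x; split=> // j; have := ax (enum_rank j) (ltn_ord _).
  by under eq_bigr do rewrite a'E enum_rankK.
exists (fun j => l (enum_rank j)); split=> // i; rewrite lc.
rewrite (reindex (@enum_rank J)) /=; last by apply: onW_bij; exact: enum_rank_bij.
by apply: eq_bigr => j _; rewrite a'E enum_rankK.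
Qed.

End FarkasFin.

Section Gordan.
Context {R : realType} {I J T : finType}.

(* The coordinate [None] homogenises the strict inequalities [f t x < 0] to
   [f t x + x None <= 0] with [x None > 0]. *)
Lemma farkas_strict (a : J -> I -> R) (f : T -> I -> R) :
  (exists x : I -> R, (forall j, 0 <= \sum_i a j i * x i) /\
     forall t, \sum_i f t i * x i < 0) \/
  (exists (l : J -> R) (p : T -> R),
     [/\ forall j, 0 <= l j, forall t, 0 <= p t, \sum_t p t = 1
       & forall i, \sum_t p t * f t i = \sum_j l j * a j i]).
Proof.
pose A (j : J + T) (i : option I) : R :=
  match j, i with
  | inl j, Some i => a j i | inl j, None => 0
  | inr t, Some i => - f t i | inr t, None => - 1 end.
pose c (i : option I) : R := if i is None then - 1 else 0.
have sumO (F : option I -> R) : \sum_i F i = F None + \sum_i F (Some i).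
  rewrite (bigD1 None) //=; congr (_ + _).
  rewrite (reindex_omap Some id) => [|[i|]] //=.
  by apply: eq_bigl => i; rewrite eqxx.
case: (farkas A c) => [[x [Ax cx]]|[l [l0 lc]]]; [left|right].
  have xN : 0 < x None.
    move: cx; rewrite sumO big1 => [|i _]; last by rewrite mul0r.
    by rewrite addr0 mulN1r oppr_lt0.
  exists (fun i => x (Some i)); split=> [j|t].
    by have := Ax (inl j); rewrite sumO mul0r add0r.
  have := Ax (inr t); rewrite sumO /= mulN1r.
  by under eq_bigr do rewrite mulNr; rewrite sumrN; lra.
exists (fun j => l (inl j)), (fun t => l (inr t)); split=> //.
  have := lc None; rewrite big_sumType /= big1 => [|j _]; last by rewrite mulr0.
  rewrite add0r; under eq_bigr do rewrite mulrN1.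
  by rewrite sumrN => /oppr_inj.
move=> i; have := lc (Some i); rewrite big_sumType /=.
under [X in _ + X]eq_bigr do rewrite mulrN.
by rewrite sumrN; move/eqP; rewrite eq_sym subr_eq0 => /eqP.
Qed.

End Gordan.

Section CompactMin.
Local Open Scope classical_set_scope.
Context {R : realType} {I : finType}.

Let T : topologicalType := prod_topology (fun _ : I => (R : topologicalType)).

(** Tychonoff's theorem makes the box compact, and the constraints cut out a closed part of it. *)
Lemma box_min (B : R) (J : Type) (g : J -> T -> R) (f : T -> R) :
  (forall j, continuous (g j)) -> continuous f ->
  let A := [set z : T | (forall i, 0 <= z i <= B) /\ forall j, 0 <= g j z] in
  (exists z, A z) -> exists2 z, A z & forall z', A z' -> f z <= f z'.
Proof.
move=> cg cf A [z0 Az0].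
have cA : compact A.
  have cbox : compact [set z : T | forall i, [set x : R | 0 <= x <= B] (z i)].
    apply: (@tychonoff I (fun=> R : topologicalType)
      (fun=> [set x : R | 0 <= x <= B])) => i.
    by rewrite -set_itvcc; exact: segment_compact.
  rewrite (_ : A = [set z : T | forall i, [set x : R | 0 <= x <= B] (z i)] `&`
      \bigcap_(j in setT) [set z | 0 <= g j z]).
    apply: compact_closedI => //; apply: closed_bigI => j _.
    by apply: (@preimage_closed _ _ (g j) [set x | 0 <= x]) => // ; exact: closed_ge.
  apply/seteqP; split=> z /=.
    by move=> [zb gz]; split=> // j _ /=.
  by move=> [zb gz]; split=> // j; exact: gz.
have A0 : A !=set0 by exists z0.
have cfA : {within A, continuous f} by apply: continuous_subspaceT.
have [z zA zmin] := compact_EVT_min A0 cA cfA.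
by exists z => [|z' Az']; [exact: set_mem | apply: zmin; exact: mem_set].
Qed.

Lemma coordinate_continuous i : continuous (fun z : T => z i : R).
Proof. by move=> z; exact: (@proj_continuous I (fun _ => R : topologicalType) i z). Qed.

End CompactMin.

(** * Servers on a forest and their potential *)

(** The same chain is run on two forests: the vertices of a tree with its points attached as further
    leaves, and the vertices of an HST with its leaves as points. [fdep] serves for induction
    towards the roots. *)
Record forest (U X : finType) := Forest {
  fpar : U -> option U;
  fdep : U -> nat;
  fanc : U -> X -> bool;
  fdep_par : forall u v, fpar v = Some u -> (fdep u < fdep v)%N;
  fanc_par : forall u v x, fpar v = Some u -> fanc v x -> fanc u x;
  fanc_inj : forall u v x, fpar u = fpar v -> fanc u x -> fanc v x -> u = v }.

Lemma small_eta (R : realType) (T : finType) (P : T -> R -> Prop) :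
  (forall t, exists2 r, 0 < r & forall s, 0 < s <= r -> P t s) ->
  exists2 r, 0 < r & forall s, 0 < s <= r -> forall t, P t s.
Proof.
move=> Pt; have /choice[f fP] : forall t, exists r, 0 < r /\ forall s, 0 < s <= r -> P t s.
  by move=> t; have [r r0 Pr] := Pt t; exists r.
have f0 t := (fP t).1; have Pf t := (fP t).2.
exists (\big[Num.min/1]_t f t).
  by apply: (big_ind (fun y => 0 < y)) => // x y x0 y0; rewrite lt_min x0.
move=> s /andP[s0 sm] t; apply: Pf; rewrite s0 /=; apply: le_trans sm _.
by rewrite (bigD1 t) //= ge_min lexx.
Qed.

Section Chain.
Context {R : realType} {U X : finType} (fr : forest U X) (H : nat).

Notation I := (U * 'I_H)%type.
Notation par := (fpar fr).
Notation anc := (fanc fr).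

Implicit Types (z x : I -> R) (o : option U) (S : {set I}) (A : {set X}).

(* [z (u, i)] is the extent to which the subtree of [u] contains an [i]-th
   server; [capacity z o m] is what the first [m] servers of the parent [o]
   allow, the virtual root [None] owning [H] full servers. *)
Definition capacity z o m : R :=
  if o is Some p then \sum_(e : I | (e.1 == p) && (e.2 < m)%N) z e
  else (minn m H)%:R.

Definition siblings o S := [forall e in S, par e.1 == o].

(** A polytope that contains all integral configurations. An offline set serves at most [#|S|] of
    the items in [S], and at most as many as it has servers below the parent; as these occupy the
    first items of the parent, both bounds together are the [capacity]. *)
Definition feasible z :=
  (forall e, 0 <= z e) /\
  forall o S, siblings o S -> \sum_(e in S) z e <= capacity z o #|S|.

Definition count A u : nat := #|[set y in A | anc u y]|.

Definition mass z u : R := \sum_i z (u, i).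

Lemma sum_items (F : I -> R) : \sum_e F e = \sum_u \sum_i F (u, i).
Proof. by rewrite pair_bigA /=; apply: eq_bigr => -[]. Qed.

Lemma card_own p m : #|[set e : I | (e.1 == p) && (e.2 < m)%N]| = minn m H.
Proof.
rewrite -sum1_card; under eq_bigl do rewrite inE.
rewrite -(pair_big (fun u => u == p) (fun i : 'I_H => (i < m)%N) (fun _ _ => 1%N)) /= big_pred1_eq.
case: (leqP m H) => [mH|/ltnW Hm].
  by rewrite -(big_ord_widen H (fun=> 1%N)) // sum1_card card_ord.
rewrite (eq_bigl predT) => [|i]; first by rewrite sum1_card card_ord.
by rewrite (leq_trans (ltn_ord i)).
Qed.

Lemma sum1_own p m :
  \sum_(e : I | (e.1 == p) && (e.2 < m)%N) (1 : R) = (minn m H)%:R.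
Proof.
by rewrite -(card_own p m) -sum1_card natr_sum; apply: eq_bigl => e; rewrite inE.
Qed.

Lemma feasible_le1 z : feasible z -> forall e, z e <= 1.
Proof.
move=> [z0 zS] [u i].
have [n un] := ubnP (fdep fr u); elim: n u un i => // n IH u un i.
have s1 : siblings (par u) [set (u, i)] by apply/forall_inP => e /set1P->.
have := zS _ _ s1; rewrite big_set1 cards1 /capacity.
case E : (par u) => [p|]; last first.
  by move=> /le_trans; apply; rewrite lern1 geq_minl.
move=> /le_trans; apply.
have H0 : (0 < H)%N by case: i {s1} => i /(leq_trans _); apply.
rewrite (eq_bigl (pred1 (p, Ordinal H0))).
  rewrite big_pred1_eq; apply: IH.
  by apply: leq_trans (fdep_par E) _.
by move=> [u' i']; rewrite /= xpair_eqE -val_eqE /= ltnS leqn0.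
Qed.

(** The subtrees of siblings are disjoint, so each point of [A] is counted at most once. *)
Lemma sum_count A o : (#|A| <= H)%N ->
  (\sum_(v | par v == o) count A v <= if o is Some p then count A p else H)%N.
Proof.
move=> AH; pose B := if o is Some p then [set y in A | anc p y] else A.
suff le : (\sum_(v | par v == o) count A v <= #|B|)%N.
  by apply: leq_trans le _; rewrite /B; case: (o).
rewrite /count -sum1_card.
under eq_bigr do rewrite -sum1_card.
rewrite (exchange_big_dep (fun y => y \in A)) /=; last by move=> v y _; rewrite inE => /andP[].
rewrite [leqRHS](_ : _ = \sum_(y in A) (y \in B))%N; last first.
  rewrite big_mkcond [RHS]big_mkcond /=; apply: eq_bigr => y _; rewrite /B.
  by case: (o) => [p|]; rewrite ?inE; case: (y \in A) => //=; case: (anc p y).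
apply: leq_sum => y yA.
have [/existsP[v /andP[/eqP vo vy]]|/existsPn nv] := boolP [exists v, (par v == o) && anc v y].
  rewrite (big_pred1 v) => [|u].
    by rewrite /B; case: (o) vo => [p|] vo; rewrite ?inE yA // (fanc_par vo vy).
  rewrite inE yA /=; apply/andP/eqP => [[/eqP uo uy]|->]; last by rewrite vo.
  by apply: (@fanc_inj _ _ fr _ _ y) => //; rewrite uo vo.
rewrite big_pred0 // => u; apply/negbTE; have := nv u.
by rewrite inE yA.
Qed.

Definition served A (e : I) : R := (e.2 < count A e.1)%:R.

(** Feasibility of the indicator of an integral configuration. Apart from covering the request, this
    is what the serving step knows about offline sets. *)
Lemma sum_served A o S : (#|A| <= H)%N -> siblings o S ->
  \sum_(e in S) served A e <=
  if o is Some p then \sum_(e : I | (e.1 == p) && (e.2 < #|S|)%N) served A e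
  else (minn #|S| H)%:R.
Proof.
move=> AH /forall_inP sib.
have natS : \sum_(e in S) served A e = (\sum_(e in S) (e.2 < count A e.1))%:R.
  by rewrite natr_sum.
have leS : (\sum_(e in S) (e.2 < count A e.1) <= #|S|)%N.
  by rewrite -sum1_card; apply: leq_sum => e _; case: (_ < _)%N.
have leK : (\sum_(e in S) (e.2 < count A e.1) <= \sum_(v | par v == o) count A v)%N.
  apply: (@leq_trans (\sum_(v | par v == o) \sum_(i < H) (i < count A v))).
    rewrite pair_big /= [leqLHS]big_mkcond [leqRHS]big_mkcond /=.
    apply: leq_sum => -[v i] _ /=; case: ifP => // /sib /= /eqP ->.
    by rewrite eqxx.
  apply: leq_sum => v _.
  rewrite -big_mkcond /= sum1_card.
  have := card_own v (count A v); rewrite -sum1_card.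
  under eq_bigl do rewrite inE.
  rewrite -(pair_big (fun u => u == v) (fun i : 'I_H => (i < count A v)%N) (fun _ _ => 1%N)) /=.
  rewrite big_pred1_eq sum1_card => ->; exact: geq_minl.
rewrite natS; case: o {sib} leK => [p|] leK; last first.
  by rewrite ler_nat leq_min leS (leq_trans leK) // (sum_count None).
have -> : \sum_(e : I | (e.1 == p) && (e.2 < #|S|)%N) served A e =
    (minn (minn #|S| (count A p)) H)%:R.
  rewrite -(sum1_own p).
  rewrite big_mkcond [RHS]big_mkcond /=; apply: eq_bigr => -[u i] _ /=.
  rewrite /served leq_min /=; case: eqP => //= ->.
  by case: (i < #|S|)%N; case: (i < count A p)%N.
rewrite ler_nat !leq_min leS (leq_trans leK (sum_count (Some p) AH)) /=.
rewrite (leq_trans leK) // (leq_trans (sum_count (Some p) AH)) //.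
apply: leq_trans AH; apply: subset_leq_card; apply/fintype.subsetP => y.
by rewrite inE => /andP[].
Qed.

End Chain.

Section Potential.
Context {R : realType} {U X : finType} (fr : forest U X) (H : nat).
Variables (w lo up : U -> R) (delta : R).

Notation I := (U * 'I_H)%type.
Notation par := (fpar fr).
Notation anc := (fanc fr).
Implicit Types (z x : I -> R) (o : option U) (S : {set I}) (A : {set X}).

Definition cost_weight A (e : I) : R := 1 - (1 - delta) * served fr A e.

(* The maximum makes [log_gain] continuous on the whole line; it is inactive
   for arguments at most 1. *)
Definition log_gain (t : R) : R := ln ((1 + delta) / Num.max delta (1 + delta - t)).

(** The linear term is matched to [charge]: the slope of potential plus charge is [w] times the
    quotient of [cost_weight] by [1 + delta - z], less [lo] where the mass grows and less [up] where
    it shrinks. *)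
Definition potential A z : R :=
  \sum_e w e.1 * (cost_weight A e * log_gain (z e) - (lo e.1 + up e.1) / 2 * z e).

Definition charge z z' : R :=
  \sum_u w u * ((up u - lo u) / 2) * `|mass z' u - mass z u|.

Hypothesis w_ge0 : forall u, 0 <= w u.
Hypothesis delta01 : 0 < delta <= 1.
Hypothesis lo_ge0 : forall u, 0 <= lo u.
Hypothesis lo_le_up : forall u, lo u <= up u.
Hypothesis up_le_half : forall u, up u <= 2^-1.
Hypothesis up_le_lo : forall u v, par v = Some u -> up v <= lo u.

(** Moving along [g - Q] respects every tight constraint. Tightness turns the sum of [1 + delta - z]
    over [S] into the sum over the parent's items, up to [1 + delta] for each of the
    [#|S| - minn #|S| H] missing items; labels only grow towards the parent, and
    [beta * (1 + delta) <= 1] absorbs the missing items. At the virtual root the bound [2^-1] on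
    labels takes over. *)
Lemma bracket z o S (Q g : I -> R) (beta : U -> R) :
  feasible fr z -> siblings fr o S -> \sum_(e in S) z e = capacity z o #|S| ->
  (forall v, lo v <= beta v <= up v) ->
  (forall e, g e = beta e.1 * (1 + delta - z e)) ->
  #|S|%:R - (if o is Some p then \sum_(e : I | (e.1 == p) && (e.2 < #|S|)%N) (1 - Q e)
             else (1 - delta) * (minn #|S| H)%:R) <= \sum_(e in S) Q e ->
  (if o is Some p then \sum_(e : I | (e.1 == p) && (e.2 < #|S|)%N) (Q e - g e) else 0)
   <= \sum_(e in S) (Q e - g e).
Proof.
move=> fz /forall_inP sib tight bnd gE.
have [d0 d1] := andP delta01.
have X0 e : 0 <= 1 + delta - z e by have := feasible_le1 fz e; lra.
have SX : \sum_(e in S) (1 + delta - z e) = (1 + delta) * #|S|%:R - capacity z o #|S|.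
  by rewrite sumrB tight sumr_const mulr_natr.
have leB (B : R) : (forall e, e \in S -> beta e.1 <= B) ->
    \sum_(e in S) g e <= B * ((1 + delta) * #|S|%:R - capacity z o #|S|).
  move=> lB; rewrite -SX mulr_sumr; apply: ler_sum => e eS.
  by rewrite gE ler_wpM2r // lB.
rewrite sumrB.
have mS : ((minn #|S| H)%:R : R) <= #|S|%:R by rewrite ler_nat geq_minl.
case: o sib tight SX leB => [p|] sib tight SX leB QS; last first.
  have := leB (2^-1) _; rewrite /capacity => lg.
  have {}lg := lg (fun e _ => le_trans (andP (bnd e.1)).2 (up_le_half _)).
  have m0 : 0 <= (minn #|S| H)%:R :> R by rewrite ler0n.
  nra.
have {}leB := leB (beta p) _.
have {}leB : \sum_(e in S) g e <= beta p * ((1 + delta) * #|S|%:R - capacity z (Some p) #|S|).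
  apply: leB => e eS; have /eqP := sib e eS => /up_le_lo.
  by have := bnd e.1; have := bnd p; lra.
have gown : \sum_(e : I | (e.1 == p) && (e.2 < #|S|)%N) g e =
    beta p * ((1 + delta) * (minn #|S| H)%:R - capacity z (Some p) #|S|).
  rewrite /capacity -(sum1_own H p).
  rewrite mulr_sumr -sumrB mulr_sumr; apply: eq_bigr => e /andP[/eqP ep _].
  by rewrite gE ep mulr1.
have Qown : \sum_(e : I | (e.1 == p) && (e.2 < #|S|)%N) (1 - Q e) =
    (minn #|S| H)%:R - \sum_(e : I | (e.1 == p) && (e.2 < #|S|)%N) Q e.
  by rewrite sumrB (sum1_own H p).
rewrite sumrB gown; rewrite Qown in QS.
have bp : 0 <= beta p <= 2^-1.
  by have := bnd p; have := lo_ge0 p; have := up_le_half p; lra.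
have b1 : beta p * (1 + delta) <= 1 by nra.
have := ler_wpM2r (_ : 0 <= #|S|%:R - (minn #|S| H)%:R) b1.
rewrite subr_ge0 => /(_ mS); lra.
Qed.

Lemma cost_weight_bound A o S : (#|A| <= H)%N -> siblings fr o S ->
  #|S|%:R - (if o is Some p then \sum_(e : I | (e.1 == p) && (e.2 < #|S|)%N) (1 - cost_weight A e)
             else (1 - delta) * (minn #|S| H)%:R) <= \sum_(e in S) cost_weight A e.
Proof.
move=> AH sib; have := sum_served (R := R) AH sib; have [d0 d1] := andP delta01.
rewrite /cost_weight sumrB sumr_const -mulr_sumr -[X in _ <= X - _]/(#|S|%:R) => le.
rewrite lerD2l lerN2; case: o sib le => [p|] sib le; last first.
  by rewrite ler_wpM2l ?subr_ge0.
under [leRHS]eq_bigr do rewrite opprB addrC subrK.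
by rewrite -mulr_sumr ler_wpM2l ?subr_ge0.
Qed.

(* Linearisation of [potential A z + charge z z'] at [z' = z], for the choice
   of signs [sg] in the absolute values of [charge]. *)
Definition slope z A (sg : U -> bool) (e : I) : R :=
  w e.1 * (cost_weight A e / (1 + delta - z e) - (lo e.1 + up e.1) / 2
           + (up e.1 - lo e.1) / 2 * (-1) ^+ sg e.1).

(** Gradients of the constraints that are active at [z]. Inactive ones are replaced by 0, so that
    the index type does not depend on [z]. *)
Definition gradA z (j : (option U * {set I}) + I) (e : I) : R :=
  match j with
  | inl (o, S0) =>
      if siblings fr o S0 && (\sum_(e in S0) z e == capacity z o #|S0|)
      then ((o == Some e.1) && (e.2 < #|S0|)%N)%:R - (e \in S0)%:R else 0
  | inr e' => if z e' == 0 then (e == e')%:R else 0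
  end.

Lemma sum_gradA z j x : \sum_e gradA z j e * x e =
  match j with
  | inl (o, S0) =>
      if siblings fr o S0 && (\sum_(e in S0) z e == capacity z o #|S0|)
      then (if o is Some p then \sum_(e : I | (e.1 == p) && (e.2 < #|S0|)%N) x e else 0)
           - \sum_(e in S0) x e else 0
  | inr e' => if z e' == 0 then x e' else 0
  end.
Proof.
case: j => [j|e']; [case: j => o S|]; rewrite /=; case: ifP => _; try by rewrite big1 // => e _; rewrite mul0r.
  under eq_bigr do rewrite mulrBl; rewrite sumrB; congr (_ - _); last first.
    rewrite [RHS]big_mkcond; apply: eq_bigr => e _.
    by case: (e \in S); rewrite ?mul1r ?mul0r.
  case: o => [p|]; last by rewrite big1 // => e _; rewrite mul0r.
  rewrite [RHS]big_mkcond; apply: eq_bigr => e _.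
  rewrite (inj_eq Some_inj) [p == _]eq_sym.
  by case: (_ && _); rewrite ?mul1r ?mul0r.
rewrite (bigD1 e') //= eqxx mul1r big1 ?addr0 // => e /negbTE ->.
by rewrite mul0r.
Qed.

(** Otherwise Gordan's multipliers average weights and signs into [Q] and [beta]. Paired with
    [phi = Q - g], cut off suitably, the averaged slope becomes a weighted sum of squares of [phi],
    positive because [phi e0 < 0]; the multipliers, however, make the same pairing nonpositive,
    since [- phi] is an admissible direction by [bracket]. *)
Lemma descent_direction z (e0 : I) (d0 : R) (y : X) :
  feasible fr z -> (forall A, y \in A -> served fr A e0 = 1 :> R) ->
  (0 < H)%N ->
  0 < w e0.1 -> 4^-1 <= lo e0.1 -> delta <= d0 / 4 -> z e0 < 1 - d0 ->
  exists x, (forall j, 0 <= \sum_e gradA z j e * x e) /\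
   forall A sg, y \in A -> (#|A| <= H)%N -> \sum_e slope z A sg e * x e < 0.
Proof.
move=> fz A0 H0 w0 lo0 dd0 ze0.
have [d0' d1] := andP delta01.
pose valid A := (y \in A) && (#|A| <= H)%N.
(* Sets that miss [y] or are too large are replaced by [[set y]], so that the alternative can be
   stated over a whole finite type. *)
pose eff A := if valid A then A else [set y].
have effP A : (y \in eff A) /\ (#|eff A| <= H)%N.
  by rewrite /eff; case: ifP => [/andP[]|_] //; rewrite set11 cards1.
pose f (t : {set X} * {ffun U -> bool}) (e : I) := slope z (eff t.1) t.2 e.
case: (farkas_strict (gradA z) f) => [[x [ax fx]]|].
  exists x; split=> // A sg yA AH.
  have := fx (A, finfun sg); rewrite /f /eff /valid /= yA AH /=.
  by congr (_ < _); apply: eq_bigr => e _; rewrite /slope ffunE.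
move=> [l [p [l0 p0 p1 lE]]]; exfalso.
pose Q e := \sum_t p t * cost_weight (eff t.1) e.
pose sigma u := \sum_t p t * (-1) ^+ (t.2 u : bool) : R.
pose beta u := (lo u + up u) / 2 - (up u - lo u) / 2 * sigma u.
pose g e := beta e.1 * (1 + delta - z e).
pose phi e := Q e - g e.
(* The cut-off makes [- phh] respect the constraints [0 <= z] where [z] vanishes. *)
pose phh e := if (z e == 0) && (0 < phi e) then 0 else phi e.
have zle1 := feasible_le1 fz.
have X0 e : 0 < 1 + delta - z e by have := zle1 e; lra.
have sig1 u : -1 <= sigma u <= 1.
  have -> : 1 = \sum_t p t * 1 :> R by under eq_bigr do rewrite mulr1.
  rewrite -sumrN; apply/andP; split; apply: ler_sum => t _.
    by rewrite -mulrN ler_wpM2l //; case: (t.2 u); rewrite ?expr1 ?expr0; lra.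
  by rewrite ler_wpM2l //; case: (t.2 u); rewrite ?expr1 ?expr0; lra.
have bb u : lo u <= beta u <= up u.
  by have := sig1 u; have := lo_le_up u; rewrite /beta; nra.
have lhsE e : \sum_t p t * f t e = w e.1 * (phi e / (1 + delta - z e)).
  rewrite /f /slope /phi /g /Q.
  rewrite (eq_bigr (fun t : {set X} * {ffun U -> bool} =>
     w e.1 / (1 + delta - z e) * (p t * cost_weight (eff t.1) e)
     - w e.1 * ((lo e.1 + up e.1) / 2) * p t
     + w e.1 * ((up e.1 - lo e.1) / 2) * (p t * (-1) ^+ t.2 e.1))); last first.
    by move=> t _; ring.
  rewrite big_split /= sumrB -!mulr_sumr p1 -/(sigma e.1) /beta.
  by field; rewrite gt_eqF.
have key : \sum_e phh e * (w e.1 * (phi e / (1 + delta - z e))) <= 0.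
  have -> : \sum_e phh e * (w e.1 * (phi e / (1 + delta - z e))) =
      \sum_j l j * \sum_e gradA z j e * phh e.
    under eq_bigr do rewrite -lhsE lE mulr_sumr.
    rewrite exchange_big /=; apply: eq_bigr => j _.
    by rewrite mulr_sumr; apply: eq_bigr => e _; ring.
  rewrite -oppr_ge0 -sumrN; apply: sumr_ge0 => j _.
  rewrite -mulrN mulr_ge0 // oppr_ge0 sum_gradA.
  case: j => [j|e']; [case: j => o S|]; case: ifP => //; last first.
    by move=> z0; rewrite /phh z0 /=; case: ltP.
  move=> /andP[sib /eqP tight].
  (* The items cut off have extent 0, so [S'] is still tight. The parent's items of rank between
     [#|S'|] and [#|S|] must then have extent 0 too, and [phh <= 0] there. *)
  pose S' := [set e in S | ~~ ((z e == 0) && (0 < phi e))].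
  have sumS (F : I -> R) : (forall e, e \in S -> (z e == 0) && (0 < phi e) -> F e = 0) ->
      \sum_(e in S) F e = \sum_(e in S') F e.
    move=> F0; rewrite [RHS](eq_bigl (fun e => (e \in S) && ~~ ((z e == 0) && (0 < phi e)))); last by move=> e; rewrite inE.
    rewrite [LHS](bigID (fun e => (z e == 0) && (0 < phi e))) /= big1 ?add0r //.
    by move=> e /andP[]; exact: F0.
  have phS : \sum_(e in S) phh e = \sum_(e in S') phi e.
    rewrite sumS => [|e _ h]; last by rewrite /phh h.
    by apply: eq_bigr => e; rewrite inE /phh => /andP[_ /negbTE ->].
  have zS : \sum_(e in S) z e = \sum_(e in S') z e.
    by apply: sumS => e _ /andP[/eqP].
  have sib' : siblings fr o S'.
    by apply/forall_inP => e; rewrite inE => /andP[eS _]; exact: (forall_inP sib).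
  have cS : (#|S'| <= #|S|)%N by rewrite subset_leq_card //; apply/fintype.subsetP => e; rewrite inE => /andP[].
  have zcap := fz.2 _ _ sib'.
  have capm : capacity z o #|S'| <= capacity z o #|S|.
    rewrite /capacity; case: (o) => [q|]; last by rewrite ler_nat leq_min geq_minr andbT geq_min cS.
    rewrite [leRHS](bigID (fun e : I => (e.2 < #|S'|)%N)) /= -[leLHS]addr0 lerD //.
      rewrite [leRHS](eq_bigl (fun e : I => (e.1 == q) && (e.2 < #|S'|)%N)) // => e.
      rewrite -andbA; congr (_ && _); apply/andP/idP => [[]//|eS'].
      by rewrite (leq_trans eS').
    by apply: sumr_ge0 => e _; exact: fz.1.
  have tight' : \sum_(e in S') z e = capacity z o #|S'|.
    by apply/eqP; rewrite eq_le zcap /= -zS tight.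
  have QS : #|S'|%:R - (if o is Some p then \sum_(e : I | (e.1 == p) && (e.2 < #|S'|)%N) (1 - Q e)
             else (1 - delta) * (minn #|S'| H)%:R) <= \sum_(e in S') Q e.
    rewrite /Q exchange_big /=.
    have -> : #|S'|%:R = \sum_t p t * #|S'|%:R :> R by rewrite -mulr_suml p1 mul1r.
    have -> : (if o is Some p1 then \sum_(e : I | (e.1 == p1) && (e.2 < #|S'|)%N) (1 - \sum_t p t * cost_weight (eff t.1) e) else (1 - delta) * (minn #|S'| H)%:R) =
      \sum_t p t * (if o is Some p1 then \sum_(e : I | (e.1 == p1) && (e.2 < #|S'|)%N) (1 - cost_weight (eff t.1) e) else (1 - delta) * (minn #|S'| H)%:R).
      case: (o) => [q|]; last by rewrite -mulr_suml p1 mul1r.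
      under [RHS]eq_bigr do rewrite mulr_sumr.
      rewrite [RHS]exchange_big /=; apply: eq_bigr => e _.
      by under [RHS]eq_bigr do rewrite mulrBr mulr1; rewrite sumrB p1.
    rewrite -sumrB; apply: ler_sum => t _.
    rewrite -mulrBr -mulr_sumr ler_wpM2l //.
    by have [_ eH] := effP t.1; apply: cost_weight_bound.
  have br := bracket fz sib' tight' bb (fun e => erefl (g e)) QS.
  rewrite subr_le0 phS; apply: le_trans br.
  case: (o) tight' tight capm => // q tight' tight _.
  rewrite (bigID (fun e : I => (e.2 < #|S'|)%N)) /=.
  have own0 : \sum_(e : I | (e.1 == q) && (e.2 < #|S|)%N && ~~ (e.2 < #|S'|)%N) z e = 0.
    move: tight; rewrite zS tight' /capacity => /esym.
    rewrite [LHS](bigID (fun e : I => (e.2 < #|S'|)%N)) /=.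
    rewrite (eq_bigl (fun e : I => (e.1 == q) && (e.2 < #|S'|)%N)); last first.
      move=> e; rewrite -andbA; congr (_ && _); apply/andP/idP => [[]//|eS'].
      by rewrite (leq_trans eS').
    by move/eqP; rewrite -subr_eq0 addrAC subrr add0r => /eqP.
  have z0 (e : I) : (e.1 == q) && (e.2 < #|S|)%N && ~~ (e.2 < #|S'|)%N -> z e = 0.
    by apply: psumr_eq0P own0 e => e _; exact: fz.1.
  rewrite -[leRHS]addr0 lerD //.
    rewrite (eq_bigl (fun e : I => (e.1 == q) && (e.2 < #|S'|)%N)); last first.
      move=> e; rewrite -andbA; congr (_ && _); apply/andP/idP => [[]//|eS'].
      by rewrite (leq_trans eS').
    by apply: ler_sum => e _; rewrite /phh -/(phi e); case: ifP => // /andP[_ /ltW].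
  apply: sumr_le0 => e /z0 ze; rewrite /phh ze eqxx /=.
  by case: ltP.
have term_ge0 e : 0 <= phh e * (w e.1 * (phi e / (1 + delta - z e))).
  rewrite /phh; case: ifP => _; first by rewrite mul0r.
  rewrite (_ : _ * _ = w e.1 * (phi e ^+ 2 / (1 + delta - z e))); last by ring.
  by rewrite mulr_ge0 // divr_ge0 ?sqr_ge0 // ltW.
have Q0 : Q e0 = delta.
  rewrite /Q (eq_bigr (fun t => p t * delta)) => [|t _].
    by rewrite -mulr_suml p1 mul1r.
  have [yA _] := effP t.1; rewrite /cost_weight A0 // mulr1; congr (_ * _); ring.
(* Here the constants meet: [beta >= 4^-1] and [1 + delta - z e0 > d0 + delta >= 5 * delta], so
   [g e0] exceeds [delta = Q e0]. *)
have phi0 : phi e0 < 0.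
  rewrite /phi Q0 /g; have := bb e0.1; have := X0 e0; nra.
suff : 0 < \sum_e phh e * (w e.1 * (phi e / (1 + delta - z e))) by rewrite ltNge key.
rewrite (bigD1 e0) //= ltr_pwDl //; last by apply: sumr_ge0.
have -> : phh e0 = phi e0 by rewrite /phh [0 < _]ltNge (ltW phi0) andbF.
rewrite (_ : _ * _ = w e0.1 * (phi e0 ^+ 2 / (1 + delta - z e0))); last by ring.
by rewrite mulr_gt0 // divr_gt0 // exprn_even_gt0 //= lt_eqF.
Qed.

End Potential.

Section LogGain.
Context {R : realType} (delta : R).
Hypothesis delta01 : 0 < delta <= 1.

Let d_gt0 : 0 < delta. Proof. by case/andP: delta01. Qed.

Lemma max_delta_gt0 t : 0 < Num.max delta (1 + delta - t).
Proof. by rewrite lt_max d_gt0. Qed.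

Lemma log_gain0 : log_gain delta 0 = 0.
Proof.
rewrite /log_gain subr0 max_r ?lerDr // divff ?ln1 // gt_eqF //.
by rewrite addr_gt0.
Qed.

Lemma log_gain_ge0 t : 0 <= t -> 0 <= log_gain delta t.
Proof.
move=> t0; apply: ln_ge0; rewrite ler_pdivlMr ?max_delta_gt0 // mul1r.
by rewrite ge_max; have := d_gt0; lra.
Qed.

Lemma log_gain_le t : log_gain delta t <= ln ((1 + delta) / delta).
Proof.
have d1 : 0 < 1 + delta by rewrite addr_gt0.
rewrite ler_ln ?posrE ?divr_gt0 ?max_delta_gt0 //.
by rewrite ler_pM2l // lef_pV2 ?posrE ?max_delta_gt0 // le_max lexx.
Qed.

(** With [X = 1 + delta - t] the left side is [- ln (1 - s / X)]; the bound is its expansion to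
    second order, valid for [s <= X / 2]. *)
Lemma log_gain_step t s : t <= 1 -> t + s <= 1 ->
  s <= (1 + delta - t) / 2 ->
  log_gain delta (t + s) - log_gain delta t <=
    s / (1 + delta - t) + s ^+ 2 * (2 / (1 + delta - t) ^+ 2).
Proof.
move=> t1 ts1 sX; have d0 := d_gt0; have d1 : 0 < 1 + delta by rewrite addr_gt0.
have mX : Num.max delta (1 + delta - t) = 1 + delta - t by rewrite max_r //; lra.
have mXs : Num.max delta (1 + delta - (t + s)) = 1 + delta - t - s.
  by rewrite max_r; [ring|lra].
set X := 1 + delta - t in mX mXs sX *.
have X0 : 0 < X by rewrite /X; lra.
have Xs0 : 0 < X - s by rewrite /X; lra.
rewrite /log_gain mX mXs.
rewrite -ln_div ?posrE ?divr_gt0 //.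
have -> : (1 + delta) / (X - s) / ((1 + delta) / X) = 1 + s / (X - s).
  by field; rewrite !gt_eqF.
apply: (le_trans (le_ln1Dx _)).
  rewrite -(ltrD2l 1) subrr (_ : 1 + s / (X - s) = X / (X - s)) ?divr_gt0 //.
  by field; rewrite gt_eqF.
have -> : s / (X - s) = s / X + s ^+ 2 * (X * (X - s))^-1.
  by field; rewrite ?gt_eqF.
rewrite lerD2l ler_wpM2l ?sqr_ge0 // ler_pdivlMr ?exprn_gt0 //.
have -> : (X * (X - s))^-1 * X ^+ 2 = X / (X - s) by field; rewrite ?gt_eqF.
by rewrite ler_pdivrMr //; lra.
Qed.

Lemma continuous_log_gain : continuous (log_gain delta : R -> R).
Proof.
move=> t; rewrite /log_gain.
apply: (@continuous_comp R R R (fun t => (1 + delta) / Num.max delta (1 + delta - t)) (@ln R) t).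
  apply: cvgM; first exact: cvg_cst.
  apply: cvgV; first by rewrite gt_eqF ?max_delta_gt0.
  have := @continuous_max _ R (fun=> delta) (fun t => 1 + delta - t) t.
  apply; first exact: cvg_cst.
  by apply: cvgB; [exact: cvg_cst | exact: cvg_id].
by apply: continuous_ln; rewrite divr_gt0 ?max_delta_gt0 ?addr_gt0.
Qed.

End LogGain.

Section Continuity.
Context {R : realType} {T : topologicalType}.

Lemma sum_continuous (J : finType) (P : pred J) (F : J -> T -> R) :
  (forall j, continuous (F j)) -> continuous (fun z => \sum_(j | P j) F j z).
Proof. by move=> cF; apply: continuous_big => //; exact: add_continuous. Qed.

Lemma mulc_continuous (c : R) (F : T -> R) :
  continuous F -> continuous (fun z => c * F z).
Proof. by move=> cF z; apply: cvgM; [exact: cvg_cst | exact: cF]. Qed.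

Lemma sub_continuous (F G : T -> R) :
  continuous F -> continuous G -> continuous (fun z => F z - G z).
Proof. by move=> cF cG z; apply: cvgB; [exact: cF | exact: cG]. Qed.

Lemma cst_continuous' (c : R) : continuous (fun _ : T => c).
Proof. by move=> z; exact: cvg_cst. Qed.

Lemma max_continuous (F G : T -> R) :
  continuous F -> continuous G -> continuous (fun z => Num.max (F z) (G z)).
Proof.
move=> cF cG z; have := @continuous_max _ T F G z.
by apply; [exact: cF | exact: cG].
Qed.

Lemma norm_continuous' (F : T -> R) :
  continuous F -> continuous (fun z => `|F z|).
Proof. by move=> cF z; apply: cvg_norm; exact: cF. Qed.

Lemma log_gain_continuous (delta : R) (F : T -> R) : 0 < delta <= 1 ->
  continuous F -> continuous (fun z => log_gain delta (F z)).
Proof.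
move=> d01 cF z; apply: (@continuous_comp _ _ _ F (log_gain delta)); first exact: cF.
exact: continuous_log_gain.
Qed.

End Continuity.

(** * The serving step *)

Section Serve.
Context {R : realType} {U X : finType} (fr : forest U X) (H : nat).
Variables (lo up : U -> R) (delta : R).

Notation I := (U * 'I_H)%type.
Notation par := (fpar fr).
Notation anc := (fanc fr).
Implicit Types (w : U -> R) (z x : I -> R) (o : option U) (S : {set I}) (A : {set X}).
Let T : topologicalType := prod_topology (fun _ : I => (R : topologicalType)).
Notation pot w := (potential fr w lo up delta).
Notation chg w := (charge w lo up).

Hypothesis delta01 : 0 < delta <= 1.
Hypothesis lo_ge0 : forall u, 0 <= lo u.
Hypothesis lo_le_up : forall u, lo u <= up u.
Hypothesis up_le_half : forall u, up u <= 2^-1.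
Hypothesis up_le_lo : forall u v, par v = Some u -> up v <= lo u.

Lemma cost_weight01 A (e : I) : 0 <= cost_weight fr delta A e <= 1.
Proof.
have [d0 d1] := andP delta01.
by rewrite /cost_weight /served; case: (e.2 < _)%N => /=; lra.
Qed.

Lemma charge_ge0 w z z' : (forall u, 0 <= w u) -> 0 <= chg w z z'.
Proof.
move=> w0; apply: sumr_ge0 => u _; rewrite mulr_ge0 // mulr_ge0 //.
by rewrite divr_ge0 // subr_ge0.
Qed.

Lemma charge_triangle w z z' z'' : (forall u, 0 <= w u) ->
  chg w z z'' <= chg w z z' + chg w z' z''.
Proof.
move=> w0; rewrite /charge -big_split /=; apply: ler_sum => u _.
rewrite -mulrDr ler_wpM2l //; first by rewrite mulr_ge0 // divr_ge0 // subr_ge0.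
have -> : mass z'' u - mass z u = (mass z' u - mass z u) + (mass z'' u - mass z' u) by ring.
exact: ler_normD.
Qed.

Lemma potential_continuous w A : continuous (pot w A : T -> R).
Proof.
apply: sum_continuous => e; apply: mulc_continuous; apply: sub_continuous.
  apply: mulc_continuous; apply: log_gain_continuous => //.
  exact: coordinate_continuous.
by apply: mulc_continuous; exact: coordinate_continuous.
Qed.

Lemma mass_continuous u : continuous ((fun z => mass z u) : T -> R).
Proof. by apply: sum_continuous => i; exact: coordinate_continuous. Qed.

Lemma charge_continuous w z : continuous (chg w z : T -> R).
Proof.
apply: sum_continuous => u; apply: mulc_continuous; apply: norm_continuous'.
by apply: sub_continuous; [exact: mass_continuous | exact: cst_continuous'].
Qed.

Definition room (j : option U * {set I}) (z : I -> R) : R :=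
  if siblings fr j.1 j.2 then capacity z j.1 #|j.2| - \sum_(e in j.2) z e else 0.

Lemma room_continuous j : continuous (room j : T -> R).
Proof.
rewrite /room; have [_|_] := boolP (siblings fr j.1 j.2); last exact: cst_continuous'.
apply: sub_continuous; last by apply: sum_continuous => e; exact: coordinate_continuous.
rewrite /capacity; case: (j.1) => [p|]; last exact: cst_continuous'.
by apply: sum_continuous => e; exact: coordinate_continuous.
Qed.

Lemma feasibleE z : feasible fr z <-> (forall e, 0 <= z e <= 1) /\ forall j, 0 <= room j z.
Proof.
split=> [fz|[z01 rz]].
  split=> [e|[q S]]; first by rewrite fz.1 (feasible_le1 fz).
  by rewrite /room /=; case: ifP => // sib; rewrite subr_ge0; exact: fz.2.
split=> [e|o S sib]; first by case/andP: (z01 e).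
by have := rz (o, S); rewrite /room /= sib subr_ge0.
Qed.

Lemma mass_shift z x (s : R) u : mass (fun e => z e + s * x e) u = mass z u + s * mass x u.
Proof. by rewrite /mass big_split mulr_sumr. Qed.

Lemma roomD j z x (s : R) : siblings fr j.1 j.2 ->
  room j (fun e => z e + s * x e) = room j z + s *
    ((if j.1 is Some p then \sum_(e : I | (e.1 == p) && (e.2 < #|j.2|)%N) x e else 0)
     - \sum_(e in j.2) x e).
Proof.
case: j => o S /= sib; rewrite /room /= sib /capacity !big_split /= -mulr_sumr.
case: o {sib} => [p|]; last by ring.
by rewrite big_split /= -mulr_sumr; ring.
Qed.

(** For a short step the first-order decrease beats the quadratic error of the logarithm. Only
    finitely many conditions bound the step length, so one length works for all sets in [B]. *)
Lemma descend w z x : (forall u, 0 <= w u) -> feasible fr z ->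
  (forall j, 0 <= \sum_e gradA fr z j e * x e) ->
  forall B : {set {set X}}, (forall A, A \in B -> forall sg,
     \sum_e slope fr w lo up delta z A sg e * x e < 0) ->
  exists z', feasible fr z' /\ forall A, A \in B ->
    pot w A z' + chg w z z' < pot w A z.
Proof.
move=> w0 fz gx B Bx.
have d0 : 0 < delta by case/andP: delta01.
have zle1 := feasible_le1 fz.
have X0 e : 0 < 1 + delta - z e by have := zle1 e; lra.
pose zs (s : R) e := z e + s * x e.
have affine_ok (a b : R) : 0 <= a -> (a = 0 -> 0 <= b) ->
    exists2 r, 0 < r & forall s, 0 < s <= r -> 0 <= a + s * b.
  move=> a0 ab; have [b0|b0] := leP 0 b.
    by exists 1 => // s /andP[s0 _]; rewrite addr_ge0 // mulr_ge0 // ltW.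
  have {}a0 : 0 < a.
    by rewrite lt_def a0 andbT; apply/eqP => /ab; rewrite leNgt b0.
  exists (a / - b); first by rewrite divr_gt0 // oppr_gt0.
  by move=> s /andP[s0]; rewrite ler_pdivlMr ?oppr_gt0 // mulrN; lra.
have [r1 r10 h1] : exists2 r, 0 < r & forall s, 0 < s <= r -> forall e, 0 <= zs s e.
  apply: small_eta => e; apply: affine_ok; first exact: fz.1.
  by move=> ze; have := gx (inr e); rewrite sum_gradA ze eqxx.
have [r2 r20 h2] : exists2 r, 0 < r & forall s, 0 < s <= r -> forall j, 0 <= room j (zs s).
  apply: small_eta => j; have [sib|nsib] := boolP (siblings fr j.1 j.2); last first.
    by exists 1 => // s _; rewrite /room (negbTE nsib).
  have [] := affine_ok (room j z) ((if j.1 is Some p then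
      \sum_(e : I | (e.1 == p) && (e.2 < #|j.2|)%N) x e else 0) - \sum_(e in j.2) x e).
  - by have /feasibleE[_] := fz; apply.
  - move: sib; case: j => o S /= sib; rewrite /room /= sib => tight; have := gx (inl (o, S)).
    by rewrite sum_gradA sib /= eq_sym -subr_eq0 tight eqxx.
  by move=> r r0 rr; exists r => // s /rr; rewrite -roomD.
have [r3 r30 h3] : exists2 r, 0 < r & forall s, 0 < s <= r -> forall e, s * x e <= (1 + delta - z e) / 2.
  apply: small_eta => e; have [] := affine_ok ((1 + delta - z e) / 2) (- x e).
  - by rewrite ltW // divr_gt0.
  - by move=> h; have := X0 e; lra.
  by move=> r r0 rr; exists r => // s /rr; lra.
pose M := \sum_e w e.1 * (x e ^+ 2 * (2 / (1 + delta - z e) ^+ 2)).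
have M0 : 0 <= M.
  apply: sumr_ge0 => e _; rewrite mulr_ge0 // mulr_ge0 ?sqr_ge0 // divr_ge0 ?sqr_ge0 //.
(* With the signs of the direction itself, the charge is linear in the step length. *)
pose sg u := mass x u < 0.
have [r4 r40 h4] : exists2 r, 0 < r & forall s, 0 < s <= r -> forall A, A \in B ->
    \sum_e slope fr w lo up delta z A sg e * x e + s * (M + 1) <= 0.
  apply: small_eta => A; have [AB|] := boolP (A \in B); last by exists 1.
  have f0 := Bx A AB sg; set F := \sum_e _ in f0 *.
  exists (- F / (M + 1)); first by rewrite divr_gt0 ?oppr_gt0 // ltr_wpDl.
  by move=> s /andP[_]; rewrite ler_pdivlMr ?ltr_wpDl // => h _; lra.
pose s := Num.min (Num.min r1 r2) (Num.min r3 r4).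
have s0 : 0 < s by rewrite !lt_min r10 r20 r30 r40.
have [s1 s2 s3 s4] : [/\ s <= r1, s <= r2, s <= r3 & s <= r4].
  by split; rewrite /s !ge_min lexx ?orbT.
have fzs : feasible fr (zs s).
  split=> [e|o S sib]; first by apply: h1; rewrite s0.
  by have := h2 s _ (o, S); rewrite s0 s2 /room /= sib subr_ge0; apply.
exists (zs s); split=> // A AB.
have := h4 s _ A AB; rewrite s0 s4 => /(_ isT) h.
have chE : chg w z (zs s) = s * \sum_e w e.1 * ((up e.1 - lo e.1) / 2 * (-1) ^+ sg e.1) * x e.
  rewrite sum_items mulr_sumr; apply: eq_bigr => u _ /=.
  rewrite mass_shift addrAC subrr add0r normrM (gtr0_norm s0) -mulr_sumr -/(mass x u).
  have -> : `|mass x u| = (-1) ^+ sg u * mass x u.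
    rewrite /sg; have [h'|h'] := ltP (mass x u) 0.
      by rewrite ltr0_norm // expr1 mulN1r.
    by rewrite ger0_norm // expr0 mul1r.
  by ring.
have poE : pot w A (zs s) - pot w A z <=
    s * (\sum_e w e.1 * (cost_weight fr delta A e / (1 + delta - z e) - (lo e.1 + up e.1) / 2) * x e) + s ^+ 2 * M.
  rewrite /potential -sumrB mulr_sumr mulr_sumr -big_split /=.
  apply: ler_sum => e _.
  suff hk : cost_weight fr delta A e * log_gain delta (zs s e) - (lo e.1 + up e.1) / 2 * zs s e -
     (cost_weight fr delta A e * log_gain delta (z e) - (lo e.1 + up e.1) / 2 * z e) <=
     s * ((cost_weight fr delta A e / (1 + delta - z e) - (lo e.1 + up e.1) / 2) * x e) +
     s ^+ 2 * (x e ^+ 2 * (2 / (1 + delta - z e) ^+ 2)).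
    apply: le_trans (le_trans _ (ler_wpM2l (w0 e.1) hk)) _; rewrite le_eqVlt; apply/orP; left; apply/eqP; ring.
  have q01 := cost_weight01 A e.
  have hl := log_gain_step delta01 (zle1 e) (feasible_le1 fzs e) (h3 s (introT andP (conj s0 s3)) e).
  set L := log_gain _ _ - _ in hl.
  have -> : cost_weight fr delta A e * log_gain delta (z e + s * x e) -
     (lo e.1 + up e.1) / 2 * (z e + s * x e) -
     (cost_weight fr delta A e * log_gain delta (z e) - (lo e.1 + up e.1) / 2 * z e)
     = cost_weight fr delta A e * L - s * ((lo e.1 + up e.1) / 2 * x e).
    by rewrite /L; ring.
  have hq : cost_weight fr delta A e * ((s * x e) ^+ 2 * (2 / (1 + delta - z e) ^+ 2)) <=
            (s * x e) ^+ 2 * (2 / (1 + delta - z e) ^+ 2).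
    rewrite ler_piMl //; last by case/andP: q01.
    by apply: mulr_ge0; [exact: sqr_ge0 | apply: divr_ge0 => //; exact: sqr_ge0].
  have := ler_wpM2l (andP q01).1 hl; rewrite mulrDr => hl'.
  have -> : s * ((cost_weight fr delta A e / (1 + delta - z e) - (lo e.1 + up e.1) / 2) * x e) +
     s ^+ 2 * (x e ^+ 2 * (2 / (1 + delta - z e) ^+ 2)) =
     cost_weight fr delta A e * (s * x e / (1 + delta - z e)) +
     (s * x e) ^+ 2 * (2 / (1 + delta - z e) ^+ 2) - s * ((lo e.1 + up e.1) / 2 * x e).
    by rewrite exprMn; ring.
  by lra.
have sE : \sum_e slope fr w lo up delta z A sg e * x e =
    (\sum_e w e.1 * (cost_weight fr delta A e / (1 + delta - z e) - (lo e.1 + up e.1) / 2) * x e)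
    + \sum_e w e.1 * ((up e.1 - lo e.1) / 2 * (-1) ^+ sg e.1) * x e.
  rewrite -big_split /=; apply: eq_bigr => e _; rewrite /slope.
  by move: ((-1) ^+ sg e.1) => t; ring.
move: h; rewrite sE; set P1 := \sum_e _ in poE *; set P2 := \sum_e _ in chE *.
rewrite chE => h.
have := ler_wpM2l (ltW s0) h; rewrite mulr0.
have : 0 < s * s by rewrite mulr_gt0.
by move: poE; rewrite expr2; nra.
Qed.

(** The sum of the potentials over [B] is minimised among the configurations whose charge is paid
    for by every set in [B]. If the minimiser were short at [e0], a descent from it would again be
    such a configuration, by the triangle inequality for [charge]. *)
Lemma serve_pos w z (y : X) (e0 : I) (d0 : R) : (forall u, 0 <= w u) ->
  feasible fr z -> (forall A, y \in A -> served fr A e0 = 1 :> R) -> (0 < H)%N ->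
  0 < w e0.1 -> 4^-1 <= lo e0.1 -> delta <= d0 / 4 ->
  exists z', [/\ feasible fr z', 1 - d0 <= z' e0 &
    forall A, y \in A -> (#|A| <= H)%N -> chg w z z' + pot w A z' <= pot w A z].
Proof.
move=> w0 fz A0 H0 we0 lo0 dd0.
pose B : {set {set X}} := [set A : {set X} | (y \in A) && (#|A| <= H)%N].
pose g (j : (option U * {set I}) + {set X}) (z' : T) : R :=
  match j with
  | inl j => room j z'
  | inr A => if A \in B then pot w A z - pot w A z' - chg w z z' else 0
  end.
have cg j : continuous (g j).
  case: j => [j|A]; first exact: room_continuous.
  rewrite /g; have [_|_] := boolP (A \in B); last exact: cst_continuous'.
  apply: sub_continuous; last exact: charge_continuous.
  by apply: sub_continuous; [exact: cst_continuous' | exact: potential_continuous].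
pose f (z' : T) : R := \sum_(A in B) pot w A z'.
have cf : continuous f by apply: sum_continuous => A; exact: potential_continuous.
have [zb zr] := (feasibleE z).1 fz.
have chg0 u : chg w u u = 0.
  by rewrite /charge big1 // => v _; rewrite subrr normr0 mulr0.
have [|z' /= [zb' gz'] zmin] := @box_min R I 1 _ g f cg cf.
  exists z; split=> // -[j|A]; first exact: zr.
  by rewrite /g; case: ifP => // _; rewrite chg0 subr0 subrr.
have fz' : feasible fr z' by apply/feasibleE; split=> // j; exact: (gz' (inl j)).
have R' A : A \in B -> chg w z z' + pot w A z' <= pot w A z.
  by move=> AB; have := gz' (inr A); rewrite /g AB; lra.
exists z'; split=> //; last by move=> A yA AH; apply: R'; rewrite inE yA.
rewrite leNgt; apply/negP => zlt.
have [x [gx sx]] := descent_direction w0 delta01 lo_ge0 lo_le_up up_le_half up_le_lo fz' A0 H0 we0 lo0 dd0 zlt.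
have [|z'' [fz'' z''lt]] := @descend w z' x w0 fz' gx B.
  by move=> A; rewrite inE => /andP[yA AH] sg; exact: sx.
have z''A : [set z : T | (forall i, 0 <= z i <= 1) /\ forall j, 0 <= g j z]%classic z''.
  have [zb2 zr2] := (feasibleE z'').1 fz''.
  split=> // -[j|A]; first exact: zr2.
  rewrite /g; case: ifP => // AB; have := z''lt A AB; have := R' A AB.
  by have := charge_triangle z z' z'' w0; lra.
have := zmin _ z''A; rewrite leNgt => /negP; apply.
have yB : [set y] \in B by rewrite inE set11 cards1.
rewrite /f; apply: ltr_sum => [|A AB].
  by apply/hasP; exists [set y]; rewrite ?mem_index_enum.
by have := z''lt A AB; have := charge_ge0 z' z'' w0; lra.
Qed.

(** Allows weight 0 at [e0], which on trees is the case for all points. A weight [s] is added at the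
    vertex of [e0]; the result of [serve_pos] then violates the conclusion for [w] by at most a
    constant times [s], so by compactness the least violation is 0. *)
Lemma serve w z (y : X) (e0 : I) (d0 : R) : (forall u, 0 <= w u) ->
  feasible fr z -> (forall A, y \in A -> served fr A e0 = 1 :> R) -> (0 < H)%N ->
  4^-1 <= lo e0.1 -> delta <= d0 / 4 ->
  exists z', [/\ feasible fr z', 1 - d0 <= z' e0 &
    forall A, y \in A -> (#|A| <= H)%N -> chg w z z' + pot w A z' <= pot w A z].
Proof.
move=> w0 fz A0 H0 lo0 dd0.
pose B : {set {set X}} := [set A : {set X} | (y \in A) && (#|A| <= H)%N].
pose f (z' : T) : R := \sum_(A in B) Num.max 0 (chg w z z' - (pot w A z - pot w A z')) +
   Num.max 0 (1 - d0 - z' e0).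
have cf : continuous f.
  have -> : f = fun z' => \sum_(A in B) Num.max 0 (chg w z z' - (pot w A z - pot w A z')) -
      (0 - Num.max 0 (1 - d0 - z' e0)) by apply: funext => z'; rewrite sub0r opprK.
  apply: sub_continuous.
    apply: sum_continuous => A; apply: max_continuous; first exact: cst_continuous'.
    apply: sub_continuous; first exact: charge_continuous.
    by apply: sub_continuous; [exact: cst_continuous' | exact: potential_continuous].
  apply: sub_continuous; first exact: cst_continuous'.
  apply: max_continuous; first exact: cst_continuous'.
  by apply: sub_continuous; [exact: cst_continuous' | exact: coordinate_continuous].
have [zb zr] := (feasibleE z).1 fz.
have [|z' /= [zb' gz'] zmin] := @box_min R I 1 _ room f room_continuous cf.
  by exists z.
have fz' : feasible fr z' by apply/feasibleE.
have f0 : f z' <= 0.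
  pose M : R := H%:R * (ln ((1 + delta) / delta) + 1).
  have ln0 : 0 <= ln ((1 + delta) / delta) :> R.
    have [d0' d1'] := andP delta01.
    by rewrite ln_ge0 // ler_pdivlMr //; lra.
  have M0 : 0 <= M by rewrite mulr_ge0 // addr_ge0.
  suff fs s : 0 < s -> f z' <= s * (#|B|%:R * M + 1).
    rewrite leNgt; apply/negP => fpos.
    have K0 : 0 < #|B|%:R * M + 1 by rewrite ltr_wpDl // mulr_ge0.
    have := fs (f z' / (#|B|%:R * M + 1) / 2) _.
    rewrite divr_gt0 ?divr_gt0 // => /(_ isT).
    by rewrite mulrAC divfK ?gt_eqF //; lra.
  move=> s0.
  pose w' u := w u + s * (u == e0.1)%:R.
  have w'0 u : 0 <= w' u by rewrite addr_ge0 // mulr_ge0 // ltW.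
  have we0 : 0 < w' e0.1 by rewrite /w' eqxx mulr1 ltr_wpDl.
  have [zs [fzs zs1 zsR]] := serve_pos w'0 fz A0 H0 we0 lo0 dd0.
  have [zsb zsr] := (feasibleE zs).1 fzs.
  apply: (le_trans (zmin zs (conj zsb zsr))).
  rewrite /f [Num.max 0 (1 - d0 - _)]max_l ?subr_le0 // addr0.
  apply: (@le_trans _ _ (\sum_(A in B) s * M)); last first.
    by rewrite sumr_const -mulr_natl; have := ltW s0; nra.
  apply: ler_sum => A; rewrite inE => /andP[yA AH].
  rewrite ge_max (mulr_ge0 (ltW s0) M0) /=.
  pose P A z := \sum_i (cost_weight fr delta A (e0.1, i) * log_gain delta (z (e0.1, i)) - (lo e0.1 + up e0.1) / 2 * z (e0.1, i)).
  have potE z1 : pot w' A z1 = pot w A z1 + s * P A z1.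
    rewrite /potential !sum_items.
    pose G u := \sum_i (cost_weight fr delta A (u, i) * log_gain delta (z1 (u, i)) - (lo u + up u) / 2 * z1 (u, i)).
    have -> : s * P A z1 = \sum_u s * (u == e0.1)%:R * G u.
      rewrite (bigD1 e0.1) //= eqxx mulr1 big1 ?addr0 // => u /negbTE ->.
      by rewrite mulr0 mul0r.
    rewrite -big_split; apply: eq_bigr => u _; rewrite /G mulr_sumr -big_split.
    by apply: eq_bigr => i _ /=; rewrite /w' mulrDl.
  have chgE : chg w z zs <= chg w' z zs.
    rewrite /charge; apply: ler_sum => u _; rewrite ler_wpM2r // ler_wpM2r //.
      by rewrite divr_ge0 // subr_ge0.
    by rewrite lerDl mulr_ge0 // ltW.
  have q01 := cost_weight01 A.
  have b01 : 0 <= (lo e0.1 + up e0.1) / 2 <= 1.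
    by have := lo_ge0 e0.1; have := lo_le_up e0.1; have := up_le_half e0.1; lra.
  have Pz : P A z <= H%:R * ln ((1 + delta) / delta).
    rewrite mulr_natl -[H in _ *+ H]card_ord -sumr_const; apply: ler_sum => i _.
    have := log_gain_le delta01 (z (e0.1, i)).
    have := log_gain_ge0 delta01 (andP (zb (e0.1, i))).1.
    by have := q01 (e0.1, i); have := zb (e0.1, i); nra.
  have Pzs : - H%:R <= P A zs.
    rewrite -[H in H%:R]card_ord -mulr_natl mulr1 -sum1_card natr_sum -sumrN.
    apply: ler_sum => i _.
    have := log_gain_ge0 delta01 (andP (zsb (e0.1, i))).1.
    by have := q01 (e0.1, i); have := zsb (e0.1, i); nra.
  have := zsR A yA AH; rewrite !potE /M.
  have := ler_wpM2l (ltW s0) Pz; have := ler_wpM2l (ltW s0) Pzs.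
  by move: chgE; lra.
have t1 A : 0 <= Num.max 0 (chg w z z' - (pot w A z - pot w A z')) by rewrite le_max lexx.
have S0 : 0 <= \sum_(A in B) Num.max 0 (chg w z z' - (pot w A z - pot w A z')) by apply: sumr_ge0.
have t2 : 0 <= Num.max 0 (1 - d0 - z' e0) by rewrite le_max lexx.
exists z'; split=> //.
  have : 1 - d0 - z' e0 <= Num.max 0 (1 - d0 - z' e0) by rewrite le_max lexx orbT.
  by move: f0; rewrite /f; lra.
move=> A yA AH.
have AB : A \in B by rewrite inE yA.
have : chg w z z' - (pot w A z - pot w A z') <= Num.max 0 (chg w z z' - (pot w A z - pot w A z')).
  by rewrite le_max lexx orbT.
have : Num.max 0 (chg w z z' - (pot w A z - pot w A z')) <= \sum_(A in B) Num.max 0 (chg w z z' - (pot w A z - pot w A z')).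
  by rewrite (bigD1 A) //= lerDl; apply: sumr_ge0.
by move: f0; rewrite /f; lra.
Qed.

End Serve.

Section PotentialBounds.
Context {R : realType} {U X : finType} (fr : forest U X) (H : nat).
Variables (w lo up : U -> R) (delta : R).
Implicit Types (z : U * 'I_H -> R) (A : {set X}).

(** Only items whose rank lies between the two counts change their weight, and for each of them
    [log_gain] is at most [ln ((1 + delta) / delta)]. *)
Lemma potential_move A A' z : (forall u, 0 <= w u) -> 0 < delta <= 1 ->
  feasible fr z ->
  potential fr w lo up delta A' z - potential fr w lo up delta A z <=
  ln ((1 + delta) / delta) * \sum_u w u * `|(count fr A' u)%:R - (count fr A u)%:R|.
Proof.
move=> w0 d01 fz; rewrite /potential -sumrB sum_items mulr_sumr; apply: ler_sum => u _.
have [d0 d1] := andP d01.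
set L := ln _.
have L0 : 0 <= L by rewrite ln_ge0 // ler_pdivlMr //; lra.
apply: (@le_trans _ _ (\sum_(i < H) w u * L * ((i < count fr A u)%:R - (i < count fr A' u)%:R) ^+ 2)).
  apply: ler_sum => i _ /=; rewrite -mulrBr.
  set l := log_gain _ _; set b := (_ + _) / 2.
  rewrite (_ : _ - _ = (cost_weight fr delta A' (u, i) - cost_weight fr delta A (u, i)) * l); last by ring.
  rewrite -mulrA ler_wpM2l //.
  have l0 : 0 <= l by apply: log_gain_ge0 => //; exact: fz.1.
  have lL : l <= L by exact: log_gain_le.
  rewrite /cost_weight /served /=.
  by case: (i < count fr A u)%N; case: (i < count fr A' u)%N => /=; nra.
rewrite -mulr_sumr -mulrA mulrCA ler_wpM2l // ler_wpM2l //.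
wlog le : A A' / (count fr A u <= count fr A' u)%N => [th|].
  case/orP: (leq_total (count fr A u) (count fr A' u)) => h; first exact: th.
  rewrite distrC; apply: le_trans (th _ _ h).
  by apply: ler_sum => i _; rewrite -sqrrN opprB.
rewrite ger0_norm ?subr_ge0 ?ler_nat // -natrB //.
rewrite (eq_bigr (fun i : 'I_H => ((count fr A u <= i < count fr A' u)%N : nat)%:R)); last first.
  move=> i _; rewrite [in RHS]leqNgt; case: (ltnP i (count fr A u)) => h1.
    by rewrite (leq_trans h1 le) subrr expr0n.
  by case: (ltnP i (count fr A' u)) => _; rewrite ?sub0r ?sqrrN ?subr0 ?expr1n ?expr0n.
rewrite -natr_sum ler_nat.
suff -> : (\sum_(i < H) (count fr A u <= i < count fr A' u) =
    minn H (count fr A' u) - minn H (count fr A u))%N by lia.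
elim: H => [|n IH]; first by rewrite big_ord0 !min0n.
by rewrite big_ord_recr /= IH; case: leqP => h1; case: ltnP => h2 /=; lia.
Qed.

Lemma potential0 A : 0 < delta <= 1 ->
  potential fr w lo up delta A (fun _ : U * 'I_H => 0) = 0.
Proof. by move=> d01; rewrite /potential big1 // => e _; rewrite log_gain0 //; ring. Qed.

End PotentialBounds.

(** Turns a step that merely exists into an online algorithm, by choice and a fold over the
    requests. States that violate the invariant are left unchanged, which makes the chosen step
    total. *)
Lemma online_run (X : Type) (St : Type) (Inv : seq X -> St -> Prop)
    (Step : seq X -> X -> St -> St -> Prop) :
  (exists st, Inv [::] st) ->
  (forall s x st, Inv s st -> exists st', Inv (rcons s x) st' /\ Step s x st st') ->
  exists run : seq X -> St, (forall s, Inv s (run s)) /\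
    forall s x, Step s x (run s) (run (rcons s x)).
Proof.
move=> [st0 I0] next.
pose P (a : seq X * X * St) st' := Inv a.1.1 a.2 -> Inv (rcons a.1.1 a.1.2) st' /\ Step a.1.1 a.1.2 a.2 st'.
have /choice[f fP] : forall a, exists st', P a st'.
  move=> a; have [Ia|nIa] := pselect (Inv a.1.1 a.2); last by exists a.2.
  by have [st' st'P] := next a.1.1 a.1.2 a.2 Ia; exists st'.
pose step (hs : seq X * St) x := (rcons hs.1 x, f (hs.1, x, hs.2)).
pose runp s := foldl step ([::], st0) s.
have runp1 s : (runp s).1 = s.
  elim/last_ind: s => // s x IH; rewrite /runp foldl_rcons /= -/(runp s) IH //.
have runS s x : (runp (rcons s x)).2 = f (s, x, (runp s).2).
  by rewrite {1}/runp foldl_rcons /= -/(runp s) runp1.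
have runI s : Inv s (runp s).2.
  by elim/last_ind: s => // s x IH; rewrite runS; exact: (fP (s, x, (runp s).2) IH).1.
exists (fun s => (runp s).2); split=> // s x.
by rewrite runS; exact: (fP (s, x, (runp s).2) (runI s)).2.
Qed.

(** * Transport plans and the cap of mass 1 per point *)

Section Plans.
Context {R : realType} {X : finType} (d : X -> X -> R).
Implicit Types (p q : X -> R) (g : X -> X -> R).

Definition plan_cost g := \sum_x \sum_y d x y * g x y.

Hypothesis d_ge0 : forall x y, 0 <= d x y.
Hypothesis d_xx : forall x, d x x = 0.
Hypothesis d_tri : forall x y z, d x z <= d x y + d y z.

Lemma plan_cost_ge0 p q g : transport_plan p q g -> 0 <= plan_cost g.
Proof. by move=> [g0 _ _]; do 2!(apply: sumr_ge0 => ? _); rewrite mulr_ge0. Qed.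

Lemma earthmover_le p q g : transport_plan p q g -> earthmover d p q <= plan_cost g.
Proof.
move=> pg; apply: ge_inf; last by exists g.
by exists 0 => _ [g' pg' <-]; exact: (plan_cost_ge0 pg').
Qed.

Lemma plan_row_le p q g x y : transport_plan p q g -> g x y <= p x.
Proof.
by move=> [g0 gp _]; rewrite -gp (bigD1 y) //= lerDl sumr_ge0.
Qed.

Lemma plan_col_le p q g x y : transport_plan p q g -> g x y <= q y.
Proof.
by move=> [g0 _ gq]; rewrite -gq (bigD1 x) //= lerDl sumr_ge0.
Qed.

(** Gluing over the middle distribution. Where [q] vanishes both plans vanish as well, so the
    division by 0 does no harm. *)
Lemma plan_comp p q r g g' : transport_plan p q g -> transport_plan q r g' ->
  exists2 h, transport_plan p r h & plan_cost h <= plan_cost g + plan_cost g'.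
Proof.
move=> pg pg'; have [g0 gp gq] := pg; have [g'0 g'q g'r] := pg'.
have q0 y : 0 <= q y by rewrite -gq sumr_ge0.
pose h x z := \sum_y g x y * g' y z / q y.
have gqK x y : g x y * q y / q y = g x y.
  have [qy|qy] := eqVneq (q y) 0; last by rewrite mulfK.
  have := plan_col_le x y pg; rewrite qy => gle.
  by rewrite mulr0 mul0r; apply/eqP; rewrite eq_le g0 gle.
have g'qK y z : g' y z * q y / q y = g' y z.
  have [qy|qy] := eqVneq (q y) 0; last by rewrite mulfK.
  have := plan_row_le y z pg'; rewrite qy => gle.
  by rewrite mulr0 mul0r; apply/eqP; rewrite eq_le g'0 gle.
have hx x z y : 0 <= g x y * g' y z / q y by rewrite divr_ge0 // mulr_ge0.
have sumz x y : \sum_z g x y * g' y z / q y = g x y.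
  by rewrite -mulr_suml -mulr_sumr g'q gqK.
have sumx y z : \sum_x g x y * g' y z / q y = g' y z.
  by rewrite -!mulr_suml gq mulrC [q y * _]mulrC mulrC g'qK.
exists h; first split.
- by move=> x z; apply: sumr_ge0 => y _.
- by move=> x; rewrite exchange_big /= -gp; apply: eq_bigr.
- by move=> z; rewrite exchange_big /= -g'r; apply: eq_bigr.
have -> : plan_cost g = \sum_x \sum_y \sum_z d x y * (g x y * g' y z / q y).
  by apply: eq_bigr => x _; apply: eq_bigr => y _; rewrite -mulr_sumr sumz.
have -> : plan_cost g' = \sum_x \sum_y \sum_z d y z * (g x y * g' y z / q y).
  rewrite /plan_cost [RHS]exchange_big; apply: eq_bigr => y _.
  by rewrite [RHS]exchange_big; apply: eq_bigr => z _; rewrite -mulr_sumr sumx.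
rewrite /plan_cost -big_split; apply: ler_sum => x _.
rewrite -big_split /= /h.
under eq_bigr do rewrite mulr_sumr.
rewrite exchange_big; apply: ler_sum => y _; rewrite -big_split; apply: ler_sum => z _ /=.
by rewrite -mulrDl ler_wpM2r.
Qed.

(* Mass is pulled towards [x] along the plan, which lowers the cost of the plan
   by exactly the distance travelled. *)
Lemma pull (F G : X -> R) (g : X -> X -> R) x : transport_plan F G g ->
  (forall y, 0 <= F y <= 1) -> 1 <= G x ->
  exists F' g' rho, [/\ transport_plan F' G g', transport_plan F F' rho,
    forall y, 0 <= F' y <= 1, F' x = 1 & plan_cost rho + plan_cost g' <= plan_cost g].
Proof.
move=> pg F01 Gx; have [g0 gF gG] := pg.
pose inn := \sum_(y | y != x) g y x; pose t := 1 - F x.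
have GxE : G x = g x x + inn by rewrite -gG (bigD1 x).
have gxx : g x x <= F x by exact: plan_row_le pg.
have t0 : 0 <= t by rewrite subr_ge0; case/andP: (F01 x).
have tin : t <= inn by rewrite /t; lra.
have inn0 : 0 <= inn by apply: sumr_ge0.
(* The fraction of the mass planned to enter [x] from elsewhere that has to arrive now to fill [x]
   up to 1. *)
pose th := t / inn.
have thin : th * inn = t.
  have [i0|i0] := eqVneq inn 0; last by rewrite divfK.
  by rewrite i0 mulr0; apply/eqP; rewrite eq_le t0 -i0 tin.
have th01 : 0 <= th <= 1.
  rewrite divr_ge0 //=; have [i0|i0] := eqVneq inn 0; first by rewrite /th i0 invr0 mulr0.
  by rewrite ler_pdivrMr ?mul1r // lt_def i0.
pose F' y := if y == x then 1 else F y - th * g y x.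
pose g' y z := if z == x then (if y == x then g x x + t else (1 - th) * g y x) else g y z.
pose rho y z := if z == y then (if y == x then F x else F' y) else if z == x then th * g y x else 0.
exists F', g', rho; split.
- split.
  + move=> y z; rewrite /g'; case: eqP => // _; case: eqP => // _; first by rewrite addr_ge0.
    by rewrite mulr_ge0 // subr_ge0; case/andP: th01.
  + move=> y; rewrite (bigD1 x) //= /g' eqxx.
    under eq_bigr => z /negbTE zx do rewrite zx.
    have := gF y; rewrite (bigD1 x) //= /F'; case: eqP => [->|_]; rewrite /t; lra.
  + move=> z; rewrite /g'; have [->|zx] := eqVneq z x; last exact: gG.
    rewrite (bigD1 x) //= eqxx.
    under eq_bigr => y /negbTE yx do rewrite yx.
    by rewrite -mulr_sumr -/inn GxE mulrBl thin; lra.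
- split.
  + move=> y z; rewrite /rho; case: eqP => _.
      have := F01 y; have := F01 x; rewrite /F'; case: eqP => _ h1 h2; first by lra.
      have := plan_row_le y x pg; have := g0 y x; nra.
    by case: eqP => // _; rewrite mulr_ge0 //; case/andP: th01.
  + move=> y; rewrite (bigD1 y) //= /rho eqxx.
    have [->|yx] := eqVneq y x.
      by rewrite big1 ?addr0 // => z /negbTE ->.
    have xy : x != y by rewrite eq_sym.
    rewrite (bigD1 x xy) /= (negbTE xy) eqxx big1.
      by rewrite /F' (negbTE yx); lra.
    by move=> z /andP[/negbTE -> /negbTE ->].
  + move=> z; rewrite (bigD1 z) //= /rho eqxx.
    have [->|zx] := eqVneq z x.
      rewrite /F' eqxx (eq_bigr (fun y => th * g y x)); last first.
        by move=> y; rewrite eq_sym => /negbTE ->.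
      by rewrite -mulr_sumr -/inn thin /t; lra.
    by rewrite big1 ?addr0 // => y; rewrite eq_sym => /negbTE ->.
- move=> y; rewrite /F'; case: eqP => _; first by rewrite ler01 lexx.
  by have := F01 y; have := plan_row_le y x pg; have := g0 y x; nra.
- by rewrite /F' eqxx.
rewrite /plan_cost -big_split; apply: ler_sum => y _ /=.
have -> : \sum_z d y z * rho y z = if y == x then 0 else d y x * (th * g y x).
  rewrite (bigD1 y) //= d_xx mul0r add0r.
  have [->|yx] := eqVneq y x.
    by rewrite big1 // => z zx; rewrite /rho (negbTE zx) mulr0.
  have xy : x != y by rewrite eq_sym.
  rewrite (bigD1 x xy) /= /rho (negbTE xy) eqxx big1 ?addr0 //.
  by move=> z /andP[/negbTE -> /negbTE ->]; rewrite mulr0.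
rewrite (bigD1 x) //= [X in _ <= X](bigD1 x) //= addrA lerD //.
  rewrite /g' eqxx; case: eqP => [->|_]; first by rewrite d_xx; lra.
  by rewrite -mulrDr; have := d_ge0 y x; lra.
by apply: ler_sum => z /negbTE zx; rewrite /g' zx.
Qed.

(** [G] may hold more than mass 1 at a point. The algorithm keeps a capped [F] together with a plan
    from [F] to [G], and on a request carries out only the part of the plan needed to fill the
    requested point. The cost of the plan still outstanding is the potential [Pt]. *)
Lemma capping (k : nat) (G : seq X -> X -> R) (B : seq X -> X -> R) :
  (k <= #|X|)%N -> (forall s x, 0 <= G s x) -> (forall s, \sum_x G s x = k%:R) ->
  (forall s x, 1 <= G (rcons s x) x) ->
  (forall s x, exists2 g, transport_plan (G s) (G (rcons s x)) g & plan_cost g <= B s x) ->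
  exists (F : seq X -> X -> R) (Pt : seq X -> R) (C : seq X -> X -> R),
   [/\ forall s x, 0 <= F s x <= 1, forall s, \sum_x F s x = k%:R,
       forall s x, F (rcons s x) x = 1, forall s, 0 <= Pt s
     & forall s x, C s x + Pt (rcons s x) <= Pt s + B s x /\
         exists2 g, transport_plan (F s) (F (rcons s x)) g & plan_cost g <= C s x].
Proof.
move=> kX G0 Gk G1 Gplan.
pose Inv s (st : (X -> R) * (X -> X -> R)) :=
  [/\ forall x, 0 <= st.1 x <= 1, \sum_x st.1 x = k%:R & transport_plan st.1 (G s) st.2].
pose Step (s : seq X) x (st st' : (X -> R) * (X -> X -> R)) := st'.1 x = 1 /\
  exists2 g, transport_plan st.1 st'.1 g & plan_cost g + plan_cost st'.2 <= plan_cost st.2 + B s x.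
have [||run [runI runS]] := online_run (Inv := Inv) (Step := Step).
- pose A := [set x in take k (enum X)].
  have cA : #|A| = k by rewrite cardsE (card_uniqP _) ?take_uniq ?enum_uniq // size_takel // -cardE.
  have sA : \sum_x (x \in A)%:R = k%:R :> R.
    by rewrite -natr_sum; congr (_%:R); rewrite -[RHS]cA -sum1_card [RHS]big_mkcond.
  exists (fun x => (x \in A)%:R, fun x y => (x \in A)%:R * G [::] y / k%:R); split=> //=.
    by move=> x; case: (x \in A); rewrite /= ?lexx ?ler01.
  have Gle y : G [::] y <= k%:R by rewrite -(Gk [::]) (bigD1 y) //= lerDl sumr_ge0.
  have Ale x : (x \in A)%:R <= k%:R :> R by rewrite -sA (bigD1 x) //= lerDl sumr_ge0.
  split=> [x y|x|y].
  + by rewrite divr_ge0 ?mulr_ge0.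
  + rewrite -mulr_suml -mulr_sumr Gk; have [k0|k0] := eqVneq (k%:R : R) 0; last by rewrite mulfK.
    by have := Ale x; rewrite k0; case: (x \in A) => /=; [rewrite ler10|rewrite !mul0r].
  + rewrite -!mulr_suml sA; have [k0|k0] := eqVneq (k%:R : R) 0; last by rewrite mulrC mulKf.
    by have := Gle y; rewrite k0 !mul0r => h; apply/eqP; rewrite eq_le h G0.
- move=> s x [F g] [/= F01 Fk Fg].
  have [pi ppi cpi] := Gplan s x.
  have [h ph ch] := plan_comp Fg ppi.
  have [F' [g' [rho [pg' prho F'01 F'x cost]]]] := pull ph F01 (G1 s x).
  exists (F', g'); split; split=> //=.
    have [_ _ h1] := prho; have [_ h2 _] := prho.
    rewrite -Fk; under eq_bigr do rewrite -h1; rewrite exchange_big /=.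
    by apply: eq_bigr => y _.
  by exists rho => //; lra.
pose C s x := plan_cost (run s).2 + B s x - plan_cost (run (rcons s x)).2.
exists (fun s => (run s).1), (fun s => plan_cost (run s).2), C; split.
- by move=> s x; have [h _ _] := runI s.
- by move=> s; have [_ h _] := runI s.
- by move=> s x; have [] := runS s x.
- by move=> s; have [_ _ h] := runI s; exact: plan_cost_ge0 h.
move=> s x; split; first by rewrite /C; lra.
by have [_ [g pg cg]] := runS s x; exists g => //; rewrite /C; lra.
Qed.

End Plans.

(** * Rooted trees *)

Record rooted_tree (V : finType) := RootedTree {
  root : V;
  parent : V -> V;
  depth : V -> nat;
  parent_root : parent root = root;
  depth_parent : forall v, v != root -> depth v = (depth (parent v)).+1 }.

Section RootedTrees.
Context {V : finType} (t : rooted_tree V).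
Notation r := (root t).
Notation par := (parent t).
Notation dep := (depth t).

Definition below u x := fconnect par x u.

Lemma below_refl u : below u u.
Proof. exact: connect0. Qed.

Lemma below_trans u v x : below u v -> below v x -> below u x.
Proof. by move=> uv vx; apply: connect_trans vx uv. Qed.

Lemma below_par v : below (par v) v.
Proof. exact: fconnect1. Qed.

Lemma belowE u x : below u x = (x == u) || ((x != r) && below u (par x)).
Proof.
apply/idP/idP; last first.
  by case/predU1P => [->|/andP[_ ux]]; [exact: below_refl|exact: below_trans ux (below_par x)].
rewrite /below => cxu; have := iter_findex cxu; case: findex => [/= ->|n].
  by rewrite eqxx.
rewrite iterSr => un; have [->//|xu] := eqVneq x u.
have upx : fconnect par (par x) u by rewrite -un fconnect_iter.
rewrite upx andbT /=; apply/eqP => xr; move/eqP: xu; apply.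
by rewrite -un xr parent_root; elim: (n) => //= m IH; rewrite -IH parent_root.
Qed.

Lemma below_ind (P : V -> Prop) : P r -> (forall v, v != r -> P (par v) -> P v) -> forall v, P v.
Proof.
move=> Pr Pp v; have [n vn] := ubnP (dep v); elim: n v vn => // n IH v vn.
have [->//|vr] := eqVneq v r; apply: Pp => //; apply: IH.
by move: vn; rewrite depth_parent.
Qed.

Lemma below_root x : below r x.
Proof.
elim/below_ind: x => [|v vr]; first exact: below_refl.
by rewrite (belowE _ v) vr => ->; rewrite orbT.
Qed.

Lemma below_depth u x : below u x -> u != x -> (dep u < dep x)%N.
Proof.
elim/below_ind: x => [|v vr IH].
  by rewrite belowE eqxx orbF eq_sym => /eqP ->; rewrite eqxx.
rewrite belowE vr eq_sym => /predU1P[->|/= ux _]; first by rewrite eqxx.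
rewrite (depth_parent vr) ltnS; have [->//|upv] := eqVneq u (par v).
exact: ltnW (IH ux upv).
Qed.

Lemma below_depth_le u x : below u x -> (dep u <= dep x)%N.
Proof. by move=> ux; have [->//|/(below_depth ux)/ltnW] := eqVneq u x. Qed.

Lemma below_anti u x : below u x -> below x u -> u = x.
Proof.
move=> ux xu; apply/eqP; apply: contraT => ne.
by have := below_depth ux ne; rewrite ltnNge (below_depth_le xu).
Qed.

Lemma below_chain u v x : below u x -> below v x -> below u v || below v u.
Proof.
elim/below_ind: x => [|x xr IH].
  by rewrite belowE eqxx orbF => /eqP <- vx; rewrite vx orbT.
rewrite belowE xr => /predU1P[<- ->|/= ux]; first by rewrite orbT.
by rewrite belowE xr => /predU1P[<-|/= vx]; rewrite 1?(below_trans ux (below_par x)) ?IH.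
Qed.

Lemma below_parent_of u v : below u v -> u != v -> below u (par v).
Proof. by rewrite belowE eq_sym => /orP[->//|/andP[]]. Qed.

Lemma sibling_inj u v x : u != r -> v != r -> par u = par v -> below u x -> below v x -> u = v.
Proof.
move=> ur vr uv ux vx; apply/eqP; apply: contraT => ne.
have dE : dep u = dep v by rewrite (depth_parent ur) (depth_parent vr) uv.
have := below_chain ux vx => /orP[/below_depth|/below_depth].
  by move=> /(_ ne); rewrite dE ltnn.
by rewrite eq_sym => /(_ ne); rewrite dE ltnn.
Qed.

Lemma par_below_neq v : v != r -> below v (par v) = false.
Proof.
move=> vr; apply/negP => /below_depth_le; rewrite (depth_parent vr).
by rewrite ltnn.
Qed.

End RootedTrees.

(** * Transport and matching on a tree *)

Section TreeDistance.
Context {R : realType} {V X : finType} (t : rooted_tree V) (j : X -> V) (w : V -> R).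
Notation below := (below t).
Implicit Types (p q : X -> R) (A B : {set X}).

(** The tree metric as a sum of cuts: [w u] is the length of the edge above [u], which separates the
    points below [u] from the others. In this form transport costs can be compared edge by edge. *)
Definition tree_dist (x y : X) : R :=
  \sum_u w u * (below u (j x) != below u (j y))%:R.

Definition inside p u : R := \sum_(x | below u (j x)) p x.

Definition inhabitants A u : nat := #|[set x in A | below u (j x)]|.

Lemma inside_set A u : inside (fun x => (x \in A)%:R) u = (inhabitants A u)%:R.
Proof.
rewrite /inside /inhabitants -sum1_card natr_sum big_mkcond [RHS]big_mkcond /=.
by apply: eq_bigr => x _; rewrite inE; case: (below _ _); case: (x \in A).
Qed.

Lemma inside_root p : inside p (root t) = \sum_x p x.
Proof. by apply: eq_bigl => x; rewrite below_root. Qed.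

Hypothesis w_ge0 : forall u, 0 <= w u.

Lemma tree_dist_ge0 x y : 0 <= tree_dist x y.
Proof. by apply: sumr_ge0 => u _; rewrite mulr_ge0. Qed.

Lemma tree_distxx x : tree_dist x x = 0.
Proof. by apply: big1 => u _; rewrite eqxx mulr0. Qed.

Lemma tree_distC x y : tree_dist x y = tree_dist y x.
Proof. by apply: eq_bigr => u _; rewrite eq_sym. Qed.

Lemma tree_dist_triangle x y z : tree_dist x z <= tree_dist x y + tree_dist y z.
Proof.
rewrite /tree_dist -big_split; apply: ler_sum => u _ /=; rewrite -mulrDr ler_wpM2l // -natrD ler_nat.
by case: (below u (j x)); case: (below u (j y)); case: (below u (j z)).
Qed.

(* The pair is separated as deep as possible, so that each edge between them has
   only surplus on one side. *)
Lemma surplus_pair p q : \sum_x p x = \sum_x q x -> (exists x, p x != q x) ->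
  exists x y, [/\ q x < p x, p y < q y,
    forall u, below u (j x) -> ~~ below u (j y) -> forall z, below u (j z) -> q z <= p z &
    forall u, below u (j y) -> ~~ below u (j x) -> forall z, below u (j z) -> p z <= q z].
Proof.
move=> pq [x0 x0P].
pose Q u := [exists x, below u (j x) && (q x < p x)] && [exists y, below u (j y) && (p y < q y)].
have Qr : Q (root t).
  have lem (a b : X -> R) : \sum_x a x = \sum_x b x -> (exists x, a x != b x) ->
      [exists x, below (root t) (j x) && (b x < a x)].
    move=> ab [z zP]; apply: contraT => /existsPn no.
    have le x : a x <= b x by have := no x; rewrite below_root /= -leNgt.
    have : a z < b z by rewrite lt_neqAle zP le.
    have : \sum_(x | x != z) a x <= \sum_(x | x != z) b x by apply: ler_sum.
    move: ab; rewrite (bigD1 z) //= [RHS](bigD1 z) //=; lra.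
  rewrite /Q (lem p q) ?(lem q p) //; first by exists x0; rewrite eq_sym.
  by exists x0.
case: (arg_maxnP (depth t) Qr) => u /andP[/existsP[x /andP[ux xP]] /existsP[y /andP[uy yP]]] umax.
exists x, y; split=> // v.
  move=> vx vy z vz; rewrite leNgt; apply/negP => zP.
  have Qv : Q v by rewrite /Q; apply/andP; split; apply/existsP; [exists x; rewrite vx|exists z; rewrite vz].
  have := below_chain vx ux => /orP[vu|uv].
    by move/negP: vy; apply; apply: below_trans vu uy.
  have ne : u != v by apply: contraNneq vy => <-.
  by have := below_depth uv ne; rewrite ltnNge; move/negP; apply; exact: umax.
move=> vy vx z vz; rewrite leNgt; apply/negP => zP.
have Qv : Q v by rewrite /Q; apply/andP; split; apply/existsP; [exists z; rewrite vz|exists y; rewrite vy].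
have := below_chain vy uy => /orP[vu|uv].
  by move/negP: vx; apply; apply: below_trans vu ux.
have ne : u != v by apply: contraNneq vx => <-.
by have := below_depth uv ne; rewrite ltnNge; move/negP; apply; exact: umax.
Qed.

Definition zero_one (x : R) := (x == 0) || (x == 1).

(** The cut bound is attained on a tree. Moving [dl] within a surplus pair lowers the bound of each
    separating edge by exactly [dl] and settles one of the two points, whence an induction on the
    number of unsettled points. From 0/1 data only amounts 0 and 1 are moved. *)
Lemma tree_plan p q : (forall x, 0 <= p x) -> (forall x, 0 <= q x) ->
  \sum_x p x = \sum_x q x ->
  exists g, [/\ transport_plan p q g,
    plan_cost tree_dist g <= \sum_u w u * `|inside p u - inside q u| &
    (forall x, zero_one (p x)) -> (forall x, zero_one (q x)) -> forall x y, zero_one (g x y)].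
Proof.
have [n] := ubnP #|[set x | p x != q x]|; elim: n p q => // n IH p q pqn p0 q0 pq.
have [/existsP pqne|/existsPn pqE] := boolP [exists x, p x != q x]; last first.
  have {}pqE x : p x = q x by apply/eqP; rewrite -[_ == _]negbK.
  exists (fun x y => (x == y)%:R * p x); split.
  - split=> [x y|x|y]; first by rewrite mulr_ge0.
      rewrite (bigD1 x) //= eqxx mul1r big1 ?addr0 // => y; rewrite eq_sym => /negbTE ->.
      by rewrite mul0r.
    rewrite (bigD1 y) //= eqxx mul1r big1 ?addr0 // => x /negbTE ->.
    by rewrite mul0r.
  - rewrite /plan_cost big1; first by apply: sumr_ge0 => u _; rewrite mulr_ge0.
    move=> x _; apply: big1 => y _; case: eqP => [->|_]; last by rewrite mul0r mulr0.
    by rewrite tree_distxx mul0r.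
  - move=> p01 _ x y; case: eqP => _; first by rewrite mul1r.
    by rewrite mul0r /zero_one eqxx.
have [x [y [xP yP ux uy]]] := surplus_pair pq pqne.
have xy : x != y by apply: contraTneq xP => ->; rewrite -leNgt ltW.
pose dl := Num.min (p x - q x) (q y - p y).
have dl0 : 0 < dl by rewrite lt_min !subr_gt0 xP.
have dlx : dl <= p x - q x by rewrite ge_min lexx.
have dly : dl <= q y - p y by rewrite ge_min lexx orbT.
pose p' z := p z - (z == x)%:R * dl; pose q' z := q z - (z == y)%:R * dl.
have p'x z : z != x -> p' z = p z by rewrite /p' => /negbTE->; rewrite mul0r subr0.
have q'y z : z != y -> q' z = q z by rewrite /q' => /negbTE->; rewrite mul0r subr0.
have p'xx : p' x = p x - dl by rewrite /p' eqxx mul1r.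
have q'yy : q' y = q y - dl by rewrite /q' eqxx mul1r.
have p'0 z : 0 <= p' z.
  have [->|/p'x->//] := eqVneq z x; rewrite p'xx; have := q0 x; lra.
have q'0 z : 0 <= q' z.
  have [->|/q'y->//] := eqVneq z y; rewrite q'yy; have := p0 y; lra.
have sum1 (z : X) (P : pred X) : \sum_(v | P v) (v == z)%:R * dl = (P z)%:R * dl.
  rewrite -mulr_suml; congr (_ * _); rewrite big_mkcond (bigD1 z) //= eqxx big1 ?addr0; first by case: (P z).
  by move=> v /negbTE ->; case: (P v).
have p'q' : \sum_x p' x = \sum_x q' x by rewrite !sumrB pq !sum1.
have [g' [[g'0 g'p g'q] g'c g'01]] : exists g, [/\ transport_plan p' q' g,
    plan_cost tree_dist g <= \sum_u w u * `|inside p' u - inside q' u| &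
    (forall x, zero_one (p' x)) -> (forall x, zero_one (q' x)) -> forall x y, zero_one (g x y)].
  apply: IH; rewrite // -ltnS; apply: leq_trans pqn; rewrite ltnS.
  apply: proper_card; apply/properP; split.
    apply/fintype.subsetP => z; rewrite !inE; have [->|zx] := eqVneq z x; first by rewrite (gt_eqF xP).
    have [->|zy] := eqVneq z y; first by rewrite (lt_eqF yP).
    by rewrite p'x // q'y.
  have [le|le] := leP (p x - q x) (q y - p y).
    exists x; rewrite !inE ?(gt_eqF xP) // negbK p'xx q'y // /dl min_l //; apply/eqP; ring.
  exists y; rewrite !inE ?(lt_eqF yP) // negbK q'yy p'x 1?eq_sym // /dl min_r ?(ltW le) //; apply/eqP; ring.
exists (fun a b => g' a b + ((a == x) && (b == y))%:R * dl); split.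
- split=> [a b|a|b].
  + by rewrite addr_ge0 // mulr_ge0 // ltW.
  + rewrite big_split /= g'p /p'; have [->|ax] := eqVneq a x => /=.
      by rewrite sum1 mul1r subrK.
    by rewrite big1 ?mul0r ?subr0 ?addr0 // => b _; rewrite mul0r.
  + rewrite big_split /= g'q /q'; have [->|bY] := eqVneq b y => /=.
      by under eq_bigr do rewrite andbT; rewrite sum1 mul1r subrK.
    by rewrite big1 ?mul0r ?subr0 ?addr0 // => a _; rewrite andbF mul0r.
- have -> : plan_cost tree_dist (fun a b => g' a b + ((a == x) && (b == y))%:R * dl) =
      plan_cost tree_dist g' + tree_dist x y * dl.
    rewrite /plan_cost.
    under eq_bigr do under eq_bigr do rewrite mulrDr.
    under eq_bigr do rewrite big_split.
    rewrite big_split /=; congr (_ + _); rewrite (bigD1 x) //= (bigD1 y) //= !eqxx /= mul1r.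
    rewrite [X in _ + X + _]big1 ?[X in _ + X]big1 ?addr0 // => [a /negbTE ax|b /negbTE bY].
      by rewrite big1 // => b _; rewrite ax mul0r mulr0.
    by rewrite bY mul0r mulr0.
  rewrite -lerBrDr; apply: le_trans g'c _.
  rewrite [tree_dist x y]/tree_dist mulr_suml -sumrB; apply: ler_sum => u _.
  rewrite -mulrA -mulrBr ler_wpM2l //.
  have -> : inside p' u - inside q' u = inside p u - inside q u
      - ((below u (j x))%:R - (below u (j y))%:R) * dl.
    by rewrite /inside !sumrB !sum1; ring.
  rewrite /inside -sumrB.
  have [bx|bx] := boolP (below u (j x)); have [bY|bY] := boolP (below u (j y)) => /=.
  + by rewrite subrr !mul0r !subr0.
  + have le z : below u (j z) -> q z <= p z by exact: ux.
    have s0 : p x - q x <= \sum_(z | below u (j z)) (p z - q z).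
      by rewrite (bigD1 x) //= lerDl sumr_ge0 // => z /andP[/le]; rewrite subr_ge0.
    by rewrite !ger0_norm; lra.
  + have le z : below u (j z) -> p z <= q z by exact: uy.
    have s0 : \sum_(z | below u (j z)) (p z - q z) <= p y - q y.
      by rewrite (bigD1 y) //= gerDl sumr_le0 // => z /andP[/le]; rewrite subr_le0.
    by rewrite !ler0_norm; lra.
  + by rewrite subrr !mul0r !subr0.
- move=> p01 q01.
  have px : p x = 1 by case/orP: (p01 x) => /eqP // px; have := q0 x; lra.
  have qx : q x = 0 by case/orP: (q01 x) => /eqP // px'; lra.
  have qy : q y = 1 by case/orP: (q01 y) => /eqP // px'; have := p0 y; lra.
  have py : p y = 0 by case/orP: (p01 y) => /eqP // px'; lra.
  have dl1 : dl = 1 by rewrite /dl px qx qy py !subr0 minxx.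
  have p'01 z : zero_one (p' z).
    by have [->|/p'x->//] := eqVneq z x; rewrite p'xx px dl1 subrr /zero_one eqxx.
  have q'01 z : zero_one (q' z).
    by have [->|/q'y->//] := eqVneq z y; rewrite q'yy qy dl1 subrr /zero_one eqxx.
  have g01 := g'01 p'01 q'01.
  move=> a b; have [/andP[/eqP-> /eqP->]|_] := boolP ((a == x) && (b == y)); last by rewrite mul0r addr0.
  suff -> : g' x y = 0 by rewrite add0r dl1 mulr1 /zero_one eqxx orbT.
  apply/eqP; rewrite eq_le g'0 andbT -[leRHS](_ : p' x = 0); last by rewrite p'xx px dl1 subrr.
  by rewrite -g'p (bigD1 y) //= lerDl sumr_ge0.
Qed.

(** An integral plan between indicators is the graph of a bijection. *)
Lemma tree_matching A B : #|A| = #|B| -> exists f : {ffun X -> X},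
  [/\ {in A &, injective f}, (f @: A = B)%SET &
    \sum_(x in A) tree_dist x (f x) <=
    \sum_u w u * `|(inhabitants A u)%:R - (inhabitants B u)%:R|].
Proof.
move=> AB; have sumE (S : {set X}) : \sum_x (x \in S)%:R = #|S|%:R :> R.
  by rewrite -natr_sum -sum1_card [in RHS]big_mkcond.
have sAB : \sum_x (x \in A)%:R = \sum_x (x \in B)%:R :> R by rewrite !sumE AB.
have [g [[g0 gA gB] cg g01]] := tree_plan (fun x => ler0n R (x \in A)) (fun x => ler0n R (x \in B)) sAB.
have {}g01 x y : zero_one (g x y).
  by apply: g01 => z; rewrite /zero_one; case: (z \in _); rewrite /= ?eqxx ?orbT.
have gne x y : g x y != 0 -> g x y = 1 by case/orP: (g01 x y) => /eqP ->; rewrite ?eqxx.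
pose f := [ffun x => odflt x [pick y | g x y == 1]].
have fP x : x \in A -> g x (f x) = 1.
  move=> xA; rewrite ffunE; case: pickP => [y /eqP//|no].
  have := gA x; rewrite xA /= big1 => [/eqP|y _]; first by rewrite eq_sym oner_eq0.
  by apply/eqP; apply: contraFT (no y) => /gne ->.
have fu x y : x \in A -> y != f x -> g x y = 0.
  move=> xA yf; apply/eqP; rewrite eq_le g0 andbT.
  have := gA x; rewrite xA (bigD1 (f x)) //= (bigD1 y) //= fP //.
  have : 0 <= \sum_(i | (i != f x) && (i != y)) g x i by apply: sumr_ge0.
  by lra.
have finj : {in A &, injective f}.
  move=> x x' xA x'A fE; apply/eqP; apply: contraT => ne.
  have := gB (f x); rewrite (bigD1 x) //= fP // (bigD1 x') 1?eq_sym //= fE fP //.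
  have : 0 <= \sum_(i | (i != x) && (i != x')) g i (f x') by apply: sumr_ge0.
  by case: (f x' \in B) => /=; lra.
exists f; split=> //.
  apply/eqP; rewrite eqEcard (card_in_imset finj) AB leqnn andbT.
  apply/fintype.subsetP => _ /imsetP[x xA ->]; apply: contraT => nB.
  have := gB (f x); rewrite (negbTE nB) (bigD1 x) //= fP //.
  have : 0 <= \sum_(i | i != x) g i (f x) by apply: sumr_ge0.
  by lra.
apply: le_trans (_ : plan_cost tree_dist g <= _); last first.
  by apply: le_trans cg _; apply: ler_sum => u _; rewrite !inside_set.
rewrite /plan_cost big_mkcond /=; apply: ler_sum => x _.
have gd y : 0 <= tree_dist x y * g x y by rewrite mulr_ge0 // tree_dist_ge0.
case: ifP => xA; last exact: sumr_ge0.
by rewrite (bigD1 (f x)) //= fP // mulr1 lerDl sumr_ge0.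
Qed.

Lemma move_cost_ge A B : #|A| = #|B| ->
  \sum_u w u * `|(inhabitants A u)%:R - (inhabitants B u)%:R| <= move_cost tree_dist A B.
Proof.
move=> AB; apply: lb_le_inf.
  (* A matching must exist here, because [inf] of an empty set is a default value. *)
  by have [f [fi fAB _]] := tree_matching AB; exists (\sum_(x in A) tree_dist x (f x)), f.
move=> _ [f [injf fAB] <-].
rewrite /tree_dist exchange_big; apply: ler_sum => u _ /=; rewrite -mulr_sumr ler_wpM2l //.
have -> : (inhabitants A u)%:R = \sum_(x in A) (below u (j x))%:R :> R.
  rewrite /inhabitants -sum1_card natr_sum big_mkcond [RHS]big_mkcond /=.
  by apply: eq_bigr => x _; rewrite inE; case: (below _ _); case: (x \in A).
have -> : (inhabitants B u)%:R = \sum_(x in A) (below u (j (f x)))%:R :> R.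
  rewrite -(big_imset (fun y => (below u (j y))%:R)) //= fAB /inhabitants -sum1_card natr_sum.
  rewrite big_mkcond [RHS]big_mkcond /=.
  by apply: eq_bigr => x _; rewrite inE; case: (below _ _); case: (x \in B).
rewrite -sumrB; apply: le_trans (ler_norm_sum _ _ _) _; apply: ler_sum => x _.
by case: (below u (j x)); case: (below u (j (f x))); rewrite /= ?subrr ?subr0 ?sub0r ?normrN ?normr0 ?normr1.
Qed.

End TreeDistance.

(** * From graphs to rooted trees *)

Section GraphToTree.
Context {V : finType} (e : rel V).

Lemma hop_diameter_ge x p : path e x p -> uniq (x :: p) -> (size p <= hop_diameter e)%N.
Proof.
move=> pp up; have sp : (size p < #|V|)%N.
  by apply: leq_trans (max_card (mem (x :: p))); rewrite (card_uniqP up).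
apply: (@leq_trans (Ordinal sp)) => //; rewrite /hop_diameter.
apply: (leq_bigmax_cond (Ordinal sp)) => /=.
by apply/existsP; exists x; apply/existsP; exists (in_tuple p); rewrite /= pp.
Qed.

(** The parent of [v] is the vertex before [v] on a shortest path from [r]. An edge not of this form
    would close a cycle with the path that joins its ends through parent edges. *)
Lemma rooted_at (r : V) : is_tree e -> exists t : rooted_tree V,
  [/\ root t = r, forall v, v != r -> e v (parent t v),
    forall a b, e a b -> (a != r /\ b = parent t a) \/ (b != r /\ a = parent t b) &
    forall v, (depth t v <= hop_diameter e)%N].
Proof.
move=> [symE irrE conE cycE].
have /choice[dep depP] : forall v, exists n,
    (exists p, [/\ path e r p, last r p = v & size p = n]) /\
    forall p, path e r p -> last r p = v -> (n <= size p)%N.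
  move=> v; pose P n := [exists p : n.-tuple V, path e r p && (last r p == v)].
  have exP : exists n, P n.
    have /connectP[p pp vE] := conE r v; exists (size p).
    by apply/existsP; exists (in_tuple p); rewrite /= pp vE eqxx.
  have [n /existsP[p /andP[pp /eqP lp]] nmin] := ex_minnP exP; exists n; split.
    by exists p; rewrite size_tuple.
  move=> q pq lq; apply: nmin; apply/existsP; exists (in_tuple q).
  by rewrite /= pq lq eqxx.
have dep_le v p : path e r p -> last r p = v -> (dep v <= size p)%N by exact: (depP v).2.
have /choice[par parP] : forall v, exists u, (v == r -> u = r) /\
    (v != r -> e v u /\ dep v = (dep u).+1).
  move=> v; have [->|vr] := eqVneq v r; first by exists r.
  have [[p [pp lp sp]] _] := depP v.
  case/lastP: p pp lp sp => [_ rv|p u]; first by rewrite -rv eqxx in vr.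
  rewrite last_rcons rcons_path size_rcons => /andP[pp lu] uv sp; exists (last r p); split=> // _.
  rewrite symE -uv lu; split=> //; apply/eqP; rewrite uv eqn_leq -{2}sp ltnS (dep_le _ p) // andbT.
  have [[q [pq lq sq]] _] := depP (last r p).
  rewrite -sq -(size_rcons q v); apply: dep_le; last by rewrite last_rcons.
  by rewrite rcons_path pq lq -uv.
have par_root : par r = r by apply: (parP r).1.
have dep_par v : v != r -> dep v = (dep (par v)).+1 by move=> /(parP v).2[].
have e_par v : v != r -> e v (par v) by move=> /(parP v).2[].
pose t := RootedTree par_root dep_par; exists t; split=> //=.
  move=> a b ab; have [ca|na] := boolP ((a != r) && (b == par a)).
    by left; case/andP: ca => ? /eqP.
  have [cb|nb] := boolP ((b != r) && (a == par b)).
    by right; case/andP: cb => ? /eqP.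
  exfalso.
  pose f : rel V := [rel x y | ((x != r) && (y == par x)) || ((y != r) && (x == par y))].
  have fe : subrel f e.
    by move=> x y /orP[/andP[xr /eqP->]|/andP[yr /eqP->]]; rewrite ?e_par // symE e_par.
  have symf : symmetric f by move=> x y; rewrite /f /= orbC.
  have symc := same_connect1.
  have conr x : connect f x r.
    elim/(below_ind (t := t)): x => [|v vr IH]; first exact: connect0.
    by apply: connect_trans IH; apply: connect1; rewrite /f /= (vr : v != r) eqxx.
  have /connectP[p pp lp] : connect f b a.
    by apply: connect_trans (conr b) _; rewrite (sym_connect_sym symf).
  case/shortenP: pp lp => q pq uq _ lq.
  have [s1|s1] := ltnP 1 (size q); last first.
    case: q pq uq lq s1 => [|c [|//]] /=.
      by move=> _ _ abE; rewrite abE irrE in ab.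
    rewrite andbT => bc _ abE _; rewrite -abE in bc.
    by case/orP: bc; [rewrite (negbTE nb)|rewrite (negbTE na)].
  apply: (cycE (b :: q)); first by rewrite /= ltnS.
  by rewrite /ucycle uq andbT /= rcons_path -lq ab (sub_path fe pq).
move=> v; have /connectP[p pp vE] := conE r v.
case/shortenP: pp vE => q pq uq _ vE.
by apply: leq_trans (hop_diameter_ge pq uq); apply: dep_le.
Qed.

End GraphToTree.

Section ShortestPath.
Context {R : realType} {V : finType} (e : rel V) (len : V -> V -> R) (t : rooted_tree V).
Notation r := (root t).
Notation par := (parent t).

Definition edge_weight u : R := if u == r then 0 else len (par u) u.

Hypothesis lenP : edge_lengths e len.
Hypothesis symE : symmetric e.
Hypothesis e_par : forall v, v != r -> e v (par v).
Hypothesis e_only : forall a b, e a b -> (a != r /\ b = par a) \/ (b != r /\ a = par b).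

Lemma edge_weight_ge0 u : 0 <= edge_weight u.
Proof.
rewrite /edge_weight; case: ifPn => // ur; apply: (lenP _).1.
by rewrite symE e_par.
Qed.

Notation dist := (tree_dist t id edge_weight).

Lemma dist_par v : v != r -> dist (par v) v = len (par v) v.
Proof.
move=> vr; rewrite /tree_dist (bigD1 v) //= {1}/edge_weight (negbTE vr).
rewrite below_refl par_below_neq // mulr1 big1 ?addr0 // => u uv.
rewrite (belowE _ u v) [v == u]eq_sym (negbTE uv) vr /=.
by rewrite eqxx mulr0.
Qed.

Lemma dist_edge a b : e a b -> dist a b = len a b.
Proof.
move=> ab; case: (e_only ab) => [[ar bE]|[br aE]]; last by rewrite aE dist_par.
by rewrite tree_distC bE dist_par // (lenP _).2 // symE e_par.
Qed.

Lemma dist_le_path x p : path e x p -> dist x (last x p) <= path_length len x p.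
Proof.
elim: p x => [|y p IH] x /=; first by rewrite tree_distxx /path_length big_nil.
case/andP=> xy /IH le; rewrite /path_length /= big_cons.
apply: le_trans (tree_dist_triangle _ _ _ _ y _) _; first exact: edge_weight_ge0.
by rewrite dist_edge // lerD2l.
Qed.

Lemma dist_through_par x y : x != r -> ~~ below t x y -> dist x y = len x (par x) + dist (par x) y.
Proof.
move=> xr xy; rewrite -(dist_edge (e_par xr)) /tree_dist -big_split; apply: eq_bigr => u _ /=.
rewrite -mulrDr; congr (_ * _); rewrite -natrD; congr (_%:R).
rewrite (belowE _ u x) xr /=; have [<-|xu] := eqVneq x u => /=.
  by rewrite (par_below_neq xr) (negbTE xy).
by rewrite eqxx.
Qed.

(** The deeper of the two ends does not lie above the other, so replacing it by its parent shortens
    the distance by exactly one edge. *)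
Lemma shortest_exists x y : exists p, [/\ path e x p, last x p = y & path_length len x p = dist x y].
Proof.
have [n] := ubnP (depth t x + depth t y); elim: n x y => // n IH x y xyn.
have [->|xy] := eqVneq x y.
  by exists [::]; rewrite tree_distxx /path_length big_nil.
have step a b : a != b -> (depth t b <= depth t a)%N -> a != r /\ ~~ below t a b.
  move=> ab ba; have nab : ~~ below t a b.
    by apply/negP => /below_depth/(_ ab); rewrite ltnNge ba.
  by split=> //; apply: contraNneq nab => ->; exact: below_root.
have [dyx|/ltnW dxy] := leqP (depth t y) (depth t x).
  have [xr nb] := step _ _ xy dyx.
  have [|p [pp lp cp]] := IH (par x) y.
    by move: xyn; rewrite (depth_parent xr) addSn ltnS.
  exists (par x :: p); rewrite /= pp lp e_par //; split=> //.
  by rewrite /path_length /= big_cons -/(path_length len (par x) p) cp [RHS]dist_through_par.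
have yx : y != x by rewrite eq_sym.
have [yr nb] := step _ _ yx dxy.
have [|p [pp lp cp]] := IH x (par y).
  by move: xyn; rewrite (depth_parent yr) addnS ltnS.
exists (rcons p y); rewrite rcons_path pp lp last_rcons symE e_par //; split=> //.
rewrite /path_length -cats1 pairmap_cat big_cat /= big_cons big_nil addr0 -/(path_length len x p).
rewrite cp lp tree_distC [RHS]tree_distC [RHS]dist_through_par // addrC; congr (_ + _).
by rewrite (lenP _).2 // symE e_par.
Qed.

Lemma shortest_path_tree x y : shortest_path e len x y = dist x y.
Proof.
have [p [pp lp cp]] := shortest_exists x y.
apply/eqP; rewrite eq_le; apply/andP; split.
  rewrite -cp; apply: ge_inf; last by exists p.
  exists 0 => _ [q [pq _] <-]; apply: le_trans (dist_le_path pq).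
  by apply: tree_dist_ge0; exact: edge_weight_ge0.
apply: lb_le_inf; first by exists (path_length len x p), p.
by move=> _ [q [pq lq] <-]; rewrite -lq; exact: dist_le_path.
Qed.

End ShortestPath.

(** * Amortised competitive analysis *)

Section Amortization.
Context {R : realType} {X : finType} (d : X -> X -> R) (h : nat).

Lemma online_cost_nil (C : Type) (dist : C -> C -> R) (A : seq X -> C) :
  online_cost dist A [::] = 0.
Proof. by rewrite /online_cost /trajectory_cost big_ord0. Qed.

Lemma online_cost_rcons (C : Type) (dist : C -> C -> R) (A : seq X -> C) s x :
  online_cost dist A (rcons s x) = online_cost dist A s + dist (A s) (A (rcons s x)).
Proof.
rewrite /online_cost /trajectory_cost size_rcons big_ord_recr /=; congr (_ + _).
  apply: eq_bigr => -[i /= ilt] _.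
  by rewrite -cats1 !takel_cat // ltnW.
by rewrite -cats1 take_size_cat // take_oversize // size_cat /= addn1.
Qed.

(** Makes the set of offline costs nonempty, so that its [inf] is not a default value. *)
Lemma offline_solution_exists s : (0 < h <= #|X|)%N ->
  exists S : nat -> {set X}, offline_solution h s S.
Proof.
move=> /andP[h0 hX].
have one (x : X) : exists A : {set X}, #|A| = h /\ x \in A.
  pose p := take h (x :: enum (predC1 x)).
  exists [set y in p]; split; last first.
    by rewrite inE /p; case: (h) h0 => // n _; rewrite /= inE eqxx.
  rewrite cardsE (card_uniqP _); last first.
    by rewrite take_uniq //= mem_enum !inE eqxx enum_uniq.
  rewrite size_takel //= -cardE.
  by have := cardC1 x; rewrite /predC1 => ->; rewrite (leq_trans hX) // leqSpred.
have any : exists A : {set X}, #|A| = h.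
  have /card_gt0P[x _] : (0 < #|X|)%N by apply: leq_trans hX.
  by have [A []] := one x; exists A.
have /choice[S SP] : forall t, exists A : {set X}, #|A| = h /\
    forall x u, t = u.+1 -> onth s u = Some x -> x \in A.
  move=> [|t]; first by have [A Ah] := any; exists A; split.
  case E : (onth s t) => [x|]; last first.
    by have [A Ah] := any; exists A; split=> // y u [<-]; rewrite E.
  have [A [Ah xA]] := one x; exists A; split=> // y u [<-].
  by rewrite E => -[<-].
exists S; split=> t; first by have [] := SP t.
by move=> x; apply: (SP t.+1).2.
Qed.

(** The online cost is an abstract [cst], so that the argument also covers expected costs of a
    randomized algorithm. *)
Lemma potential_competitive (cst : seq X -> R) (step : seq X -> X -> R)
    (Psi : {set X} -> seq X -> R) (alpha c c' : R) :
  (0 < h <= #|X|)%N -> 0 < alpha ->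
  cst [::] <= 0 -> (forall s x, cst (rcons s x) <= cst s + step s x) ->
  (forall (A : {set X}) s, #|A| = h -> - c <= Psi A s) -> (forall A : {set X}, #|A| = h -> Psi A [::] <= c') ->
  (forall s x (A A' : {set X}), #|A| = h -> #|A'| = h -> x \in A' ->
     step s x + Psi A' (rcons s x) <= Psi A s + alpha * move_cost d A A') ->
  forall s, cst s <= alpha * offline_opt d h s + (c + c').
Proof.
move=> hX a0 cst0 cstS Psil Psi0 PsiS s.
have main (S : nat -> {set X}) : (forall t, #|S t| = h) ->
    (forall t x, onth s t = Some x -> x \in S t.+1) ->
    cst s + Psi (S (size s)) s <= c' + alpha * trajectory_cost (move_cost d) S (size s).
  move=> Sh; elim/last_ind: s => [|s x IH] Ss.
    rewrite /trajectory_cost big_ord0 mulr0 addr0 -[leRHS]add0r; apply: lerD => //.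
    by apply: Psi0.
  have onthr t : (t < size s)%N -> onth (rcons s x) t = onth s t.
    by rewrite -cats1 => ts; rewrite onth_cat ts.
  have Ss' t y : onth s t = Some y -> y \in S t.+1.
    move=> ty; apply: Ss; rewrite onthr //.
    by rewrite ltnNge; apply/negP => ts; rewrite onth_default in ty.
  have xS : x \in S (size s).+1.
    by apply: Ss; rewrite -cats1 onth_cat ltnn subnn.
  have := PsiS s x (S (size s)) (S (size s).+1) (Sh _) (Sh _) xS.
  have := IH Ss'; have := cstS s x.
  rewrite size_rcons {2}/trajectory_cost big_ord_recr /= -/(trajectory_cost _ _ _) mulrDr.
  by lra.
have bnd S : offline_solution h s S -> cst s - (c + c') <= alpha * trajectory_cost (move_cost d) S (size s).
  by move=> [Sh Ss]; have := main S Sh Ss; have := Psil (S (size s)) s (Sh _); lra.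
rewrite -lerBlDr mulrC -ler_pdivrMr //; apply: lb_le_inf.
  by have [S Sof] := offline_solution_exists s hX; exists (trajectory_cost (move_cost d) S (size s)), S.
by move=> _ [S Sof <-]; rewrite ler_pdivrMr // mulrC; exact: bnd.
Qed.

End Amortization.

(** * Number of servers of the chain and the logarithmic factor *)

Section Constants.
Context {R : realType}.

Lemma add_uphalf_le k : (1 < k -> k + 3 * uphalf k <= 3 * k)%N.
Proof.
have := odd_double_half k; rewrite uphalf_half -muln2.
by move: (k./2) (odd k) => n []; lia.
Qed.

(* [H] is the number of servers the chain is run with: serving only up to
   [H / k] and rescaling by [k / H <= 2] yields [k] servers. *)
Lemma augmentation (h k : nat) (eps : R) : (0 < h <= k)%N -> 0 < eps ->
  k%:R / h%:R = 1 + eps ->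
  exists H (d0 : R), [/\ (0 < h <= H)%N, (H < k)%N, k%:R / H%:R * (1 - d0) = 1 :> R &
    [/\ k%:R / H%:R <= 2 :> R, 0 < d0 <= 1 &
      ln ((1 + d0 / 4) / (d0 / 4)) <= 13 * log_inv eps]].
Proof.
move=> /andP[h0 hk] eps0 khE.
have h0' : 0 < h%:R :> R by rewrite ltr0n.
have kE : k%:R = h%:R * (1 + eps) by rewrite -khE mulrC divfK // gt_eqF.
have hk' : (h < k)%N by rewrite -(ltr_nat R) kE mulrDr mulr1 ltrDl mulr_gt0.
(* At least half of the [k] servers keep [k / H] bounded by 2 however large [eps] is. *)
pose H := maxn h (uphalf k).
have Hk : (H < k)%N.
  rewrite gtn_max hk' /= -[X in (_ < X)%N]odd_double_half uphalf_half ltn_add2l -addnn.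
  by rewrite -[X in (X < _)%N]addn0 ltn_add2l half_gt0 (leq_ltn_trans h0 hk').
have hH : (h <= H)%N by rewrite leq_max leqnn.
have H0 : 0 < H%:R :> R by rewrite ltr0n (leq_trans h0).
have k0 : 0 < k%:R :> R by rewrite ltr0n (leq_ltn_trans _ Hk).
have Hk2 : k%:R <= 2 * H%:R :> R.
  rewrite -natrM ler_nat mul2n (leq_trans _ (_ : (uphalf k).*2 <= _)%N) //.
    by rewrite -{1}(odd_double_half k) uphalf_half doubleD leq_add2r; case: (odd k).
  by rewrite leq_double leq_max leqnn orbT.
have HkR : H%:R < k%:R :> R by rewrite ltr_nat.
pose d0 := 1 - H%:R / k%:R : R.
have d0E : d0 * k%:R = k%:R - H%:R by rewrite /d0 mulrBl divfK ?gt_eqF // mul1r.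
have d00 : 0 < d0 by rewrite -(pmulr_lgt0 _ k0) d0E subr_gt0.
have d01 : d0 <= 1 by rewrite /d0 gerBl divr_ge0 // ltW.
exists H, d0; rewrite h0 hH Hk d00 d01; split=> //.
  by rewrite /d0 opprB addrC subrK mulrA divfK ?gt_eqF // divff // gt_eqF.
split=> //; first by rewrite ler_pdivrMr.
pose M := Num.max 1 eps^-1.
have M1 : 1 <= M by rewrite le_max lexx.
have Me : eps^-1 <= M by rewrite le_max lexx orbT.
(* [d0] is of the order of [min 1 eps]: either [H = h] and [d0 = eps / (1 + eps)], or [H = uphalf k]
   and [d0 >= 1 / 3]. *)
have d0M : 1 <= d0 * (3 * M).
  have [Hu|Hu] := leqP (uphalf k) h.
    have HE : H = h by rewrite /H; apply/maxn_idPl.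
    have d0E' : d0 * (1 + eps) = eps.
      apply: (mulfI (lt0r_neq0 h0')); rewrite mulrCA -kE d0E HE kE; ring.
    have eM : 1 <= eps * M by rewrite -ler_pdivrMl // mulr1.
    have : (1 + eps) <= (1 + eps) * (d0 * (3 * M)).
      by rewrite [leRHS]mulrA [(1 + eps) * d0]mulrC d0E'; nra.
    by rewrite ler_pMr // addr_gt0.
  have HE : H = uphalf k by rewrite /H; apply/maxn_idPr; exact: ltnW.
  have k3 : k%:R <= 3 * (k%:R - H%:R) :> R.
    have : (k + 3 * H <= 3 * k)%N.
      by rewrite HE; apply: add_uphalf_le; apply: leq_ltn_trans h0 hk'.
    by rewrite -(ler_nat R) natrD !natrM; lra.
  have : k%:R * 1 <= k%:R * (d0 * 3) by rewrite mulrA [k%:R * d0]mulrC d0E mulr1 mulrC.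
  by rewrite ler_pM2l //; nra.
have d4 : 0 < d0 / 4 by rewrite divr_gt0.
(* The left side is [1 + 4 / d0 <= 1 + 12 * M]. With [ln 13 <= 12] and [log_inv eps >= 1] this
   yields the factor 13. *)
have frac : (1 + d0 / 4) / (d0 / 4) <= 13 * M.
  rewrite ler_pdivrMr //; nra.
have lM : ln M <= log_inv eps.
  rewrite /M /log_inv; have [e1|e1] := leP eps^-1 1.
    by rewrite ln1 le_max ler01.
  by rewrite le_max lexx orbT.
have L1 : 1 <= log_inv eps by rewrite /log_inv le_max lexx.
apply: (@le_trans _ _ (ln (13 * M))).
  have M0 : 0 < M by apply: lt_le_trans M1.
  have f0 : 0 < (1 + d0 / 4) / (d0 / 4) by rewrite divr_gt0 // addr_gt0.
  by rewrite ler_ln // posrE // mulr_gt0.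
rewrite lnM ?posrE //; last exact: lt_le_trans M1.
have : ln (13 : R) <= 12.
  have := @le_ln1Dx R 12; rewrite (_ : 1 + 12 = 13); last by lra.
  by apply; lra.
by lra.
Qed.

End Constants.

Section ChainMass.
Context {R : realType} {U X : finType} (fr : forest U X) (H : nat).
Notation I := (U * 'I_H)%type.
Implicit Types (z : I -> R).

Lemma mass_ge0 z u : feasible fr z -> 0 <= mass z u.
Proof. by move=> [z0 _]; apply: sumr_ge0. Qed.

Lemma mass_children_sum z o : feasible fr z ->
  \sum_(u | fpar fr u == o) mass z u <= if o is Some p then mass z p else H%:R.
Proof.
move=> [z0 zS]; pose S := [set e : I | fpar fr e.1 == o].
have sib : siblings fr o S by apply/forall_inP => e; rewrite inE.
have := zS o S sib; rewrite (_ : \sum_(e in S) z e = \sum_(u | fpar fr u == o) mass z u); last first.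
  by rewrite pair_big /=; apply: eq_big => [[u i]|[u i] _] //; rewrite inE andbT.
move=> /le_trans; apply; rewrite /capacity; case: (o) => [p|]; last first.
  by rewrite ler_nat geq_minr.
rewrite [leRHS](_ : _ = \sum_(e : I | e.1 == p) z e); last first.
  transitivity (\sum_(u | u == p) \sum_i z (u, i)); first by rewrite big_pred1_eq.
  by rewrite pair_big /=; apply: eq_big => [[u i]|[u i] _] //=; rewrite andbT.
rewrite big_mkcond [leRHS]big_mkcond /=; apply: ler_sum => e _.
by case: eqP => //= _; case: ifP.
Qed.

Lemma feasible0 : feasible fr (fun _ : I => 0 : R).
Proof.
split=> // o S _; rewrite big1 // /capacity; case: o => [p|//].
by rewrite big1.
Qed.

Lemma potential_ge (w lo up : U -> R) delta A z : (forall u, 0 <= w u) -> 0 < delta <= 1 ->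
  (forall u, lo u <= up u) -> (forall u, up u <= 2^-1) -> feasible fr z ->
  - (\sum_u w u * H%:R) <= potential fr w lo up delta A z.
Proof.
move=> w0 d01 lu uh fz; rewrite -sumrN /potential sum_items; apply: ler_sum => u _.
rewrite /= -mulr_sumr -mulrN ler_wpM2l //.
have -> : H%:R = \sum_(i < H) 1 :> R by rewrite sumr_const card_ord.
rewrite -sumrN.
apply: ler_sum => i _ /=; have z1 := feasible_le1 fz (u, i); have z0 := fz.1 (u, i).
have g0 : 0 <= cost_weight fr delta A (u, i) * log_gain delta (z (u, i)).
  have /andP[cw _] := cost_weight01 fr d01 A (u, i).
  by rewrite mulr_ge0 ?log_gain_ge0.
have := lu u; have := uh u; nra.
Qed.

Lemma served_first (A : {set X}) y u (H0 : (0 < H)%N) : fanc fr u y -> y \in A ->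
  served fr A (u, Ordinal H0) = 1 :> R.
Proof.
move=> uy yA; rewrite /served /= (_ : (0 < _)%N) //.
by apply/card_gt0P; exists y; rewrite inE yA.
Qed.

End ChainMass.

Section Telescoping.
Context {R : realType} {V : finType} (t : rooted_tree V).
Notation r := (root t).
Notation par := (parent t).

(** Converts masses of subtrees into a distribution on points: a vertex holds what its children
    leave over. *)
Lemma inside_telescope (y : V -> R) u :
  \sum_(x | below t u x) (y x - \sum_(c | (c != r) && (par c == x)) y c) = y u.
Proof.
rewrite sumrB (exchange_big_dep (fun c => below t u c && (c != u))) /=; last first.
  move=> x c ux /andP[cr /eqP pcx].
  have xc : below t x c by rewrite -pcx below_par.
  rewrite (below_trans ux xc) /=; apply: contraTneq ux => cu.
  by rewrite -pcx cu par_below_neq // -cu.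
rewrite (bigD1 u) ?below_refl //= -addrA -sumrB big1 ?addr0 // => c /andP[uc cu].
rewrite (big_pred1 (par c)) ?subrr // => x /=.
have cr : c != r.
  apply: contraNneq cu => cr; apply/eqP/esym; apply: (below_anti uc); rewrite cr.
  exact: below_root.
rewrite cr /= [par c == x]eq_sym andbC; have [->|//] := eqVneq x (par c).
by apply: below_parent_of => //; rewrite eq_sym.
Qed.

End Telescoping.

(** * The fractional algorithm on trees *)

Section PointForest.
Context {V : finType} (t : rooted_tree V).
Notation r := (root t).
Notation par := (parent t).

(* [inr v] is the point [v] itself, hung below the vertex [inl v], so that
   servers may also stay at inner vertices. *)
Definition point_par (u : V + V) : option (V + V) :=
  match u with inl v => if v == r then None else Some (inl (par v)) | inr v => Some (inl v) end.

Definition point_dep (u : V + V) : nat :=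
  match u with inl v => depth t v | inr v => (depth t v).+1 end.

Definition point_anc (u : V + V) (x : V) : bool :=
  match u with inl v => below t v x | inr v => x == v end.

Lemma point_dep_par u v : point_par v = Some u -> (point_dep u < point_dep v)%N.
Proof.
case: v => v /=; last by move=> [<-].
by case: (eqVneq v r) => // vr [<-] /=; rewrite (depth_parent vr).
Qed.

Lemma point_anc_par u v x : point_par v = Some u -> point_anc v x -> point_anc u x.
Proof.
case: v => v /=; last by move=> [<-] /eqP -> /=; exact: below_refl.
by case: (eqVneq v r) => // vr [<-] /=; apply: below_trans (below_par _ _).
Qed.

Lemma point_anc_inj u v x : point_par u = point_par v -> point_anc u x -> point_anc v x -> u = v.
Proof.
case: u => u; case: v => v /=.
- case: (eqVneq u r) => [->|ur]; case: (eqVneq v r) => [->|vr] // [pE] ux vx.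
  by rewrite (sibling_inj ur vr pE ux vx).
- case: (eqVneq u r) => // ur [<-] ux /eqP xE; move: ux.
  by rewrite xE par_below_neq.
- case: (eqVneq v r) => // vr [->] /eqP xE; rewrite xE par_below_neq //.
- by move=> _ /eqP -> /eqP ->.
Qed.

Definition point_forest := Forest point_dep_par point_anc_par point_anc_inj.

End PointForest.

Section TreeAlgorithm.
Context {R : realType} {V : finType} (t : rooted_tree V) (w : V -> R).
Notation r := (root t).
Notation par := (parent t).
Notation dist := (tree_dist t id w).
Variables (h H k D : nat) (d0 : R).

Hypothesis w_ge0 : forall u, 0 <= w u.
Hypothesis w_root : w r = 0.
Hypothesis D_gt0 : (0 < D)%N.
Hypothesis depth_le : forall v, (depth t v <= D)%N.
Hypothesis h_gt0 : (0 < h)%N.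
Hypothesis hH : (h <= H)%N.
Hypothesis Hk : (H < k)%N.
Hypothesis kV : (k <= #|V|)%N.
Hypothesis d0_01 : 0 < d0 <= 1.
Hypothesis scale_serve : k%:R / H%:R * (1 - d0) = 1 :> R.

Notation fr := (point_forest t).
Notation I := ((V + V) * 'I_H)%type.
Let delta := d0 / 4.
(** Each level lowers the labels by [2 / M]. There are at most [D + 1 <= 2 * D] levels, so the
    labels stay above [2^-1 - 4 * D / M = 4^-1]. Movement across an edge is charged at rate
    [1 / M]. *)
Let M : R := 16 * D%:R.
Let w' (u : V + V) : R := if u is inl v then w v else 0.
Let lo (u : V + V) : R :=
  match u with inl v => 2^-1 - 2 * (depth t v).+1%:R / M | inr v => 2^-1 - 2 * (depth t v).+1%:R / M end.
Let up (u : V + V) : R :=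
  match u with inl v => 2^-1 - 2 * (depth t v)%:R / M | inr v => 2^-1 - 2 * (depth t v).+1%:R / M end.

Let Dr : 1 <= D%:R :> R. Proof. by rewrite ler1n. Qed.
Let M0 : 0 < M. Proof. by rewrite mulr_gt0 // (lt_le_trans ltr01). Qed.
Let w'0 u : 0 <= w' u. Proof. by case: u => v /=. Qed.
Let delta01 : 0 < delta <= 1. Proof. by rewrite /delta; have := andP d0_01 => -[]; lra. Qed.

Let lo4 u : 4^-1 <= lo u.
Proof.
have dv v : 2 * (depth t v).+1%:R / M <= 4^-1.
  have dD : (depth t v).+1%:R <= 2 * D%:R :> R.
    by rewrite -natrM ler_nat; have := depth_le v; have := D_gt0; lia.
  by rewrite ler_pdivrMr // /M mulrA (_ : 4^-1 * 16 = 4); [lra|field].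
by case: u => v /=; have := dv v; lra.
Qed.

Let chargeE (z z' : I -> R) : charge w' lo up z z' =
  (\sum_u w u * `|mass z' (inl u) - mass z (inl u)|) / M :> R.
Proof.
rewrite /charge big_sumType /= [X in _ + X]big1 ?addr0 => [|u _]; last by rewrite !mul0r.
rewrite mulr_suml; apply: eq_bigr => u _; rewrite -!mulrA; congr (_ * _); rewrite mulrA mulrC; congr (_ * _).
by rewrite -[(depth t u).+1%:R]natr1; have /lt0r_neq0 := M0; move: (M) => m m0; field.
Qed.

Let lo_up u : lo u <= up u.
Proof.
rewrite /lo /up; case: u => v; last exact: lexx.
by rewrite lerD2l lerN2 ler_pM2r ?invr_gt0 // ler_pM2l // ler_nat leqnSn.
Qed.

Let up_half u : up u <= 2^-1.
Proof. by case: u => v /=; rewrite gerBl divr_ge0 // ?mulr_ge0 // ltW. Qed.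

Let up_lo u v : fpar fr v = Some u -> up v <= lo u.
Proof.
case: v => v /=; last by move=> [<-].
by case: (eqVneq v r) => // vr [<-] /=; rewrite (depth_parent vr).
Qed.

Let lo_ge0 u : 0 <= lo u.
Proof. by apply: le_trans (lo4 u); rewrite invr_ge0. Qed.

(** The root is credited with all [H] servers, whatever the chain holds, so that the total mass is
    constant. *)
Let level (z : I -> R) v : R := if v == r then H%:R else mass z (inl v).

Let spread (z : I -> R) v : R :=
  k%:R / H%:R * (level z v - \sum_(c | (c != r) && (par c == v)) level z c).

Let H_gt0 : (0 < H)%N. Proof. exact: leq_trans hH. Qed.
Let HR : 0 < H%:R :> R. Proof. by rewrite ltr0n. Qed.
Let kH0 : 0 <= k%:R / H%:R :> R. Proof. by rewrite divr_ge0. Qed.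

Let spread_point z v : feasible fr z -> k%:R / H%:R * mass z (inr v) <= spread z v.
Proof.
move=> fz; rewrite /spread ler_wpM2l // lerBrDr.
have := mass_children_sum (Some (inl v)) fz; rewrite (bigD1 (inr v)) //= => le.
apply: le_trans (_ : _ <= mass z (inl v)) _.
  apply: le_trans le; rewrite lerD2l [leRHS]big_sumType /= [X in _ <= _ + X]big1 ?addr0; last first.
    by move=> u /andP[/eqP[->]]; rewrite eqxx.
  rewrite big_mkcond [leRHS]big_mkcond /=; apply: ler_sum => c _; rewrite andbT.
  case: (eqVneq c r) => //= cr; rewrite /level (negbTE cr) /=.
  by rewrite [Some _ == _]/(par c == v); case: ifP => _; rewrite ?mass_ge0.
rewrite /level; case: eqP => // ->.
have := mass_children_sum None fz; apply: le_trans.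
rewrite (bigD1 (inl r)) /= ?eqxx // lerDl; apply: sumr_ge0 => u _; exact: mass_ge0 fz.
Qed.

Let spread_ge0 z v : feasible fr z -> 0 <= spread z v.
Proof.
move=> fz; apply: le_trans (spread_point v fz).
by apply: mulr_ge0 => //; exact: mass_ge0 fz.
Qed.

Let inside_spread z u : inside t id (spread z) u = k%:R / H%:R * level z u.
Proof. by rewrite /inside -mulr_sumr inside_telescope. Qed.

Let sum_spread z : \sum_x spread z x = k%:R.
Proof.
by rewrite -(inside_root t id) inside_spread /level eqxx divfK // gt_eqF.
Qed.

Let countE A v : count fr A (inl v) = inhabitants t id A v. Proof. by []. Qed.

(** The chain reaches [1 - d0] at the request, scaling by [k / H] raises this to 1, and capping
    removes excess mass. The amortisation adds the outstanding plan cost of [capping] to the scaled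
    potential of the chain. *)
Theorem tree_algorithm (d : V -> V -> R) (alpha : R) : d =2 dist ->
  alpha = k%:R / H%:R * M * ln ((1 + delta) / delta) -> 0 < alpha ->
  exists2 F : seq V -> V -> R, fractional_algorithm k F &
  competitive d h alpha (fun s => (online_cost (earthmover d) F s)%:E).
Proof.
move=> dE aE a0; have {dE} -> : d = dist by apply: funext => x; apply: funext => y.
pose Step (s : seq V) y (z z' : I -> R) := 1 - d0 <= z' (inr y, Ordinal H_gt0) /\
  forall A : {set V}, y \in A -> (#|A| <= H)%N ->
    charge w' lo up z z' + potential fr w' lo up delta A z' <= potential fr w' lo up delta A z.
pose Inv (s : seq V) (z : I -> R) := feasible fr z /\ (s = [::] -> z = fun=> 0).
have [||run [runI runS]] := online_run (Inv := Inv) (Step := Step).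
- by exists (fun=> 0); split=> //; exact: feasible0.
- move=> s y z [fz _].
  have [|z' [fz' z'y z'A]] := serve delta01 lo_ge0 lo_up up_half up_lo w'0 fz
    (y := y) (e0 := (inr y, Ordinal H_gt0)) (d0 := d0) _ H_gt0 (lo4 _) (lexx _).
    by move=> A yA; apply: served_first yA; rewrite /= eqxx.
  by exists z'; split; split=> //; case: (s).
pose G s := spread (run s).
pose B s x := k%:R / H%:R * M * charge w' lo up (run s) (run (rcons s x)).
have fz s : feasible fr (run s) by have [] := runI s.
have BE s x : \sum_u w u * `|inside t id (G s) u - inside t id (G (rcons s x)) u| <= B s x.
  rewrite /B chargeE -[leRHS]mulrA [M * _]mulrC divfK ?gt_eqF // mulr_sumr; apply: ler_sum => u _.
  rewrite !inside_spread -mulrBr normrM ger0_norm // mulrCA ler_wpM2l //.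
  rewrite /level; case: eqP => [->|_]; first by rewrite w_root !mul0r.
  by rewrite distrC.
have [|||||||F [Pt [C [F01 Fk Fx Pt0 CP]]]] := @capping _ _ dist _ _ _ k G B kV.
- exact: tree_dist_ge0.
- exact: tree_distxx.
- by move=> x y z; exact: tree_dist_triangle.
- by move=> s x; exact: spread_ge0.
- by move=> s; exact: sum_spread.
- move=> s x; rewrite -scale_serve; apply: le_trans (spread_point x (fz _)).
  rewrite ler_wpM2l //; apply: le_trans (runS s x).1 _.
  by rewrite /mass (bigD1 (Ordinal H_gt0)) //= lerDl sumr_ge0 // => i _; exact: (fz _).1.
- move=> s x; have [|||g [pg cg _]] := @tree_plan _ _ _ t id w w_ge0 (G s) (G (rcons s x)).
  + by move=> y; exact: spread_ge0.
  + by move=> y; exact: spread_ge0.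
  + by rewrite !sum_spread.
  by exists g => //; apply: le_trans cg (BE s x).
exists F; first by split=> // s x; have /andP[] := F01 s x.
pose L := ln ((1 + delta) / delta).
have kM : 0 <= k%:R / H%:R * M by rewrite mulr_ge0 // ltW.
pose Psi A s := Pt s + k%:R / H%:R * M * potential fr w' lo up delta A (run s).
exists (k%:R / H%:R * M * (\sum_u w' u * H%:R) + Pt [::]) => s; rewrite lee_fin.
apply: (@potential_competitive _ _ dist h _ (fun s x => C s x) Psi _ _ _ _ a0) => //.
- by rewrite h_gt0 (leq_trans hH) // (leq_trans (ltnW Hk)).
- by rewrite online_cost_nil.
- move=> s' x; rewrite online_cost_rcons lerD2l; have [_ [g pg cg]] := CP s' x.
  by apply: le_trans cg; apply: earthmover_le pg; exact: tree_dist_ge0.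
- move=> A s' _; rewrite /Psi -mulrN -[leLHS]add0r; apply: lerD => //.
  by apply: ler_wpM2l => //; apply: potential_ge.
- move=> A _; rewrite /Psi (_ : run [::] = fun=> 0); last by have [_ ->] := runI [::].
  by rewrite potential0 // mulr0 addr0.
- move=> s' x A A' Ah A'h xA'; have [CB _] := CP s' x.
  have := (runS s' x).2 A' xA'; rewrite A'h => /(_ hH) st.
  have mv := potential_move lo up A A' w'0 delta01 (fz s').
  have mc : \sum_u w' u * `|(count fr A' u)%:R - (count fr A u)%:R| <= move_cost dist A A'.
    rewrite big_sumType /= [X in _ + X]big1 ?addr0 => [|u _]; last by rewrite mul0r.
    have AA : #|A| = #|A'| by rewrite Ah.
    apply: le_trans (move_cost_ge t id w_ge0 AA).
    by apply: ler_sum => u _; rewrite distrC.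
  have L0 : 0 <= L.
    rewrite ln_ge0 // ler_pdivlMr ?mul1r; last by case/andP: delta01.
    by rewrite lerDr.
  rewrite aE /Psi; move: CB; rewrite /B.
  set c1 := k%:R / H%:R * M in kM *.
  set P1 := potential _ _ _ _ _ A' (run (rcons s' x)) in st *.
  set P0 := potential _ _ _ _ _ A' (run s') in st mv *.
  set P := potential _ _ _ _ _ A (run s') in mv *.
  have lem : P1 + charge w' lo up (run s') (run (rcons s' x)) <= P + L * move_cost dist A A'.
    have : L * \sum_u w' u * `|(count fr A' u)%:R - (count fr A u)%:R| <= L * move_cost dist A A'.
      exact: ler_wpM2l.
    by move: mv; rewrite -/L; lra.
  by have := ler_wpM2l kM lem; rewrite -/L !mulrDr -[c1 * L * _]mulrA; lra.
Qed.

End TreeAlgorithm.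

Lemma inf_ge0 (R : realType) (A : set R) : (forall x, A x -> 0 <= x) -> 0 <= inf A.
Proof.
move=> A0; have [->|/set0P A1] := eqVneq A set0; first by rewrite inf0.
exact: lb_le_inf.
Qed.

Lemma offline_opt_ge0 (R : realType) (X : finType) (d : X -> X -> R) h s :
  (forall x y, 0 <= d x y) -> 0 <= offline_opt d h s.
Proof.
move=> d0; apply: inf_ge0 => _ [S _ <-]; apply: sumr_ge0 => i _.
by apply: inf_ge0 => _ [f _ <-]; apply: sumr_ge0.
Qed.

Lemma competitive_le (R : realType) (X : finType) (d : X -> X -> R) h alpha alpha' (cost : seq X -> \bar R) :
  (forall x y, 0 <= d x y) -> alpha <= alpha' -> competitive d h alpha cost -> competitive d h alpha' cost.
Proof.
move=> d0 le [c cP]; exists c => s; apply: le_trans (cP s) _.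
by rewrite lee_fin lerD2r ler_wpM2r // offline_opt_ge0.
Qed.

Lemma hop_diameter_gt0 (V : finType) (e : rel V) : is_tree e -> (1 < #|V|)%N -> (0 < hop_diameter e)%N.
Proof.
move=> Te V2; have /card_gt0P[r _] : (0 < #|V|)%N by apply: ltnW.
have [t [tr _ _ dD]] := rooted_at r Te.
have /card_gt0P[v] : (0 < #|predC1 r|)%N by rewrite (cardC1 r) -subn1 subn_gt0.
rewrite inE => vr; apply: leq_trans (dD v).
by rewrite (depth_parent (v := v)) // tr.
Qed.

Lemma tree_part (R : realType) : exists2 C : R, 0 < C &
  forall (V : finType) (e : rel V) (len : V -> V -> R) (h k : nat) (eps : R),
    is_tree e -> edge_lengths e len ->
    (0 < h <= k)%N -> (k <= #|V|)%N ->
    0 < eps -> k%:R / h%:R = 1 + eps ->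
    let d := shortest_path e len in
    exists2 F : seq V -> V -> R,
      fractional_algorithm k F &
      competitive d h (C * ((hop_diameter e)%:R * log_inv eps))
        (fun s => (online_cost (earthmover d) F s)%:E).
Proof.
(* [416 = 2 * 16 * 13]: the bound on [k / H], the factor in the label spacing, and the factor of
   [log_inv eps] from [augmentation]. *)
exists 416%:R; first by rewrite ltr0n.
move=> V e len h k eps Te lenP hk kV eps0 khE d.
have [H [d0 [/andP[h0 hH] Hk serve1 [kH2 d01 LE]]]] := augmentation hk eps0 khE.
have V2 : (1 < #|V|)%N by apply: leq_trans kV; apply: leq_ltn_trans Hk; exact: leq_trans hH.
have /card_gt0P[r _] : (0 < #|V|)%N by apply: ltnW.
have [t [tr epar eonly dD]] := rooted_at r Te; rewrite -tr in epar eonly.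
have [symE _ _ _] := Te; have D0 := hop_diameter_gt0 Te V2.
pose w := edge_weight len t.
have w0 u : 0 <= w u by apply: edge_weight_ge0 lenP symE epar u.
have wr : w (root t) = 0 by rewrite /w /edge_weight eqxx.
have dE x y : d x y = tree_dist t id w x y.
  exact: (shortest_path_tree lenP symE epar eonly).
have H0 : 0 < H%:R :> R by rewrite ltr0n (leq_trans h0).
have kR : 0 < k%:R :> R by rewrite ltr0n (leq_ltn_trans _ Hk).
have DR : 1 <= (hop_diameter e)%:R :> R by rewrite ler1n.
have [d00 d0le] := andP d01.
have L0 : 0 < ln ((1 + d0 / 4) / (d0 / 4)).
  by rewrite ln_gt0 // ltr_pdivlMr ?divr_gt0 // mul1r ltrDr.
have a0 : 0 < k%:R / H%:R * (16 * (hop_diameter e)%:R) * ln ((1 + d0 / 4) / (d0 / 4)).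
  by rewrite !mulr_gt0 ?invr_gt0 // (lt_le_trans ltr01).
have [F Fk Fc] := tree_algorithm w0 wr D0 dD h0 hH Hk kV d01 serve1 dE erefl a0.
exists F => //; apply: competitive_le Fc; first by move=> x y; rewrite dE tree_dist_ge0.
rewrite [leRHS](_ : _ = 2 * (16 * (hop_diameter e)%:R) * (13 * log_inv eps)); last first.
  by rewrite (_ : 416%:R = 2 * 16 * 13 :> R) -?natrM //; ring.
apply: ler_pM LE; [|exact: ltW|by rewrite ler_wpM2r // mulr_ge0].
by apply: mulr_ge0; [exact: divr_ge0|exact: mulr_ge0].
Qed.

(** * Hierarchically separated trees *)

Section HeavyPaths.
Context {R : realType} {V : finType} (t : rooted_tree V) (M : R).
Notation r := (root t).
Notation par := (parent t).
Implicit Types (des : V -> V) (y : V -> R).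

Definition child p c := (c != r) && (par c == p).

Definition designates des := forall p c, child p c -> child p (des p).

Definition light des v := (v != r) && (des (par v) != v).

Definition light_depth des v := #|[set u | below t u v && light des u]|.

Definition tree_mass y :=
  [/\ forall v, 0 <= y v, forall p, \sum_(c | child p c) y c <= y p & y r <= M].

Lemma below_of_root v : below t v r -> v = r.
Proof. by rewrite belowE eqxx orbF => /eqP. Qed.

Lemma child_par v : v != r -> child (par v) v.
Proof. by move=> vr; rewrite /child vr eqxx. Qed.

Lemma child_below p c : child p c -> below t p c.
Proof. by case/andP=> _ /eqP <-; exact: below_par. Qed.

Fixpoint hat_rec des y n v : R :=
  if v == r then M else
  if light des v then y v else
  if n is n'.+1 then hat_rec des y n' (par v) - \sum_(c | child (par v) c && (c != v)) y c else 0.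

(* The mass [y p] not accounted for by the children of [p], as well as the
   mass of the root missing from [M], is given to the designated child. *)
Definition hat des y v := hat_rec des y (depth t v) v.

Lemma hatE des y v : hat des y v =
  if v == r then M else if light des v then y v
  else hat des y (par v) - \sum_(c | child (par v) c && (c != v)) y c.
Proof.
rewrite {1}/hat; have [->|vr] := eqVneq v r; last first.
  by rewrite (depth_parent vr) /= (negbTE vr).
by case: (depth t r) => [|n] /=; rewrite eqxx.
Qed.

Lemma hat_unique des y (g : V -> R) : g r = M ->
  (forall v, v != r -> g v = if light des v then y v
     else g (par v) - \sum_(c | child (par v) c && (c != v)) y c) ->
  g =1 hat des y.
Proof.
move=> gr gE; elim/(below_ind (t := t)) => [|v vr IH].
  by rewrite hatE eqxx gr.
by rewrite gE // hatE (negbTE vr) IH.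
Qed.

Lemma hat_root des y : hat des y r = M.
Proof. by rewrite hatE eqxx. Qed.

Lemma hat_light des y v : light des v -> hat des y v = y v.
Proof. by move=> lv; rewrite hatE lv; case/andP: lv => /negbTE ->. Qed.

Lemma hat_heavy des y v : v != r -> ~~ light des v ->
  hat des y v = hat des y (par v) - \sum_(c | child (par v) c && (c != v)) y c.
Proof. by move=> /negbTE vr /negbTE lv; rewrite hatE vr lv. Qed.

Lemma heavyP des v : v != r -> ~~ light des v -> v = des (par v).
Proof. by move=> vr; rewrite /light vr negbK => /eqP. Qed.

Lemma light_child_le y v : tree_mass y -> v != r -> y v <= y (par v).
Proof.
move=> [y0 yc _] vr; apply: le_trans (yc (par v)).
by rewrite (bigD1 v) ?child_par //= lerDl sumr_ge0.
Qed.

Lemma mass_below y u v : tree_mass y -> below t u v -> y v <= y u.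
Proof.
move=> ym; elim/(below_ind (t := t)): v => [|v vr IH].
  by rewrite belowE eqxx orbF => /eqP ->.
by rewrite belowE vr => /predU1P[->//|/= /IH]; apply: le_trans; exact: light_child_le.
Qed.

Lemma hat_ge des y v : tree_mass y -> y v <= hat des y v.
Proof.
move=> ym; have [y0 yc yr] := ym; elim/(below_ind (t := t)): v => [|v vr IH].
  by rewrite hat_root.
have [/hat_light -> //|lv] := boolP (light des v).
rewrite hat_heavy // lerBrDr; apply: le_trans IH; apply: le_trans (yc (par v)).
by rewrite [leRHS](bigD1 v) ?child_par //= lerD2l.
Qed.

Lemma hat_ge0 des y v : tree_mass y -> 0 <= hat des y v.
Proof. by move=> ym; apply: le_trans (hat_ge des v ym); case: ym. Qed.

Lemma hat_par_le des y v : tree_mass y -> v != r -> hat des y v <= hat des y (par v).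
Proof.
move=> ym vr; have [lv|lv] := boolP (light des v).
  by rewrite hat_light //; apply: le_trans (hat_ge des _ ym); exact: light_child_le.
by rewrite [leLHS]hat_heavy // gerBl sumr_ge0 // => c _; case: ym.
Qed.

(** The designated child takes exactly what its siblings leave. All mass therefore flows down to the
    leaves, where the servers have to be. *)
Lemma hat_children des y p c0 : designates des -> child p c0 ->
  \sum_(c | child p c) hat des y c = hat des y p.
Proof.
move=> desP pc0; have pd := desP _ _ pc0; have /andP[dr /eqP dp] := pd.
rewrite (bigD1 (des p)) //= (hat_heavy _ dr); last by rewrite /light dr dp eqxx.
rewrite dp [X in _ + X](eq_bigr y) ?subrK // => c /andP[/andP[cr /eqP cp] cd].
by rewrite hat_light // /light cr cp eq_sym.
Qed.

Lemma light_depthE des v : v != r ->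
  light_depth des v = (light_depth des (par v) + light des v)%N.
Proof.
move=> vr; rewrite /light_depth.
have -> : [set u | below t u v && light des u] =
    [set u | below t u (par v) && light des u] :|: [set u | (u == v) && light des u].
  apply/setP => u; rewrite !inE belowE vr [v == u]eq_sym /=.
  by rewrite -andb_orl orbC.
rewrite cardsU (_ : _ :&: _ = finset.set0) ?cards0 ?subn0; last first.
  apply/setP => u; rewrite !inE; have [->|//] := eqVneq u v; last by rewrite !andbF.
  by rewrite par_below_neq.
congr (_ + _)%N; have [lv|lv] := boolP (light des v).
  rewrite (_ : [set u | _] = [set v]%SET) ?cards1 //; apply/setP => u; rewrite !inE.
  by case: eqVneq => // ->.
rewrite (_ : [set u | _] = finset.set0) ?cards0 //; apply/setP => u; rewrite !inE.
by case: eqVneq => // ->; rewrite (negbTE lv).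
Qed.

Lemma light_depth_root des : light_depth des r = 0%N.
Proof.
apply/eqP; rewrite cards_eq0; apply/eqP/setP => u; rewrite !inE belowE eqxx orbF.
by case: eqVneq => //= <-; rewrite /light eqxx.
Qed.

Lemma light_depth_le des v : (light_depth des v <= depth t v)%N.
Proof.
elim/(below_ind (t := t)): v => [|v vr IH]; first by rewrite light_depth_root.
by rewrite light_depthE // (depth_parent vr) -addn1 leq_add // leq_b1.
Qed.

Section Geometric.
Variables (w : V -> R) (tau : R).
Hypothesis w_ge0 : forall u, 0 <= w u.
Hypothesis tau_gt1 : 1 < tau.
Hypothesis w_geo : forall v, v != r -> par v != r -> w (par v) = tau * w v.

Let tau0 : 0 < tau. Proof. exact: lt_trans ltr01 _. Qed.
Let tau1 : 0 < tau - 1. Proof. by rewrite subr_gt0. Qed.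

Lemma le_of_geometric (S T : R) : S <= T + S / tau -> S <= tau / (tau - 1) * T.
Proof.
move=> le; rewrite mulrAC ler_pdivlMr // mulrBr mulr1 lerBlDr.
have := ler_wpM2l (ltW tau0) le; rewrite mulrDr [tau * (S / tau)]mulrC divfK ?gt_eqF //; lra.
Qed.

(** A discrepancy is handed on to one child only, where it weighs [tau] times less, so the levels
    sum to a geometric series. [g] vanishes at the root, where [w_geo] says nothing. *)
Lemma geometric_chain (s : V -> V) (g be : V -> R) : (forall v, 0 <= g v) -> g r = 0 ->
  (forall v, v != r -> g v <= (v == s (par v))%:R * g (par v) + be v) ->
  \sum_(v | v != r) w v * g v <= tau / (tau - 1) * \sum_(v | v != r) w v * be v.
Proof.
move=> g0 gr gle; apply: le_of_geometric.
apply: (@le_trans _ _ (\sum_(v | v != r) (w v * be v + (v == s (par v))%:R * (w v * g (par v))))).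
  by apply: ler_sum => v vr; rewrite addrC mulrCA -mulrDr ler_wpM2l // gle.
rewrite big_split lerD2l /=.
rewrite (partition_big par predT) //= mulr_suml [leRHS]big_mkcond /=; apply: ler_sum => p _.
have [->|pr] := eqVneq p r.
  by rewrite big1 // => v /andP[_ /eqP ->]; rewrite gr !mulr0.
apply: (@le_trans _ _ (\sum_(v | (v != r) && (par v == p)) (v == s p)%:R * (w p * g p / tau))).
  apply: ler_sum => v /andP[vr /eqP vp]; rewrite vp ler_wpM2l // -vp w_geo ?vp //.
  by rewrite [leRHS](_ : _ = w v * g p) //; field; rewrite gt_eqF.
rewrite -mulr_suml; apply: ler_piMl; first by rewrite divr_ge0 ?mulr_ge0 // ltW.
rewrite big_mkcond (bigD1 (s p)) //= eqxx [X in _ + X]big1 ?addr0; first by case: ifP.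
by move=> v /negbTE ->; case: ifP.
Qed.

(** From one level to the next the total mass does not grow, while the weights drop by the factor
    [tau]. *)
Lemma subtree_sum y v : tree_mass y -> v != r ->
  \sum_(u | below t v u) w u * y u <= tau / (tau - 1) * (w v * y v).
Proof.
move=> ym vr; have [y0 yc _] := ym; apply: le_of_geometric.
rewrite {1}(bigD1 v) ?below_refl //= lerD2l.
rewrite (partition_big par (below t v)) /=; last first.
  by move=> u /andP[vu uv]; apply: below_parent_of => //; rewrite eq_sym.
rewrite mulr_suml; apply: ler_sum => p vp.
have pr : p != r by apply: contraNneq vr => pr; rewrite (@below_of_root v) // -pr.
apply: (@le_trans _ _ (\sum_(c | child p c) w c * y c)).
  rewrite big_mkcond [leRHS]big_mkcond /=; apply: ler_sum => u _.
  case: ifP => [/andP[/andP[vu uv] up]|_]; last by case: ifP => // _; rewrite mulr_ge0.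
  rewrite /child up andbT ifT //; apply: contraNneq vr => ur.
  by rewrite (@below_of_root v) // -ur.
apply: (@le_trans _ _ (\sum_(c | child p c) w p / tau * y c)).
  apply: ler_sum => c /andP[cr /eqP cp]; rewrite ler_wpM2r // -cp w_geo ?cp //.
  by rewrite mulrAC divff ?gt_eqF // mul1r.
by rewrite -mulr_sumr [leRHS]mulrAC ler_wpM2l ?divr_ge0 // ltW.
Qed.

(* The weights decrease geometrically along the heavy paths, so that the
   completion of [y] only costs a constant factor. *)
Lemma hat_move des y y' : designates des ->
  (forall c, child r c -> w (des r) <= w c) ->
  \sum_(v | v != r) w v * `|hat des y' v - hat des y v| <=
  tau / (tau - 1) * (2 * \sum_(v | light des v) w v * `|y' v - y v|).
Proof.
move=> desP desr.
pose be v := if light des v then `|y' v - y v|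
  else \sum_(c | child (par v) c && (c != v)) `|y' c - y c|.
apply: (@le_trans _ _ (tau / (tau - 1) * \sum_(v | v != r) w v * be v)).
  apply: (@geometric_chain des (fun v => `|hat des y' v - hat des y v|)) => //.
    by rewrite !hat_root subrr normr0.
  move=> v vr; rewrite /be; have [lv|lv] := boolP (light des v).
    by rewrite !(hat_light _ lv) lerDr mulr_ge0.
  rewrite -heavyP // eqxx mul1r.
  have -> : hat des y' v - hat des y v = (hat des y' (par v) - hat des y (par v))
      - \sum_(c | child (par v) c && (c != v)) (y' c - y c).
    by rewrite !(hat_heavy _ vr lv) sumrB; ring.
  by apply: le_trans (ler_normB _ _) _; rewrite lerD2l; exact: ler_norm_sum.
rewrite ler_pM2l ?divr_gt0 // (bigID (light des)) /= mulrDl mul1r lerD //.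
  rewrite big_mkcond [leRHS]big_mkcond /=; apply: ler_sum => v _.
  by rewrite /be /light; case: ifP => [/andP[-> ->] //|_]; case: ifP => // _; rewrite mulr_ge0.
apply: (@le_trans _ _ (\sum_(v | (v != r) && ~~ light des v)
    \sum_(c | (c != r) && (par c == par v) && light des c) w c * `|y' c - y c|)).
  apply: ler_sum => v /andP[vr lv]; rewrite /be (negbTE lv) mulr_sumr.
  rewrite big_mkcond [leRHS]big_mkcond /=; apply: ler_sum => c _.
  have vE := heavyP vr lv.
  have [/andP[/andP[cr /eqP cp] cv]|_] := boolP (child _ _ && _); last first.
    by case: ifP => // _; rewrite mulr_ge0.
  rewrite cr cp eqxx /light cr cp -vE eq_sym cv /= ler_wpM2r //.
  (* The designated child weighs no more than its siblings: by its choice at the root, and because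
     siblings have equal weights elsewhere. *)
  have [pr|pr] := eqVneq (par v) r.
    by rewrite vE pr desr // /child cr cp pr eqxx.
  have := w_geo vr pr; have := w_geo cr; rewrite cp => /(_ pr) -> /(mulfI (lt0r_neq0 tau0)).
  by move=> ->.
rewrite (exchange_big_dep (light des)) /=; last by move=> v c _ /andP[].
apply: ler_sum => c lc; have /andP[cr _] := lc.
rewrite (big_pred1 (des (par c))) // => v /=.
rewrite cr lc andbT /=; apply/andP/eqP => [[/andP[vr lv] /eqP ->]|->]; first exact: heavyP.
have /andP[dr /eqP dp] := desP _ _ (child_par cr).
by rewrite dr dp eqxx /light dr dp eqxx.
Qed.

End Geometric.

End HeavyPaths.

Section LeafForest.
Context {V X : finType} (t : rooted_tree V) (j : X -> V).
Notation r := (root t).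
Notation par := (parent t).

Definition leaf_par v := if v == r then None else Some (par v).

Lemma leaf_parE u v : (leaf_par v == Some u) = child t u v.
Proof. by rewrite /leaf_par /child; case: (v == r). Qed.

Lemma leaf_dep_par u v : leaf_par v = Some u -> (depth t u < depth t v)%N.
Proof. by move/eqP; rewrite leaf_parE => /andP[vr /eqP <-]; rewrite (depth_parent vr). Qed.

Lemma leaf_anc_par u v x : leaf_par v = Some u -> below t v (j x) -> below t u (j x).
Proof. by move/eqP; rewrite leaf_parE => /child_below; exact: below_trans. Qed.

Lemma leaf_anc_inj u v x : leaf_par u = leaf_par v -> below t u (j x) -> below t v (j x) -> u = v.
Proof.
rewrite /leaf_par; case: (eqVneq u r) => [->|ur]; case: (eqVneq v r) => [->|vr] // [uv].
exact: sibling_inj uv.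
Qed.

Definition leaf_forest := @Forest V X leaf_par (depth t) (fun u x => below t u (j x))
  leaf_dep_par leaf_anc_par leaf_anc_inj.

End LeafForest.

Section Zeroing.
Context {R : realType} {U X : finType} (fr : forest U X) (H : nat).
Implicit Types (Z : pred U) (z : U * 'I_H -> R).

Definition zeroing Z z (e : U * 'I_H) : R := if Z e.1 then 0 else z e.

Lemma feasible_zeroing Z z : (forall u v, fpar fr v = Some u -> Z u -> Z v) ->
  feasible fr z -> feasible fr (zeroing Z z).
Proof.
move=> Zdown [z0 zS]; have zz0 e : 0 <= zeroing Z z e by rewrite /zeroing; case: ifP.
split=> // o S /forall_inP sib; have le : \sum_(e in S) zeroing Z z e <= \sum_(e in S) z e.
  by apply: ler_sum => e _; rewrite /zeroing; case: ifP.
have := zS o S (introT forall_inP sib); rewrite /capacity; case: o sib => [p|] sib; last first.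
  exact: le_trans.
have [Zp|Zp] := boolP (Z p).
  move=> _; rewrite big1; last first.
    by move=> e /sib /eqP eo; rewrite /zeroing (Zdown _ _ eo Zp).
  exact: sumr_ge0.
move=> /(le_trans le); rewrite [leRHS](eq_bigr (zeroing Z z)) // => e /andP[/eqP ep _].
by rewrite /zeroing ep (negbTE Zp).
Qed.

Lemma mass_zeroing Z z u : mass (zeroing Z z) u = if Z u then 0 else mass z u.
Proof. by rewrite /mass /zeroing /=; case: ifP => // _; rewrite big1. Qed.

End Zeroing.

(** * Potential of the light edges: evictions and changes of designation *)

Section Bank.
Context {R : realType} {V X : finType} (t : rooted_tree V) (j : X -> V) (H : nat).
Variables (w : V -> R) (tau C eta delta : R).
Notation r := (root t).
Notation par := (parent t).
Notation fr := (leaf_forest t j).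
Notation I := (V * 'I_H)%type.
Notation hat := (hat t H%:R).
Notation K := (tau / (tau - 1)).
Notation tree_mass := (tree_mass t H%:R).
Implicit Types (des : V -> V) (y : V -> R) (z : I -> R) (A : {set X}).

Hypothesis w_ge0 : forall u, 0 <= w u.
Hypothesis tau_gt1 : 1 < tau.
Hypothesis w_geo : forall v, v != r -> par v != r -> w (par v) = tau * w v.
Hypothesis C_ge1 : 1 <= C.
Hypothesis eta_gt0 : 0 < eta.
Hypothesis etaK : eta * K = 16^-1.
Hypothesis delta01 : 0 < delta <= 1.

Lemma chain_mass z : feasible fr z -> tree_mass (mass z).
Proof.
move=> fz; split=> [v|p|]; first exact: mass_ge0 fz.
  by have := mass_children_sum (Some p) fz; under eq_bigl do rewrite [fpar _ _]/(leaf_par t _) leaf_parE.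
have := mass_children_sum None fz; apply: le_trans.
rewrite (bigD1 r) /= /leaf_par ?eqxx // lerDl.
by apply: sumr_ge0 => u _; exact: mass_ge0 fz.
Qed.

(* Each light edge above a node lowers the mean of its labels by [2 / C], except
   that the node below a light edge is lowered by [1 / C] only; [heap] collects
   what the light edge above [v] costs. *)
Definition heap y v := 2 * \sum_(u | below t v u) w u * y u - w v * y v.

(* A light node with small mass keeps a deposit that pays for its eviction. *)
Definition deposit y v : R := (0 < y v)%R%:R * (8^-1 * (w v * Num.max 0 (2^-1 - y v))).

Definition light_potential des y := (\sum_(v | light t des v) (heap y v + deposit y v)) / C.

Definition base_potential A z := potential fr w (fun=> 2^-1) (fun=> 2^-1) delta A z.

Definition total_potential A des z := base_potential A z + light_potential des (mass z).

Let C0 : 0 < C. Proof. exact: lt_le_trans C_ge1. Qed.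
Let K1 : 1 <= K. Proof. by rewrite ler_pdivlMr ?subr_gt0 //; lra. Qed.
Let eta16 : eta <= 16^-1. Proof. by rewrite -etaK ler_pMr. Qed.

(** Exchanging the sums exhibits the heaps as linear terms with a coefficient for each vertex, the
    form in which the labels of the serving step produce them. *)
Lemma heap_sum des y : \sum_(v | light t des v) heap y v =
  \sum_u (2 * (light_depth t des u)%:R - (light t des u)%:R) * (w u * y u).
Proof.
rewrite sumrB -mulr_sumr; under [RHS]eq_bigr do rewrite mulrBl.
rewrite sumrB; congr (_ - _); last first.
  rewrite big_mkcond; apply: eq_bigr => u _.
  by case: ifP => _; rewrite ?mul1r ?mul0r.
rewrite (exchange_big_dep predT) //= mulr_sumr; apply: eq_bigr => u _.
rewrite -mulrA; congr (_ * _); rewrite -[LHS]mul1r big_distrr /=.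
rewrite /light_depth -sum1_card natr_sum mulr_suml; apply: eq_bigl => v.
by rewrite inE andbC.
Qed.

Lemma heap_ge y v : (forall u, 0 <= y u) -> w v * y v <= heap y v.
Proof.
move=> y0; rewrite /heap (bigD1 v) ?below_refl //=.
have : 0 <= \sum_(i | below t v i && (i != v)) w i * y i by apply: sumr_ge0 => u _; rewrite mulr_ge0.
lra.
Qed.

Lemma heap_le y v : tree_mass y -> v != r -> heap y v <= 2 * K * (w v * y v).
Proof.
move=> ym vr; have := subtree_sum w_ge0 tau_gt1 w_geo ym vr; rewrite /heap.
have [y0 _ _] := ym; have : 0 <= w v * y v by rewrite mulr_ge0.
lra.
Qed.

Lemma heap_mono y y' v : (forall u, y' u <= y u) -> heap y' v <= heap y v.
Proof.
move=> le; rewrite /heap (bigD1 v) ?below_refl //= [X in _ <= 2 * X - _](bigD1 v) ?below_refl //=.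
have : \sum_(i | below t v i && (i != v)) w i * y' i <= \sum_(i | below t v i && (i != v)) w i * y i.
  by apply: ler_sum => u _; rewrite ler_wpM2l.
have := ler_wpM2l (w_ge0 v) (le v); lra.
Qed.

Lemma deposit_ge0 y v : 0 <= deposit y v.
Proof. by rewrite /deposit !mulr_ge0 // le_max lexx. Qed.

Lemma light_potential_ge0 des y : (forall u, 0 <= y u) -> 0 <= light_potential des y.
Proof.
move=> y0; rewrite divr_ge0 ?(ltW C0) //; apply: sumr_ge0 => v _; rewrite addr_ge0 ?deposit_ge0 //.
by apply: le_trans (heap_ge v y0); rewrite mulr_ge0.
Qed.

Section Eviction.
Variable gam : R.
Hypothesis gamE : gam = eta / (2 * C).

Let evicted des y v := [&& light t des v, 0 < y v & y v < gam].
Let Z des y u := [exists v, evicted des y v && below t v u].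

Let Zdown des y u v : fpar fr v = Some u -> Z des y u -> Z des y v.
Proof.
move=> /eqP; rewrite [fpar _ _]/(leaf_par t v) leaf_parE => /child_below uv.
by move=> /existsP[x /andP[xe xu]]; apply/existsP; exists x; rewrite xe (below_trans xu uv).
Qed.

Let Zpar des y v : v != r -> ~~ Z des y v -> ~~ Z des y (par v).
Proof.
move=> vr; apply: contra; apply: Zdown.
by apply/eqP; rewrite [fpar _ _]/(leaf_par t v) leaf_parE child_par.
Qed.

Let gam_small : 0 < gam /\ gam <= 4^-1.
Proof.
rewrite gamE; split; first by rewrite divr_gt0 // mulr_gt0.
rewrite ler_pdivrMr ?mulr_gt0 //; have := eta16; have := C_ge1; lra.
Qed.

Let KgamC : K * gam * C = 32^-1.
Proof.
have -> : K * gam * C = eta * K / 2.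
  rewrite gamE; have := subr_gt0 1 tau; rewrite tau_gt1 => t1.
  by field; rewrite !gt_eqF.
by rewrite etaK; field.
Qed.

(** The subtrees of light vertices with positive mass below [gam] are emptied. Each such vertex [v]
    releases a deposit of at least [w v / 32], as [gam <= 4^-1]. By geometric decay the weighted
    mass removed is at most [K * gam] times these weights, and [K * gam * C = 32^-1]; half of what
    is released covers the rise of the base potential, half the movement. *)
Lemma evict des z : designates t des -> (forall c, child t r c -> w (des r) <= w c) ->
  feasible fr z ->
  (forall v, light t des v -> par v != r -> 0 < mass z v ->
     mass z v < (1 - eta) * hat des (mass z) (par v)) ->
  exists z', [/\ feasible fr z',
    forall v, light t des v -> par v != r -> 0 < mass z' v ->
     mass z' v < (1 - eta) * hat des (mass z') (par v),
    forall v, light t des v -> 0 < mass z' v -> gam <= mass z' v,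
    forall x, gam <= mass z (j x) -> mass z' (j x) = mass z (j x) &
    forall A, total_potential A des z' +
      (\sum_(v | v != r) w v * `|hat des (mass z') v - hat des (mass z) v|) / (C * (4 * K)) <=
      total_potential A des z].
Proof.
move=> desP desr fz inv; set y := mass z in inv *; have ym := chain_mass fz.
pose z' := zeroing (Z des y) z; pose y' := mass z'.
have y'E u : y' u = if Z des y u then 0 else y u by exact: mass_zeroing.
have fz' : feasible fr z' by apply: feasible_zeroing fz => u v; exact: Zdown.
have ym' := chain_mass fz'; have [y0 _ _] := ym; have [y'0 _ _] := ym'.
have y'le u : y' u <= y u by rewrite y'E; case: ifP.
(* Outside the emptied subtrees completed masses can only grow, so the decay along light edges
   survives. *)
have hatle p : ~~ Z des y p -> hat des y p <= hat des y' p.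
  elim/(below_ind (t := t)): p => [|p pr IH] Zp; first by rewrite !hat_root.
  have [lp|lp] := boolP (light t des p).
    by rewrite !(hat_light _ _ lp) y'E (negbTE Zp).
  rewrite !(hat_heavy _ _ pr lp) lerB ?IH ?(Zpar pr) //.
  by apply: ler_sum.
exists z'; split=> // [v lv pvr|v lv|x|A].
- rewrite -/(y' v) y'E; case: (boolP (Z des y v)) => [_|Zv]; first by rewrite ltxx.
  move=> yv; apply: lt_le_trans (inv v lv pvr yv) _; rewrite ler_wpM2l //.
    by have := eta16; lra.
  by apply: hatle; apply: Zpar Zv; case/andP: lv.
- rewrite -/(y' v) y'E; case: (boolP (Z des y v)) => [_|Zv]; first by rewrite ltxx.
  move=> yv; rewrite leNgt; apply: contra Zv => yg; apply/existsP; exists v.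
  by rewrite /evicted lv yv yg below_refl.
- rewrite -/(y (j x)) -/(y' (j x)) y'E => gx; case: ifP => // /existsP[v /andP[/and3P[_ _ yv] vx]].
  by have := mass_below ym vx; rewrite -/y; lra.
pose SZ := \sum_(u | Z des y u) w u * y u.
have SZ_le : SZ <= K * gam * \sum_(v | evicted des y v) w v.
  apply: (@le_trans _ _ (\sum_(v | evicted des y v) \sum_(u | below t v u) w u * y u)).
    rewrite (exchange_big_dep predT) //= /SZ big_mkcond; apply: ler_sum => u _.
    case: ifP => [/existsP[v /andP[ve vu]]|_]; last by do 1!apply: sumr_ge0 => v _; rewrite mulr_ge0.
    by rewrite (bigD1 v) /= ?ve // lerDl; apply: sumr_ge0 => v' _; rewrite mulr_ge0.
  rewrite mulr_sumr; apply: ler_sum => v /and3P[/andP[vr _] _ yg].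
  apply: le_trans (subtree_sum w_ge0 tau_gt1 w_geo ym vr) _.
  rewrite -[leRHS]mulrA; apply: ler_wpM2l; first exact: le_trans K1.
  by rewrite mulrC ler_wpM2r // ltW.
have W0 : base_potential A z' <= base_potential A z + SZ / 2.
  rewrite /base_potential /potential !sum_items /SZ [\sum_(u | Z des y u) _]big_mkcond mulr_suml -big_split /=.
  apply: ler_sum => u _; rewrite /z' /zeroing /=; case: ifP => Zu; last by rewrite mul0r addr0.
  apply: (@le_trans _ _ (\sum_(i < H) 0)).
    by apply: ler_sum => i _; rewrite log_gain0 //; lra.
  rewrite /y /mass mulr_sumr mulr_suml -big_split /=; apply: ler_sum => i _.
  have /andP[cw _] := cost_weight01 fr delta01 A (u, i).
  have zi := fz.1 (u, i); have gi := log_gain_ge0 delta01 zi.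
  have := mulr_ge0 (w_ge0 u) (mulr_ge0 cw gi); lra.
have QL : light_potential des y' * C <= light_potential des y * C
    - \sum_(v | evicted des y v) 8^-1 * (w v * 4^-1).
  rewrite /light_potential !divfK ?gt_eqF // lerBrDr big_mkcond [leRHS]big_mkcond [X in _ + X]big_mkcond -big_split /=.
  apply: ler_sum => v _; rewrite /evicted; case: (boolP (light t des v)) => lv; last by rewrite addr0.
  have hm := heap_mono v y'le.
  case: ifP => [/and3P[_ yv yg]|_]; last first.
    rewrite addr0 lerD // /deposit y'E; case: ifP => _; last exact: lexx.
    by rewrite ltxx mul0r; exact: deposit_ge0.
  have -> : deposit y' v = 0.
    rewrite /deposit y'E ifT ?ltxx ?mul0r //; apply/existsP; exists v.
    by rewrite /evicted lv yv yg below_refl.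
  rewrite addr0 lerD // /deposit yv mul1r ler_wpM2l // ler_wpM2l //.
  by have := gam_small.2; rewrite le_max; lra.
have LZ : \sum_(v | light t des v) w v * `|y' v - y v| <= SZ.
  rewrite /SZ big_mkcond [leRHS]big_mkcond /=; apply: ler_sum => v _; rewrite y'E.
  case: (Z des y v); rewrite ?sub0r ?normrN ?subrr ?normr0 ?mulr0; last by case: ifP.
  by rewrite (ger0_norm (y0 v)); case: ifP => // _; rewrite mulr_ge0.
have E := hat_move H%:R w_ge0 tau_gt1 w_geo y y' desP desr.
set ER := \sum_(v | v != r) _ in E *; rewrite /total_potential -/y -/y'.
have CK0 : 0 < C * (4 * K).
  by apply: mulr_gt0 => //; apply: mulr_gt0 => //; exact: lt_le_trans K1.
have SZ0 : 0 <= SZ by apply: sumr_ge0 => u _; rewrite mulr_ge0.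
have E2 : ER / (C * (4 * K)) <= SZ / 2.
  rewrite ler_pdivrMr //; apply: le_trans E _.
  have : 2 * \sum_(v | light t des v) w v * `|y' v - y v| <= 2 * SZ by rewrite ler_pM2l.
  move=> /(ler_wpM2l (ltW (lt_le_trans ltr01 K1))) /le_trans; apply.
  have : 1 * (K * SZ) <= C * (K * SZ) by rewrite ler_wpM2r // mulr_ge0 // (le_trans _ K1).
  lra.
have Q2 : light_potential des y' + SZ <= light_potential des y.
  rewrite -(ler_pM2r C0) mulrDl; have := ler_wpM2r (ltW C0) SZ_le.
  rewrite mulrAC KgamC; move: QL; rewrite -mulr_sumr -mulr_suml; lra.
lra.
Qed.

End Eviction.

Section Switching.
Variables (des : V -> V) (y : V -> R).
Hypothesis desP : designates t des.
Hypothesis ym : tree_mass y.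

Let heavier p (a : R) := odflt (des p) [pick v | [&& child t p v, v != des p & (1 - eta) * a <= y v]].
Let newdes p a := if p == r then des p else heavier p a.

(** The new designation at a vertex depends on its completed mass, which depends on the new
    designations above it; both are computed together from the root down, and [gE] identifies the
    result as [hat des' y]. The root keeps its designated child, which must remain one of least
    weight. *)
Fixpoint switch_rec n v : R :=
  if v == r then H%:R else
  if n is n'.+1 then
    let a := switch_rec n' (par v) in
    if newdes (par v) a != v then y v else a - \sum_(c | child t (par v) c && (c != v)) y c
  else 0.

Let g v := switch_rec (depth t v) v.
Let des' p := newdes p (g p).

Let gE : g =1 hat des' y.
Proof.
apply: hat_unique; first by rewrite /g; case: (depth t r) => [|n] /=; rewrite eqxx.
move=> v vr; rewrite {1}/g (depth_parent vr) /= (negbTE vr) -/(g (par v)).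
by rewrite /light vr.
Qed.

Let hat'0 p : 0 <= hat des' y p. Proof. exact: hat_ge0. Qed.

Let switchedP p : des' p != des p -> [/\ p != r, child t p (des' p) & (1 - eta) * hat des' y p <= y (des' p)].
Proof.
rewrite /des' /newdes; have [->|pr] := eqVneq p r; first by rewrite eqxx.
by rewrite /heavier; case: pickP => [v /and3P[pv vd le]|_] /=; rewrite ?eqxx // -gE.
Qed.

Let des'P : designates t des'.
Proof.
move=> p c pc; have [->|/switchedP[]//] := eqVneq (des' p) (des p); exact: desP pc.
Qed.

Let sum_light d (phi : V -> R) : designates t d ->
  \sum_(v | light t d v) phi v = \sum_(v | v != r) phi v - \sum_(p | [exists c, child t p c]) phi (d p).
Proof.
move=> dP; apply/eqP; rewrite eq_sym subr_eq; apply/eqP.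
rewrite (bigID (light t d)) /=; congr (_ + _).
  by apply: eq_bigl => v; rewrite /light andbA andbb.
rewrite (reindex_onto d par) /=; last first.
  by move=> v /andP[vr lv]; rewrite -heavyP.
apply: eq_bigl => p; rewrite /light; apply/idP/idP.
  by move=> /andP[/andP[dr _] /eqP dp]; apply/existsP; exists (d p); rewrite /child dr dp eqxx.
move=> /existsP[c /dP /andP[dr /eqP dp]]; by rewrite dr dp !eqxx.
Qed.

Let pairsum p c c' : child t p c -> child t p c' -> c != c' -> y c + y c' <= hat des' y p.
Proof.
move=> pc pc' cc'; have [y0 yc _] := ym.
apply: le_trans (hat_ge des' p ym); apply: le_trans (yc p).
rewrite (bigD1 c) //= (bigD1 c') /=; last by rewrite pc' eq_sym.
by rewrite addrA lerDl sumr_ge0.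
Qed.

Let gain p := ((des' p != des p)%:R * (w (des p) * hat des' y p)).

Let phi v := heap y v + deposit y v.

(** After a switch at [p] the old designated child becomes light, but has mass at most
    [eta * hat des' y p], so its heap is at most an eighth of [w (des p) * hat des' y p]. The new
    one ceases to be light and frees a heap of at least [1 - eta] times that quantity. Deposits
    change the balance by at most an eighth of the freed mass. *)
Let gain_le p c0 : child t p c0 -> phi (des p) - phi (des' p) <= - (gain p / 2).
Proof.
move=> pc0; rewrite /gain; have [->|sw] := eqVneq (des' p) (des p).
  by rewrite subrr mul0r mul0r oppr0.
have [pr pd' le] := switchedP sw; have pd := desP pc0.
have [y0 _ _] := ym.
have ww : w (des' p) = w (des p).
  have /andP[dr /eqP dp] := pd; have /andP[d'r /eqP d'p] := pd'.
  have := w_geo dr; have := w_geo d'r; rewrite dp d'p => /(_ pr) -> /(_ pr).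
  by move/(mulfI (lt0r_neq0 (lt_trans ltr01 tau_gt1))) => ->.
have dr : des p != r by case/andP: pd.
have := pairsum pd pd'; rewrite eq_sym => /(_ sw) ps.
have h1 := heap_le ym dr; have h2 := heap_ge (des' p) y0; rewrite ww in h2.
set a := hat des' y p in le ps *; have a0 : 0 <= a by exact: hat'0.
set c := des p in h1 h2 ps ww dr *; set c' := des' p in le h2 ps ww *.
have yc : y c <= eta * a by lra.
have W0 := w_ge0 c; have Wa : 0 <= w c * a by rewrite mulr_ge0.
have h1' : heap y c <= 8^-1 * (w c * a).
  apply: le_trans h1 _; rewrite (_ : 8^-1 * _ = 2 * (eta * K) * (w c * a)); last by rewrite etaK; lra.
  have : K * (w c * y c) <= K * (w c * (eta * a)).
    by rewrite ler_wpM2l ?(le_trans _ K1) // ler_wpM2l.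
  lra.
have h2' : (1 - 16^-1) * (w c * a) <= w c * y c'.
  apply: le_trans (_ : w c * ((1 - eta) * a) <= _); last by rewrite ler_wpM2l.
  by rewrite [leRHS]mulrCA ler_wpM2r //; have := eta16; lra.
have dd : deposit y c - deposit y c' <= 8^-1 * (w c * y c').
  have [yc'|yc'] := leP (y c') 0.
    have yc'0 : y c' = 0 by apply/eqP; rewrite eq_le yc' y0.
    have a00 : a = 0.
      by apply/eqP; rewrite eq_le a0 andbT; have := eta16; nra.
    have yc0 : y c = 0 by apply/eqP; rewrite eq_le y0 andbT; move: yc; rewrite a00 mulr0.
    by rewrite /deposit yc0 yc'0 ltxx !mul0r subrr !mulr0.
  rewrite /deposit yc' mul1r ww.
  have m1 : Num.max 0 (2^-1 - y c) <= 2^-1 by rewrite ge_max invr_ge0 ler0n /= gerBl.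
  have m0 : 0 <= Num.max 0 (2^-1 - y c) by rewrite le_max lexx.
  have m2 : 2^-1 - y c' <= Num.max 0 (2^-1 - y c') by rewrite le_max lexx orbT.
  have : (0 < y c)%R%:R * (8^-1 * (w c * Num.max 0 (2^-1 - y c))) <= 8^-1 * (w c * 2^-1).
    case: (0 < y c); rewrite ?mul1r ?mul0r; last by rewrite !mulr_ge0.
    by rewrite ler_wpM2l // ler_wpM2l.
  have := ler_wpM2l W0 m2; lra.
rewrite /phi mul1r; lra.
Qed.

(** A switch at the parent redirects only the part of its completed mass that the children's own
    masses do not cover, and this part is at most [eta] times the whole. *)
Let move_bound v : v != r -> `|hat des' y v - hat des y v| <=
  (v == des (par v))%:R * `|hat des' y (par v) - hat des y (par v)| +
  (des' (par v) != des (par v))%:R *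
    ((v == des (par v))%:R + (v == des' (par v))%:R) * (eta * hat des' y (par v)).
Proof.
move=> vr; set p := par v; have pv : child t p v by exact: child_par.
have ea : 0 <= eta * hat des' y p by rewrite mulr_ge0 ?(ltW eta_gt0).
have [sE|sw] := eqVneq (des' p) (des p).
  rewrite !mul0r addr0; have [vd|vd] := eqVneq v (des p).
    have lv : ~~ light t des v by rewrite /light vr -/p -vd eqxx.
    have lv' : ~~ light t des' v by rewrite /light vr -/p sE -vd eqxx.
    rewrite mul1r !(hat_heavy _ _ vr) // -/p.
    by rewrite le_eqVlt; apply/orP; left; apply/eqP; congr (`|_|); ring.
  have lv : light t des v by rewrite /light vr -/p eq_sym.
  have lv' : light t des' v by rewrite /light vr -/p sE eq_sym.
  by rewrite !(hat_light _ _ lv) (hat_light _ _ lv') subrr normr0 mul0r.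
have [pr pd' le] := switchedP sw; have [y0 yc _] := ym.
have pd := desP pv.
have left_le : 0 <= hat des' y p - \sum_(c | child t p c) y c <= eta * hat des' y p.
  have h1 : \sum_(c | child t p c) y c <= hat des' y p by apply: le_trans (yc p) (hat_ge des' p ym).
  have h2 : y (des' p) <= \sum_(c | child t p c) y c by rewrite (bigD1 (des' p)) //= lerDl sumr_ge0.
  by apply/andP; split; lra.
have sumE : \sum_(c | child t p c) y c = y v + \sum_(c | child t p c && (c != v)) y c.
  by rewrite (bigD1 v).
have [vd|vd] := eqVneq v (des p).
  have lv : ~~ light t des v by rewrite /light vr -/p -vd eqxx.
  have lv' : light t des' v by rewrite /light vr -/p vd.
  have -> : (v == des' p) = false by rewrite vd eq_sym; apply/negbTE.
  rewrite /= addr0 !mul1r (hat_light _ _ lv') (hat_heavy _ _ vr lv) -/p.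
  have -> : y v - (hat des y p - \sum_(c | child t p c && (c != v)) y c) =
    (hat des' y p - hat des y p) - (hat des' y p - \sum_(c | child t p c) y c).
    by rewrite sumE; ring.
  by apply: le_trans (ler_normB _ _) _; rewrite lerD2l ger0_norm; case/andP: left_le.
have lv : light t des v by rewrite /light vr -/p eq_sym.
rewrite mul0r !add0r mul1r (hat_light _ _ lv); have [vd'|vd'] := eqVneq v (des' p).
  have lv' : ~~ light t des' v by rewrite /light vr -/p -vd' eqxx.
  rewrite mul1r (hat_heavy _ _ vr lv') -/p.
  have -> : hat des' y p - \sum_(c | child t p c && (c != v)) y c - y v =
    hat des' y p - \sum_(c | child t p c) y c by rewrite sumE; ring.
  by rewrite ger0_norm; case/andP: left_le.
have lv' : light t des' v by rewrite /light vr -/p eq_sym.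
by rewrite (hat_light _ _ lv') subrr normr0 mul0r.
Qed.

(** Restores the decay along light edges. The movement is a geometric chain fed at the switched
    vertices; the factor [eta] makes it cheaper than the gain. *)
Lemma switch : exists d, [/\ designates t d, d r = des r,
  forall v, light t d v -> par v != r -> 0 < y v -> y v < (1 - eta) * hat d y (par v) &
  light_potential d y + (\sum_(v | v != r) w v * `|hat d y v - hat des y v|) / (C * (4 * K)) <=
  light_potential des y].
Proof.
exists des'; split=> //; first by rewrite /des' /newdes eqxx.
  move=> v /andP[vr dv] pr yv; set p := par v in dv pr *.
  have pv : child t p v by exact: child_par.
  have [sE|/switchedP[_ pd' le]] := eqVneq (des' p) (des p).
    rewrite ltNge; apply: contra_neqN dv => le.
    move: sE; rewrite /des' /newdes (negbTE pr) /heavier; case: pickP => [u /and3P[_ ud _] /= uE|].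
      by rewrite uE eqxx in ud.
    move=> /(_ v); rewrite pv gE le andbT /= => /negbFE /eqP -> //.
  have := pairsum pd' pv dv; have := hat'0 p; have := eta16; have [y0 _ _] := ym; have := y0 v.
  set a := hat des' y p in le *; nra.
set ER := \sum_(v | v != r) _.
have ERle : ER <= K * (2 * eta * \sum_(p | [exists c, child t p c]) gain p).
  pose be v := (des' (par v) != des (par v))%:R *
    ((v == des (par v))%:R + (v == des' (par v))%:R) * (eta * hat des' y (par v)).
  apply: (@le_trans _ _ (K * \sum_(v | v != r) w v * be v)).
    apply: (geometric_chain w_ge0 tau_gt1 w_geo (s := des)
        (g := fun v => `|hat des' y v - hat des y v|) (be := be)) => [v||v vr] //.
      by rewrite !hat_root subrr normr0.
    exact: move_bound.
  rewrite ler_wpM2l ?(le_trans _ K1) // mulr_sumr.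
  rewrite (partition_big par (fun p => [exists c, child t p c])) /=; last first.
    by move=> v vr; apply/existsP; exists v; exact: child_par.
  apply: ler_sum => p /existsP[c0 pc0]; rewrite /gain.
  have [sE|sw] := eqVneq (des' p) (des p).
    by rewrite mul0r mulr0 big1 // => v /andP[_ /eqP vp]; rewrite /be vp sE eqxx !mul0r mulr0.
  have [pr pd' le] := switchedP sw; have pd := desP pc0.
  have wE v : child t p v -> w v = w p / tau.
    move=> /andP[vr /eqP vp]; rewrite -{1}vp in pr; have := w_geo vr pr; rewrite vp => ->.
    by rewrite mulrAC divff ?mul1r // gt_eqF // (lt_trans ltr01).
  apply: (@le_trans _ _ (\sum_(v | child t p v) (v == des p)%:R * (w p / tau * (eta * hat des' y p)) +
     \sum_(v | child t p v) (v == des' p)%:R * (w p / tau * (eta * hat des' y p)))).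
    rewrite -big_split /=; apply: ler_sum => v pv; have /andP[_ /eqP vp] := pv.
    by rewrite /be vp sw mul1r (wE v) // -mulrDl mulrCA.
  rewrite -!mulr_suml (bigD1 (des p)) //= eqxx big1 ?addr0 => [|v /andP[_ /negbTE ->] //].
  rewrite (bigD1 (des' p)) //= eqxx big1 ?addr0 => [|v /andP[_ /negbTE ->] //].
  by rewrite mul1r mul1r -(wE (des p)) //; rewrite le_eqVlt; apply/orP; left; apply/eqP; ring.
have gain0 p : 0 <= gain p by rewrite /gain !mulr_ge0.
set G := \sum_(p | _) gain p in ERle; have G0 : 0 <= G by apply: sumr_ge0.
have CK0 : 0 < C * (4 * K).
  by apply: mulr_gt0 => //; apply: mulr_gt0 => //; exact: lt_le_trans K1.
rewrite /light_potential -(ler_pM2r C0) mulrDl !divfK ?gt_eqF // !sum_light //.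
have gl : \sum_(p | [exists c, child t p c]) phi (des p) -
    \sum_(p | [exists c, child t p c]) phi (des' p) <= - (G / 2).
  rewrite -sumrB /G mulr_suml -sumrN; apply: ler_sum => p /existsP[c]; exact: gain_le.
have EG : ER / (C * (4 * K)) * C <= G / 2.
  have D0 : 0 < 4 * K by apply: mulr_gt0 => //; exact: lt_le_trans K1.
  have -> : ER / (C * (4 * K)) * C = ER / (4 * K).
    by move: D0; move: (4 * K) => D D0; field; rewrite !gt_eqF.
  rewrite ler_pdivrMr //; apply: le_trans ERle _.
  have -> : K * (2 * eta * G) = 2 * (eta * K) * G by move: (K) => K'; ring.
  by rewrite etaK; have := ler_wpM2r G0 K1; move: (K) => K'; lra.
rewrite -/phi in gl *; move: gl EG; rewrite /phi; lra.
Qed.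

End Switching.

End Bank.

(** * One request on an HST *)

Section HstStep.
Context {R : realType} {V X : finType} (t : rooted_tree V) (j : X -> V) (H : nat).
Variables (w : V -> R) (tau C eta d0 : R).
Notation r := (root t).
Notation par := (parent t).
Notation fr := (leaf_forest t j).
Notation I := (V * 'I_H)%type.
Notation hat := (hat t H%:R).
Notation K := (tau / (tau - 1)).
Notation tree_mass := (tree_mass t H%:R).
Let delta := d0 / 4.
Let gam := eta / (2 * C).
Notation ltp := (light_potential t w C).
Notation total := (total_potential t j w C delta).
Implicit Types (des : V -> V) (y : V -> R) (z : I -> R) (A : {set X}).

Hypothesis w_ge0 : forall u, 0 <= w u.
Hypothesis tau_gt1 : 1 < tau.
Hypothesis w_geo : forall v, v != r -> par v != r -> w (par v) = tau * w v.
Hypothesis C_ge8 : 8 <= C.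
Hypothesis eta_gt0 : 0 < eta.
Hypothesis etaK : eta * K = 16^-1.
Hypothesis d0_01 : 0 < d0 <= 2^-1.
Hypothesis H_gt0 : (0 < H)%N.
Hypothesis leafX : forall x c, ~~ child t (j x) c.

Let C1 : 1 <= C. Proof. by have := C_ge8; lra. Qed.
Let C0 : 0 < C. Proof. by have := C_ge8; lra. Qed.
Let delta01 : 0 < delta <= 1. Proof. by have /andP[] := d0_01; rewrite /delta; lra. Qed.
Let K1 : 1 <= K. Proof. by rewrite ler_pdivlMr ?subr_gt0 //; lra. Qed.
Let eta16 : eta <= 16^-1. Proof. by rewrite -etaK ler_pMr. Qed.
Let HR : 0 < H%:R :> R. Proof. by rewrite ltr0n. Qed.

(** Completed mass starts at [H], shrinks by [1 - eta] at each light edge and is at least [gm] after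
    it. The predecessor allows for a light edge at the root, where no decay is known. *)
Lemma light_depth_bound des y gm u : tree_mass y ->
  (forall v, light t des v -> par v != r -> 0 < y v -> y v < (1 - eta) * hat des y (par v)) ->
  (forall v, light t des v -> 0 < y v -> gm <= y v) ->
  0 < hat des y u -> light_depth t des u = 0%N \/ gm <= H%:R * (1 - eta) ^+ (light_depth t des u).-1.
Proof.
move=> ym inv1 inv2 hu.
have e0 : 0 <= 1 - eta by have := eta16; lra.
have e1 : 1 - eta <= 1 by have := eta_gt0; lra.
suff : exists a, [/\ hat des y u <= a, light_depth t des u = 0%N \/ gm <= a &
    a <= H%:R * (1 - eta) ^+ (light_depth t des u).-1].
  by move=> [a [_ [->|ga] aH]]; [left|right; exact: le_trans ga aH].
elim/(below_ind (t := t)): u hu => [|v vr IH] hv.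
  by exists H%:R; rewrite hat_root light_depth_root; split; [|left|rewrite mulr1].
have hp : 0 < hat des y (par v) by apply: lt_le_trans hv (hat_par_le _ ym vr).
have [a [ha ga aH]] := IH hp; rewrite light_depthE //.
have [lv|lv] := boolP (light t des v); last first.
  by exists a; rewrite addn0; split=> //; apply: le_trans ha; exact: hat_par_le.
rewrite addn1; rewrite (hat_light _ _ lv) in hv *; exists (y v); split=> //; first by right; exact: inv2.
have [pr|pr] := eqVneq (par v) r.
  rewrite pr light_depth_root /= expr0 mulr1.
  by have := hat_par_le des ym vr; rewrite pr hat_root (hat_light _ _ lv).
apply: le_trans (ltW (inv1 v lv pr hv)) _; apply: le_trans (ler_wpM2l e0 (le_trans ha aH)) _.
rewrite mulrCA ler_wpM2l // -exprS /=; case: (light_depth _ _ _) => [|n] //=.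
Qed.

(** Where the completed mass is 0 the designation can be changed freely. Pointing it towards the
    requested leaf makes the empty part of the path to [l] heavy, which bounds the light depth along
    the whole path and leaves [hat] and the potential as they were. *)
Lemma redirect des y l : designates t des -> tree_mass y -> (forall c, ~~ child t l c) ->
  (forall u, 0 < hat des y u -> (light_depth t des u)%:R + 1 <= C / 8) ->
  exists d, [/\ designates t d, d r = des r, hat d y =1 hat des y, ltp d y = ltp des y &
    [/\ forall u, 0 < hat des y u -> (light_depth t d u)%:R <= C / 8 &
        forall u, below t u l -> (light_depth t d u)%:R <= C / 8]].
Proof.
move=> desP ym leafl dep; have [y0 yc _] := ym.
pose d p := if (p != r) && (hat des y p == 0)
  then odflt (des p) [pick c | child t p c && below t c l] else des p.
have dP : designates t d.
  move=> p c pc; rewrite /d; case: ifP => _; last exact: desP pc.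
  by case: pickP => [u /andP[]//|_] /=; exact: desP pc.
have dE p : 0 < hat des y p -> d p = des p.
  by rewrite /d => /gt_eqF ->; rewrite andbF.
have dr : d r = des r by rewrite /d eqxx.
have lE v : v != r -> 0 < hat des y (par v) -> light t d v = light t des v.
  by move=> vr hp; rewrite /light vr dE.
have zero p : ~ 0 < hat des y p -> hat des y p = 0.
  by move=> /negP; rewrite -leNgt => le; apply/eqP; rewrite eq_le le hat_ge0.
have hE : hat des y =1 hat d y.
  apply: hat_unique; first by rewrite hat_root.
  move=> v vr; have [hp|/negP/zero hp] := boolP (0 < hat des y (par v)).
    by rewrite lE // hatE (negbTE vr).
  have hv : hat des y v = 0.
    by apply/eqP; rewrite eq_le hat_ge0 // andbT -hp hat_par_le.
  have yv : y v = 0.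
    by apply/eqP; rewrite eq_le y0 andbT -hv hat_ge.
  rewrite hv yv hp; case: ifP => // _; rewrite big1 ?subr0 // => c /andP[/andP[cr /eqP cp] _].
  apply/eqP; rewrite eq_le y0 andbT -hp -cp; apply: le_trans (hat_par_le des ym cr).
  exact: hat_ge.
have hE' : hat d y =1 hat des y by move=> v; rewrite hE.
exists d; split=> //.
  rewrite /light_potential; congr (_ / _); rewrite big_mkcond [RHS]big_mkcond.
  apply: eq_bigr => v _; have [yv|yv] := eqVneq (y v) 0; last first.
    have [->|vr] := eqVneq v r; first by rewrite /light eqxx.
    rewrite lE //; apply: lt_le_trans (hat_par_le des ym vr); apply: lt_le_trans (hat_ge des v ym).
    by rewrite lt_def yv y0.
  have -> : heap t w y v + deposit w y v = 0; last by case: ifP; case: ifP.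
  rewrite /deposit yv ltxx mul0r addr0 /heap yv mulr0 subr0 big1 ?mulr0 // => u vu.
  have -> : y u = 0 by apply/eqP; rewrite eq_le y0 andbT -yv (mass_below ym).
  by rewrite mulr0.
have ldE u : 0 < hat des y u -> light_depth t d u = light_depth t des u.
  elim/(below_ind (t := t)): u => [|v vr IH] hv; first by rewrite !light_depth_root.
  have hp : 0 < hat des y (par v) by apply: lt_le_trans hv (hat_par_le _ ym vr).
  by rewrite !(light_depthE _ vr) IH // lE.
split=> u; first by move=> hu; rewrite ldE //; have := dep u hu; lra.
elim/(below_ind (t := t)): u => [|v vr IH] vl.
  by rewrite light_depth_root; have := C_ge8; lra.
have pl : below t (par v) l by apply: below_trans vl; exact: below_par.
have [hp|/negP/zero hp] := boolP (0 < hat des y (par v)).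
  rewrite light_depthE // natrD ldE //; apply: le_trans (dep _ hp); rewrite lerD2l.
  by rewrite lern1 leq_b1.
have pr : par v != r by apply: contra_eqN hp => /eqP ->; rewrite hat_root gt_eqF.
rewrite light_depthE // (_ : light t d v = false) ?addn0; first exact: IH.
rewrite /light vr /= /d pr hp eqxx /=; apply/negbTE; rewrite negbK.
case: pickP => [c /andP[/andP[cr /eqP cp] cl]|/(_ v)]; last by rewrite child_par // vl.
by apply/eqP; apply: sibling_inj cl vl.
Qed.

Section ServeStep.
Variables (des : V -> V) (act : pred V).

(** Active vertices have labels that drop by [2 / C] per light edge. At the others, whose light
    depth is not controlled, the labels are 0, and mass placed there is removed after serving at no
    cost. *)
Let lo u : R := if act u then 2^-1 - 2 * (light_depth t des u)%:R / C else 0.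
Let up u : R := if act u then lo u + 2 * (light t des u)%:R / C else 0.

Hypothesis act_par : forall v, v != r -> act v -> act (par v).
Hypothesis act_depth : forall u, act u -> (light_depth t des u)%:R <= C / 8.

Let lo4 u : act u -> 4^-1 <= lo u.
Proof.
move=> au; rewrite /lo au; have := act_depth au => le.
have : 2 * (light_depth t des u)%:R / C <= 4^-1 by rewrite ler_pdivrMr //; lra.
lra.
Qed.

Let lo0 u : 0 <= lo u.
Proof.
by have [/lo4|au] := boolP (act u); [apply: le_trans; rewrite invr_ge0|rewrite /lo (negbTE au)].
Qed.

Let lo_up u : lo u <= up u.
Proof.
rewrite /up; have [au|au] := boolP (act u); last by rewrite /lo (negbTE au).
by rewrite lerDl divr_ge0 ?mulr_ge0 // ltW.
Qed.

Let up_half u : up u <= 2^-1.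
Proof.
rewrite /up; have [au|au] := boolP (act u); last by rewrite invr_ge0.
rewrite /lo au -addrA gerDl addrC subr_le0 ler_pM2r ?invr_gt0 // ler_pM2l // ler_nat.
have [->|ur] := eqVneq u r; first by rewrite /light eqxx.
by rewrite light_depthE // leq_addl.
Qed.

Let up_lo u v : fpar fr v = Some u -> up v <= lo u.
Proof.
move=> /eqP; rewrite [fpar _ _]/(leaf_par t v) leaf_parE => /andP[vr /eqP <-].
rewrite /up; have [av|av] := boolP (act v); last exact: lo0.
rewrite /lo av act_par // light_depthE // natrD mulrDr mulrDl; lra.
Qed.

Let labelled A z := potential fr w lo up delta A z.

(** The mean label of an active vertex is [2^-1] minus its heap coefficient divided by [C], so the
    labels of the serving step differ from constant ones exactly by the heaps. *)
Let labelledE A z : (forall u, ~~ act u -> mass z u = 0) ->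
  labelled A z = base_potential t j w delta A z + (\sum_(v | light t des v) heap t w (mass z) v) / C.
Proof.
move=> z0; rewrite heap_sum /labelled /base_potential /potential !sum_items mulr_suml -big_split /=.
apply: eq_bigr => u _; have [au|au] := boolP (act u); last first.
  rewrite (z0 u au) !mulr0 mul0r addr0 -[LHS]subr0 -[RHS]subr0; apply/eqP; rewrite -subr_eq0.
  have -> (a b : R) : a - 0 - (b - 0) = a - b by ring.
  rewrite -sumrB (eq_bigr (fun i => w u * ((2^-1 + 2^-1) / 2 - (lo u + up u) / 2) * z (u, i))).
    by rewrite -mulr_sumr -/(mass z u) z0 ?mulr0.
  by move=> i _; ring.
rewrite /mass mulr_sumr mulr_sumr mulr_suml -big_split /=; apply: eq_bigr => i _.
have -> : (lo u + up u) / 2 = 2^-1 - (2 * (light_depth t des u)%:R - (light t des u)%:R) / C.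
  by rewrite /up /lo au; field; rewrite gt_eqF.
by field; rewrite gt_eqF.
Qed.

(** Serving is charged at least [S1 / C], with [S1] the movement counted on light edges. By
    [hat_move] half of this pays for the movement of all completed masses, while the deposits grow
    by at most an eighth of [S1]. *)
Lemma serve_step z x : designates t des -> (forall c, child t r c -> w (des r) <= w c) ->
  feasible fr z -> act (j x) -> (forall u, ~~ act u -> mass z u = 0) ->
  (forall u, light t des u -> act u -> mass z u = 0 -> below t u (j x)) ->
  exists z', [/\ feasible fr z', 1 - d0 <= mass z' (j x) &
    forall A, x \in A -> (#|A| <= H)%N ->
    total A des z' + (\sum_(v | v != r) w v * `|hat des (mass z') v - hat des (mass z) v|) / (C * (4 * K)) <=
    total A des z].
Proof.
move=> desP desr fz actx z0 new.
have served_x A : x \in A -> served fr A (j x, Ordinal H_gt0) = 1 :> R.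
  by move=> xA; apply: (served_first _ _ xA); exact: below_refl.
have [z1 [fz1 z1x z1A]] := serve delta01 lo0 lo_up up_half up_lo w_ge0 fz
  served_x H_gt0 (lo4 actx) (lexx _).
pose z' := zeroing (fun u => ~~ act u) z1.
have z'E u : mass z' u = if act u then mass z1 u else 0 by rewrite mass_zeroing if_neg.
have fz' : feasible fr z'.
  apply: feasible_zeroing fz1 => u v /eqP; rewrite [fpar _ _]/(leaf_par t v) leaf_parE.
  by move=> /andP[vr /eqP <-]; apply: contra; exact: act_par.
have z'x : 1 - d0 <= mass z' (j x).
  rewrite z'E actx; apply: le_trans z1x _.
  by rewrite /mass (bigD1 (Ordinal H_gt0)) //= lerDl sumr_ge0 // => i _; exact: fz1.1.
exists z'; split=> // A xA AH.
set y := mass z in z0 new *; set y' := mass z' in z'E z'x *.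
have ym := chain_mass fz; have ym' := chain_mass fz'.
have [y0 _ _] := ym; have [y'0 _ _] := ym'.
pose S1 := \sum_(v | light t des v) w v * `|y' v - y v|.
have S10 : 0 <= S1 by apply: sumr_ge0 => v _; rewrite mulr_ge0.
have chg : S1 / C <= charge w lo up z z1.
  rewrite /S1 /charge mulr_suml big_mkcond; apply: ler_sum => v _.
  have ge0 : 0 <= w v * ((up v - lo v) / 2) * `|mass z1 v - y v|.
    by apply: mulr_ge0 => //; apply: mulr_ge0 => //; apply: divr_ge0 => //; rewrite subr_ge0.
  case: ifP => // lv; rewrite z'E; case: ifP => av; last by rewrite (z0 v) ?av // subrr normr0 mulr0 mul0r.
  rewrite (_ : (up v - lo v) / 2 = C^-1); first by rewrite mulrAC.
  by rewrite /up av lv /=; move: (lo v) => l; field; rewrite gt_eqF.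
have lab : labelled A z' <= labelled A z1.
  rewrite /labelled /potential; apply: ler_sum => -[u i] _ /=; rewrite ler_wpM2l //.
  rewrite /z' /zeroing /=; case: (boolP (act u)) => //= au.
  rewrite log_gain0 // !mulr0 subr0 /up /lo (negbTE au) addr0 mul0r mul0r subr0.
  rewrite mulr_ge0 ?log_gain_ge0 //; last exact: fz1.1.
  by have /andP[] := cost_weight01 fr delta01 A (u, i).
have y'off u : ~~ act u -> y' u = 0 by move=> au; rewrite z'E (negbTE au).
have dep : \sum_(v | light t des v) deposit w y' v <= \sum_(v | light t des v) deposit w y v + 8^-1 * S1.
  rewrite /S1 mulr_sumr -big_split; apply: ler_sum => v lv /=.
  have dw : 0 <= 8^-1 * (w v * `|y' v - y v|) by rewrite !mulr_ge0.
  case: (boolP (act v)) => av; last first.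
    have -> : deposit w y' v = 0 by rewrite /deposit y'off // ltxx mul0r.
    by apply: addr_ge0 => //; exact: deposit_ge0.
  have [yv|yv] := eqVneq (y v) 0.
    (* A light active vertex without mass lies above the request, so it receives at least
       [1 - d0 >= 2^-1] and owes no deposit. *)
    have vx := new v lv av yv.
    have : mass z' (j x) <= mass z' v by exact: mass_below ym' vx.
    have /andP[_ d2] := d0_01 => le.
    rewrite {1}/deposit max_l ?mulr0 ?addr_ge0 ?(deposit_ge0 w_ge0) //.
    by rewrite subr_le0; move: z'x le; rewrite -/y'; lra.
  have yv0 : 0 < y v by rewrite lt_def yv y0.
  rewrite /deposit yv0 mul1r -mulrDr.
  apply: (@le_trans _ _ (8^-1 * (w v * Num.max 0 (2^-1 - y' v)))).
    by case: (0 < y' v); rewrite ?mul1r ?mul0r // !mulr_ge0 // le_max lexx.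
  rewrite ler_wpM2l // -mulrDr ler_wpM2l // ge_max.
  have m1 : 2^-1 - y v <= Num.max 0 (2^-1 - y v) by rewrite le_max lexx orbT.
  have m0 : 0 <= Num.max 0 (2^-1 - y v) by rewrite le_max lexx.
  rewrite addr_ge0 //=; have := ler_norm (y v - y' v); rewrite distrC; lra.
have E := hat_move H%:R w_ge0 tau_gt1 w_geo y y' desP desr.
set ER := \sum_(v | v != r) _ in E *.
have CK0 : 0 < C * (4 * K).
  by apply: mulr_gt0 => //; apply: mulr_gt0 => //; exact: lt_le_trans K1.
have E2 : ER / (C * (4 * K)) <= S1 / C / 2.
  rewrite ler_pdivrMr //; apply: le_trans E _; rewrite -/S1.
  have -> : S1 / C / 2 * (C * (4 * K)) = K * (2 * S1); last exact: lexx.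
  by move: (K) => K'; field; rewrite gt_eqF.
have ltpE f : ltp des f = (\sum_(v | light t des v) heap t w f v) / C +
    (\sum_(v | light t des v) deposit w f v) / C.
  by rewrite /light_potential big_split mulrDl.
have C'0 : 0 <= C^-1 by rewrite invr_ge0 ltW.
have dep' := ler_wpM2r C'0 dep; rewrite mulrDl -[8^-1 * S1 / C]mulrA in dep'.
have p1 := z1A A xA AH; have l1 := labelledE A z0; have l2 := labelledE A y'off.
rewrite /total_potential !ltpE -/y -/y'; rewrite -/y' in l2; rewrite -/y in l1.
have S1C : 0 <= S1 / C by exact: mulr_ge0.
move: (ER / _) (S1 / C) E2 chg dep' p1 lab l1 l2 S1C => er s1.
rewrite /labelled; lra.
Qed.

End ServeStep.

Definition hst_invariant z des := [/\ feasible fr z, designates t des,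
  forall c, child t r c -> w (des r) <= w c,
  forall v, light t des v -> par v != r -> 0 < mass z v ->
     mass z v < (1 - eta) * hat des (mass z) (par v) &
  forall v, light t des v -> 0 < mass z v -> gam <= mass z v].

(* Either the tree is shallow, or the light depth is logarithmic because masses
   decrease geometrically along light edges, down to [gam]. *)
Hypothesis depth_ok : (forall v, (depth t v).+1%:R <= C / 8) \/
  (forall n, gam <= H%:R * (1 - eta) ^+ n -> n.+2%:R <= C / 8).

(** Redirect, serve, switch, evict. Serving needs a bounded light depth and may destroy the decay
    and the lower bound [gam]; the last two steps restore them in this order, since evictions
    preserve the decay. *)
Lemma hst_step z des x : hst_invariant z des -> exists z' des',
  [/\ hst_invariant z' des', 1 - d0 <= mass z' (j x) &
    forall A, x \in A -> (#|A| <= H)%N ->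
    total A des' z' + (\sum_(v | v != r) w v * `|hat des' (mass z') v - hat des (mass z) v|) / (C * (4 * K)) <=
    total A des z].
Proof.
move=> [fz desP desr inv1 inv2]; have ym := chain_mass fz; have [y0 _ _] := ym.
have dep u : 0 < hat des (mass z) u -> (light_depth t des u)%:R + 1 <= C / 8.
  move=> hu; case: depth_ok => ok.
    by apply: le_trans (ok u); rewrite natr1 ler_nat ltnS light_depth_le.
  have [->|le] := light_depth_bound ym inv1 inv2 hu; first by have := C_ge8; lra.
  apply: le_trans (ok _ le); rewrite natr1 ler_nat ltnS; exact: leqSpred.
have [d [dP dr hE pE [ld1 ld2]]] := redirect desP ym (leafX x) dep.
pose act u := (0 < hat d (mass z) u) || below t u (j x).
have [||||||z1 [fz1 z1x pot1]] := @serve_step d act _ _ z x dP _ fz.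
- move=> v vr /orP[hv|vx]; apply/orP; [left|right].
    by apply: lt_le_trans hv (hat_par_le _ ym vr).
  by apply: below_trans vx; exact: below_par.
- by move=> u /orP[|]; [rewrite hE; exact: ld1|exact: ld2].
- by rewrite dr.
- by rewrite /act below_refl orbT.
- move=> u; rewrite negb_or -leNgt => /andP[hu _]; apply/eqP; rewrite eq_le y0 andbT.
  exact: le_trans (hat_ge d u ym) hu.
- by move=> u lu /orP[|//]; rewrite hat_light // => /gt_eqF/eqP.
have ym1 := chain_mass fz1.
have [d' [d'P d'r inv' pot']] := switch w_ge0 tau_gt1 w_geo C1 eta_gt0 etaK dP ym1.
have d'min c : child t r c -> w (d' r) <= w c by rewrite d'r dr; exact: desr.
have [z2 [fz2 inv1' inv2' z2x pot2]] :=
  evict w_ge0 tau_gt1 w_geo C1 eta_gt0 etaK delta01 (erefl gam) d'P d'min fz1 inv'.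
exists z2, d'; split=> //.
  (* The requested leaf is not evicted, as its mass is at least [1 - d0 >= 2^-1 >= gam]. *)
  rewrite z2x // (le_trans _ z1x) // /gam ler_pdivrMr ?mulr_gt0 //.
  have /andP[_ d2] := d0_01; have := eta16; have := C_ge8; nra.
move=> A xA AH; have p1 := pot1 A xA AH; have p2 := pot2 A.
set E1 := \sum_(v | v != r) _ in p1; set E2 := \sum_(v | v != r) _ in pot'.
set E3 := \sum_(v | v != r) _ in p2; set E := \sum_(v | v != r) _.
have tri : E <= E1 + E2 + E3.
  rewrite /E /E1 /E2 /E3 -!big_split; apply: ler_sum => v _ /=; rewrite -!mulrDr ler_wpM2l // -hE.
  have -> : hat d' (mass z2) v - hat d (mass z) v = (hat d (mass z1) v - hat d (mass z) v) +
    (hat d' (mass z1) v - hat d (mass z1) v) + (hat d' (mass z2) v - hat d' (mass z1) v) by ring.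
  by apply: le_trans (ler_normD _ _) _; rewrite lerD2r; exact: ler_normD.
have CK0 : 0 <= (C * (4 * K))^-1.
  by rewrite invr_ge0; apply: mulr_ge0; [exact: ltW|apply: mulr_ge0 => //; exact: le_trans K1].
rewrite /total_potential pE in p1; rewrite /total_potential in p2 *.
move: CK0 p1 p2 pot' tri; clearbody E1 E2 E3 E; move: ((C * (4 * K))^-1) => q q0 p1 p2 pot' tri.
by have := ler_wpM2r q0 tri; rewrite !mulrDl; lra.
Qed.

End HstStep.

(** * The fractional algorithm on HSTs *)

Section HstAlgorithm.
Context {R : realType} {V X : finType} (t : rooted_tree V) (j : X -> V).
Variables (h H k : nat) (w : V -> R) (tau C eta d0 : R).
Notation r := (root t).
Notation par := (parent t).
Notation fr := (leaf_forest t j).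
Notation I := (V * 'I_H)%type.
Notation hat := (hat t H%:R).
Notation K := (tau / (tau - 1)).
Notation dist := (tree_dist t j w).
Let delta := d0 / 4.
Notation total := (total_potential t j w C delta).

Hypothesis w_ge0 : forall u, 0 <= w u.
Hypothesis tau_gt1 : 1 < tau.
Hypothesis w_geo : forall v, v != r -> par v != r -> w (par v) = tau * w v.
Hypothesis C_ge8 : 8 <= C.
Hypothesis eta_gt0 : 0 < eta.
Hypothesis etaK : eta * K = 16^-1.
Hypothesis d0_01 : 0 < d0 <= 2^-1.
Hypothesis leafX : forall x c, ~~ child t (j x) c.
Hypothesis Xleaf : forall v, (forall c, ~~ child t v c) -> exists x, j x = v.
Hypothesis j_inj : injective j.
Hypothesis depth_ok : (forall v, (depth t v).+1%:R <= C / 8) \/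
  (forall n, eta / (2 * C) <= H%:R * (1 - eta) ^+ n -> n.+2%:R <= C / 8).
Hypothesis h_gt0 : (0 < h)%N.
Hypothesis hH : (h <= H)%N.
Hypothesis Hk : (H < k)%N.
Hypothesis kX : (k <= #|X|)%N.
Hypothesis scale_serve : k%:R / H%:R * (1 - d0) = 1 :> R.

Let H_gt0 : (0 < H)%N. Proof. exact: leq_trans hH. Qed.
Let HR : 0 < H%:R :> R. Proof. by rewrite ltr0n. Qed.
Let kH0 : 0 <= k%:R / H%:R :> R. Proof. by rewrite divr_ge0. Qed.
Let C0 : 0 < C. Proof. by have := C_ge8; lra. Qed.
Let delta01 : 0 < delta <= 1. Proof. by have /andP[] := d0_01; rewrite /delta; lra. Qed.
Let K1 : 1 <= K. Proof. by rewrite ler_pdivlMr ?subr_gt0 //; lra. Qed.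
Let CK0 : 0 < C * (4 * K).
Proof. by apply: mulr_gt0 => //; apply: mulr_gt0 => //; exact: lt_le_trans K1. Qed.

Let spread (st : (I -> R) * (V -> V)) x : R := k%:R / H%:R * hat st.2 (mass st.1) (j x).

Lemma inside_leaves (f : V -> R) u :
  (forall p c, child t p c -> \sum_(c | child t p c) f c = f p) ->
  inside t j (fun x => f (j x)) u = f u.
Proof.
move=> fc; rewrite -[RHS](inside_telescope t).
transitivity (\sum_x \sum_(v | v == j x) (if below t u v then f v else 0)).
  by rewrite /inside big_mkcond; apply: eq_bigr => x _; rewrite big_pred1_eq.
rewrite (exchange_big_dep predT) //= [RHS]big_mkcond; apply: eq_bigr => v _.
have [/existsP[c vc]|/existsPn nc] := boolP [exists c, child t v c].
  rewrite big_pred0; last first.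
    by move=> x; apply/eqP => vx; have := leafX x c; rewrite -vx vc.
  by case: ifP => // _; rewrite (fc v c) // subrr.
have [x xv] := Xleaf nc; rewrite (big_pred1 x); last first.
  by move=> x'; rewrite /= -xv eq_sym inj_eq.
by case: ifP => // _; rewrite big_pred0 ?subr0 // => c; apply/negbTE/nc.
Qed.

Let inside_spread st u : designates t st.2 -> inside t j (spread st) u = k%:R / H%:R * hat st.2 (mass st.1) u.
Proof.
move=> desP; rewrite -(inside_leaves (f := hat st.2 (mass st.1))) /inside ?mulr_sumr //.
by move=> p c; exact: hat_children.
Qed.

Let sum_spread st : designates t st.2 -> \sum_x spread st x = k%:R.
Proof. by move=> desP; rewrite -(inside_root t j) inside_spread // hat_root divfK // gt_eqF. Qed.

Let initial_designation : exists des, designates t des /\ forall c, child t r c -> w (des r) <= w c.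
Proof.
have [/existsP[c0 rc0]|/existsPn nc] := boolP [exists c, child t r c]; last first.
  exists (fun p => odflt p [pick c | child t p c]); split=> [p c pc|c].
    by case: pickP => [//|/(_ c)]; rewrite pc.
  by rewrite (negbTE (nc c)).
have [cm rcm cmin] := arg_minP w rc0.
exists (fun p => if p == r then cm else odflt p [pick c | child t p c]); split=> [p c pc|c].
  case: eqVneq => [->//|_]; by case: pickP => [//|/(_ c)]; rewrite pc.
by rewrite eqxx => /cmin.
Qed.

(** The last clause holds for any cost [cst] that grows by at most [beta * B] per request. It is
    used for the fractional cost with [beta = 1] and for the expected cost of the rounding. *)
Lemma hst_algorithm : exists (F : seq X -> X -> R) (B : seq X -> X -> R), [/\
  forall s x, 0 <= F s x <= 1, forall s, \sum_x F s x = k%:R, forall s x, F (rcons s x) x = 1,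
  forall s x, exists2 g, transport_plan (F s) (F (rcons s x)) g & plan_cost dist g <= B s x &
  forall (beta alpha : R) (cst : seq X -> R), 0 < beta ->
    alpha = beta * (k%:R / H%:R * (C * (4 * K)) * ln ((1 + delta) / delta)) -> 0 < alpha ->
    cst [::] <= 0 -> (forall s x, cst (rcons s x) <= cst s + beta * B s x) ->
    exists c, forall s, cst s <= alpha * offline_opt dist h s + c].
Proof.
pose Inv (s : seq X) (st : (I -> R) * (V -> V)) :=
  hst_invariant t j w C eta st.1 st.2 /\ (s = [::] -> st.1 = fun=> 0).
pose mv (st st' : (I -> R) * (V -> V)) :=
  \sum_(v | v != r) w v * `|hat st'.2 (mass st'.1) v - hat st.2 (mass st.1) v|.
pose Step (s : seq X) x (st st' : (I -> R) * (V -> V)) := 1 - d0 <= mass st'.1 (j x) /\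
  forall A : {set X}, x \in A -> (#|A| <= H)%N ->
    total A st'.2 st'.1 + mv st st' / (C * (4 * K)) <= total A st.2 st.1.
have [||run [runI runS]] := online_run (Inv := Inv) (Step := Step).
- have [des [desP desr]] := initial_designation; exists (fun=> 0, des); split=> //; split=> //=.
  + exact: feasible0.
  + by move=> v _ _; rewrite /mass big1 // ltxx.
  + by move=> v _; rewrite /mass big1 // ltxx.
- move=> s x [z des] [inv _].
  have [z' [des' [inv' z'x pot]]] := hst_step w_ge0 tau_gt1 w_geo C_ge8 eta_gt0 etaK d0_01 H_gt0
    leafX depth_ok x inv.
  by exists (z', des'); split; split=> //; case: (s).
have desP s : designates t (run s).2 by have [[]] := runI s.
have fz s : feasible fr (run s).1 by have [[]] := runI s.
pose G s := spread (run s).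
pose B s x := k%:R / H%:R * mv (run s) (run (rcons s x)).
have G0 s x : 0 <= G s x by apply: mulr_ge0 => //; apply: hat_ge0; exact: chain_mass (fz s).
have BE s x : \sum_u w u * `|inside t j (G s) u - inside t j (G (rcons s x)) u| <= B s x.
  rewrite /B /mv mulr_sumr [leRHS]big_mkcond; apply: ler_sum => u _.
  rewrite !inside_spread // -mulrBr normrM ger0_norm // mulrCA distrC.
  by case: eqVneq => [->|_] //=; rewrite !hat_root subrr normr0 !mulr0.
have [|||||||F [Pt [Cs [F01 Fk Fx Pt0 CP]]]] := @capping _ _ dist _ _ _ k G B kX.
- exact: tree_dist_ge0.
- exact: tree_distxx.
- by move=> x y z; exact: tree_dist_triangle.
- exact: G0.
- by move=> s; exact: sum_spread.
- move=> s x; rewrite -scale_serve /G /spread ler_wpM2l //; apply: le_trans (runS s x).1 _.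
  by apply: hat_ge; exact: chain_mass (fz _).
- move=> s x; have [|||g [pg cg _]] := @tree_plan _ _ _ t j w w_ge0 (G s) (G (rcons s x)).
  + exact: G0.
  + exact: G0.
  + by rewrite !sum_spread.
  by exists g => //; apply: le_trans cg (BE s x).
exists F, Cs; split=> //; first by move=> s x; have [] := CP s x.
move=> beta alpha cst b0 aE a0 cst0 cstS.
pose kap : R := k%:R / H%:R * (C * (4 * K)).
have kap0 : 0 <= kap by rewrite mulr_ge0 // ltW.
pose Psi (A : {set X}) s := beta * (Pt s + kap * total A (run s).2 (run s).1).
exists (beta * (kap * (\sum_u w u * H%:R)) + beta * Pt [::]) => s.
apply: (@potential_competitive _ _ dist h _ (fun s x => beta * Cs s x) Psi _ _ _ _ a0) => //.
- by rewrite h_gt0 (leq_trans hH) // (leq_trans (ltnW Hk)).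
- move=> A s' _; rewrite /Psi -mulrN; apply: ler_wpM2l; first exact: ltW.
  rewrite -mulrN -[leLHS]add0r; apply: lerD => //.
  apply: ler_wpM2l => //; rewrite /total_potential -[leLHS]addr0; apply: lerD.
    by apply: potential_ge => // u; rewrite lexx.
  have C1 : 1 <= C by have := C_ge8; lra.
  by apply: light_potential_ge0 => //; have [] := chain_mass (fz s').
- move=> A _; rewrite /Psi (_ : (run [::]).1 = fun=> 0); last by have [_ ->] := runI [::].
  rewrite ler_pM2l // /total_potential /base_potential potential0 // add0r /light_potential big1 ?mul0r ?mulr0 ?addr0 //.
  move=> v _; have m0 u : mass (fun _ : I => 0 : R) u = 0 by rewrite /mass big1.
  rewrite /deposit m0 ltxx mul0r addr0 /heap m0 mulr0 subr0 big1 ?mulr0 // => u _.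
  by rewrite m0 mulr0.
- move=> s' x A A' Ah A'h xA'; have [CB _] := CP s' x.
  have := (runS s' x).2 A' xA'; rewrite A'h => /(_ hH) st.
  have mvp := potential_move (fun=> 2^-1) (fun=> 2^-1) A A' w_ge0 delta01 (fz s').
  have mc : \sum_u w u * `|(count fr A' u)%:R - (count fr A u)%:R| <= move_cost dist A A'.
    have AA : #|A| = #|A'| by rewrite Ah.
    apply: le_trans (move_cost_ge t j w_ge0 AA).
    by apply: ler_sum => u _; rewrite distrC.
  pose L := ln ((1 + delta) / delta).
  have L0 : 0 <= L.
    rewrite ln_ge0 // ler_pdivlMr ?mul1r; last by case/andP: delta01.
    by rewrite lerDr.
  have mc' := ler_wpM2l L0 mc.
  have main : Cs s' x + (Pt (rcons s' x) + kap * total A' (run (rcons s' x)).2 (run (rcons s' x)).1) <=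
      Pt s' + kap * total A (run s').2 (run s').1 + kap * L * move_cost dist A A'.
    have Bm : B s' x = kap * (mv (run s') (run (rcons s' x)) / (C * (4 * K))).
      rewrite /B /kap -[RHS]mulrA [C * (4 * K) * _]mulrC divfK //.
      by rewrite gt_eqF.
    have lem : total A' (run (rcons s' x)).2 (run (rcons s' x)).1 +
        mv (run s') (run (rcons s' x)) / (C * (4 * K)) <=
        total A (run s').2 (run s').1 + L * move_cost dist A A'.
      apply: le_trans st _; move: mvp mc'; rewrite /total_potential /base_potential -/L.
      lra.
    have := ler_wpM2l kap0 lem; rewrite !mulrDr -Bm -[kap * L * _]mulrA; lra.
  rewrite /Psi -mulrDr (_ : alpha = beta * (kap * L)); last by rewrite aE.
  by rewrite -mulrA -mulrDr ler_pM2l.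
Qed.

End HstAlgorithm.

(** * Balanced laws on sets of servers *)

Section Descent.
Context {V X : finType} (t : rooted_tree V) (j : X -> V).
Notation r := (root t).
Notation par := (parent t).
Implicit Types (a b : {set X}).

Hypothesis leafX : forall x c, ~~ child t (j x) c.
Hypothesis j_inj : injective j.

Notation N a u := (inhabitants t j a u).

Lemma child_toward u z : below t u z -> z != u -> exists2 c, child t u c & below t c z.
Proof.
elim/(below_ind (t := t)): z => [|z zr IH].
  by rewrite belowE eqxx orbF => /eqP ->; rewrite eqxx.
rewrite belowE zr => /predU1P[->|/= uz]; first by rewrite eqxx.
move=> zu; have [pE|pu] := eqVneq (par z) u.
  by exists z; rewrite ?below_refl // /child zr pE eqxx.
by have [c uc cz] := IH uz pu; exists c => //; apply: below_trans cz (below_par _ _).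
Qed.

Lemma child_unique u c c' z : child t u c -> child t u c' -> below t c z -> below t c' z -> c = c'.
Proof.
move=> /andP[cr /eqP cu] /andP[c'r /eqP c'u]; apply: sibling_inj => //.
by rewrite cu c'u.
Qed.

Lemma inhabitantsE a u : N a u = (\sum_(x in a) below t u (j x))%N.
Proof.
rewrite /inhabitants -sum1_card big_mkcond [RHS]big_mkcond /=; apply: eq_bigr => x _.
by rewrite inE; case: (x \in a); case: (below _ _ _).
Qed.

Lemma inhabitants_children a u c0 : child t u c0 -> N a u = (\sum_(c | child t u c) N a c)%N.
Proof.
move=> uc0; under eq_bigr do rewrite inhabitantsE.
rewrite inhabitantsE exchange_big; apply: eq_bigr => x _ /=.
have [ux|ux] := boolP (below t u (j x)); last first.
  rewrite big1 // => c uc; apply/eqP; rewrite eqb0; apply: contra ux => cx.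
  exact: below_trans (child_below uc) cx.
have xu : j x != u by apply: contraTneq uc0 => <-; exact: leafX.
have [c uc cx] := child_toward ux xu.
rewrite (bigD1 c) //= cx big1 // => c' /andP[uc' c'c]; apply/eqP; rewrite eqb0.
by apply: contraNN c'c => c'x; rewrite (child_unique uc' uc c'x cx).
Qed.

Lemma inhabitants_leaf a x : N a (j x) = (x \in a).
Proof.
rewrite inhabitantsE; have lem z : below t (j x) (j z) = (z == x).
  apply/idP/eqP => [xz|->]; last exact: below_refl.
  apply: j_inj; apply/eqP; apply: contraT => zx.
  by have [c xc _] := child_toward xz zx; have := leafX x c; rewrite xc.
under eq_bigr do rewrite lem.
rewrite big_mkcond (bigD1 x) //= eqxx big1 ?addn0; first by case: (x \in a).
by move=> i /negbTE ->; case: ifP.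
Qed.

Lemma inhabitants_exchange a l1 l2 u : l1 \in a -> l2 \notin a ->
  (N (l2 |: (a :\ l1)) u + below t u (j l1) = N a u + below t u (j l2))%N.
Proof.
move=> l1a l2a; rewrite !inhabitantsE big_setU1 /=; last first.
  by rewrite !inE (negbTE l2a) andbF.
by rewrite [in RHS](big_setD1 l1) //= addnAC [RHS]addnC addnA.
Qed.

Lemma card_exchange a l1 l2 : l1 \in a -> l2 \notin a -> #|l2 |: (a :\ l1)| = #|a|.
Proof.
move=> l1a l2a; rewrite cardsU1 [in RHS](cardsD1 l1) l1a !inE (negbTE l2a) andbF.
by [].
Qed.

Lemma lt_sum_child (P : pred V) (f g : V -> nat) :
  (\sum_(c | P c) f c < \sum_(c | P c) g c)%N -> exists2 c, P c & (f c < g c)%N.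
Proof.
move=> lt; apply/exists_inP; apply: contraLR lt => /exists_inPn le.
by rewrite -leqNgt; apply: leq_sum => c Pc; rewrite leqNgt; exact: le.
Qed.

Lemma lt_rest (p q p' q' m n : nat) : (q < p)%N -> (q' < p')%N ->
  (p + (p' + m) <= (q + (q' + n)).+1)%N -> (m < n)%N.
Proof. by lia. Qed.

(** Counts of children add up, so below a vertex where [a] has fewer points than [b] there is a
    child with the same property; following such children leads to a leaf. *)
Lemma separating_site a b u : (N a u < N b u)%N -> exists l, [/\ l \in b, l \notin a, below t u (j l) &
  forall v, below t u v -> below t v (j l) -> (N a v < N b v)%N].
Proof.
have [n] := ubnP #|[set v | below t u v]|; elim: n u => // n IH u un lt.
have [/existsP[c0 uc0]|/existsPn nc] := boolP [exists c, child t u c]; last first.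
  have /card_gt0P[x] : (0 < N b u)%N by apply: leq_ltn_trans lt.
  rewrite inE => /andP[xb ux].
  have xu : j x = u.
    apply/eqP; apply: contraT => ne; have [c uc _] := child_toward ux ne.
    by have := nc c; rewrite uc.
  exists x; rewrite xb ux; split=> //; last first.
    move=> v uv vx; have -> // : v = u.
    by apply: (below_anti _ uv); rewrite -xu.
  by apply/negP => xa; move: lt; rewrite -xu !inhabitants_leaf xa xb.
have : (\sum_(c | child t u c) N a c < \sum_(c | child t u c) N b c)%N.
  by rewrite -!(inhabitants_children _ uc0).
move=> /lt_sum_child[c uc ltc]; have uc' := child_below uc.
have [|l [lb la cl lP]] := IH c _ ltc.
  rewrite -ltnS; apply: leq_trans un; rewrite ltnS; apply: proper_card; apply/properP; split.
    by apply/fintype.subsetP => v; rewrite !inE; exact: below_trans.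
  exists u; rewrite inE ?below_refl //; case/andP: uc => cr /eqP <-.
  by rewrite par_below_neq.
exists l; split=> //; first exact: below_trans cl.
move=> v uv vl; have [->//|vu] := eqVneq v u.
have [c' uc2 c'v] := child_toward uv vu.
have cE : c' = c by apply: child_unique uc2 uc (below_trans c'v vl) cl.
by apply: lP vl; rewrite -cE.
Qed.

End Descent.

(** * Exchanges of points between balanced sets *)

Section Tokens.
Context {R : realType} {V X : finType} (t : rooted_tree V) (j : X -> V).
Variables (om : V -> R) (tau : R).
Notation r := (root t).
Notation par := (parent t).
Notation K := (tau / (tau - 1)).
Notation N a u := (inhabitants t j a u).
Implicit Types (a b o : {set X}) (S : {set {set X}}).

Hypothesis leafX : forall x c, ~~ child t (j x) c.
Hypothesis j_inj : injective j.
Hypothesis om_ge0 : forall u, 0 <= om u.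
Hypothesis tau_gt1 : 1 < tau.
Hypothesis om_siblings : forall p c c', child t p c -> child t p c' -> om c = om c'.
Hypothesis om_par : forall v, v != r -> par v != r -> tau * om v <= om (par v).

Definition balanced S := forall a b u, a \in S -> b \in S -> (N a u <= (N b u).+1)%N.

(* The range left to the number of servers below [u] when a little probability
   is moved from [x] to [y]: it must stay of width one. *)
Definition slack S x y u (n : nat) : Prop :=
  if below t u (j x) && ~~ below t u (j y) then
    (exists2 b, b \in S & (n <= N b u)%N) /\ (forall b, b \in S -> (N b u <= n.+1)%N)
  else if below t u (j y) && ~~ below t u (j x) then
    (exists2 b, b \in S & (N b u <= n)%N) /\ (forall b, b \in S -> (n <= (N b u).+1)%N)
  else (exists2 b, b \in S & (N b u <= n)%N) /\ (exists2 b, b \in S & (n <= N b u)%N).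

Definition good_move S x y (m : {set X} * {set X}) :=
  [/\ m.1 \in S, #|m.2| = #|m.1| & forall u, slack S x y u (N m.2 u)].

(** The change of the mean when an equal small amount of probability is moved from [m.1] to [m.2]
    for each pair [m] of [L]. *)
Definition net (L : seq ({set X} * {set X})) z : R :=
  \sum_(m <- L) ((z \in m.2)%:R - (z \in m.1)%:R).

Definition set_cost a b : R := \sum_u om u * `|(N a u)%:R - (N b u)%:R|.

Definition moves_cost (L : seq ({set X} * {set X})) : R := \sum_(m <- L) set_cost m.1 m.2.

Lemma slack_self S x y u a : balanced S -> a \in S -> slack S x y u (N a u).
Proof.
move=> Sb aS; rewrite /slack; case: ifP => _; [|case: ifP => _]; split;
  by [exists a | move=> b bS; apply: Sb].
Qed.

Lemma good_exchange S x y o l1 l2 : balanced S -> o \in S -> l1 \in o -> l2 \notin o ->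
  (forall u, below t u (j l1) -> ~~ below t u (j l2) -> ~~ below t u (j y) /\
     (if below t u (j x) then forall b, b \in S -> (N b u <= N o u)%N
      else exists2 b, b \in S & (N b u < N o u)%N)) ->
  (forall u, below t u (j l2) -> ~~ below t u (j l1) -> ~~ below t u (j x) /\
     (if below t u (j y) then forall b, b \in S -> (N o u <= N b u)%N
      else exists2 b, b \in S & (N o u < N b u)%N)) ->
  good_move S x y (o, l2 |: (o :\ l1)).
Proof.
move=> Sb oS l1o l2o out inn; split=> //=; first exact: card_exchange.
move=> u; have := inhabitants_exchange t j u l1o l2o; have := out u; have := inn u.
have [b1|b1] := boolP (below t u (j l1)); have [b2|b2] := boolP (below t u (j l2)) => /=.
- by move=> _ _ /eqP; rewrite eqn_add2r => /eqP ->; exact: slack_self.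
- move=> _ /(_ isT isT) [ny ok]; rewrite addn1 addn0 => E; rewrite /slack ny (negbTE ny) /= andbT.
  case: ifP ok => _ ok; split.
  + by exists o => //; rewrite -E.
  + by move=> b /ok; rewrite -E.
  + by case: ok => b bS; rewrite -E ltnS; exists b.
  + by exists o => //; rewrite -E.
- move=> /(_ isT isT) [nx ok] _; rewrite addn1 addn0 => E; rewrite /slack nx (negbTE nx) /= andbT.
  case: ifP ok => _ ok; split.
  + by exists o => //; rewrite E.
  + by move=> b /ok; rewrite E ltnS.
  + by exists o => //; rewrite E.
  + by case: ok => b bS lt; exists b => //; rewrite E.
- by move=> _ _; rewrite !addn0 => ->; exact: slack_self.
Qed.

Definition path_weight u (z : V) := \sum_(v | below t u v && below t v z) om v.

Lemma path_weight_le u z : u != r -> below t u z -> path_weight u z <= K * om u.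
Proof.
move=> ur uz; have t1 : 0 < tau - 1 by rewrite subr_gt0.
(* The subtracted tail of the geometric series makes the induction along the path close. *)
suff : path_weight u z <= K * om u - om z / (tau - 1).
  by have := divr_ge0 (om_ge0 z) (ltW t1); lra.
elim/(below_ind (t := t)): z uz => [|z zr IH].
  by rewrite belowE eqxx orbF => /eqP rE; rewrite rE eqxx in ur.
have [->|zu] := eqVneq z u.
  move=> _; rewrite /path_weight (big_pred1 u); last first.
    move=> v /=; apply/andP/eqP => [[uv vu]|->]; last by rewrite below_refl.
    exact: below_anti vu uv.
  by rewrite le_eqVlt; apply/orP; left; apply/eqP; field; rewrite gt_eqF.
move=> uz; have uz' : below t u (par z) by apply: below_parent_of => //; rewrite eq_sym.
have pr : par z != r.
  by apply: contraNneq ur => pr; rewrite (@below_of_root _ t u) // -pr.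
have -> : path_weight u z = path_weight u (par z) + om z.
  rewrite /path_weight (bigD1 z) /=; last by rewrite uz below_refl.
  rewrite addrC; congr (_ + _); apply: eq_bigl => v; rewrite (belowE t v z) zr /= [z == v]eq_sym.
  have [->|//] := eqVneq v z; last by rewrite andbT.
  by rewrite par_below_neq // !andbF.
have := IH uz'; have := om_par zr pr => h1 h2.
have : tau * om z / (tau - 1) <= om (par z) / (tau - 1) by rewrite ler_pM2r ?invr_gt0.
have -> : tau * om z / (tau - 1) = om z + om z / (tau - 1) by field; rewrite gt_eqF.
lra.
Qed.

(** Only counts on the two paths below [c1] and [c2] change, and by geometric decay each path weighs
    at most [K * om c1]. *)
Lemma exchange_cost q c1 c2 o l1 l2 : child t q c1 -> child t q c2 ->
  below t c1 (j l1) -> below t c2 (j l2) -> l1 \in o -> l2 \notin o ->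
  set_cost o (l2 |: (o :\ l1)) <= 2 * K * om c1.
Proof.
move=> qc1 qc2 b1 b2 l1o l2o.
have [c1r _] := andP qc1; have [c2r _] := andP qc2.
have p1 := path_weight_le c1r b1; have p2 := path_weight_le c2r b2.
rewrite -(om_siblings qc1 qc2) in p2.
apply: (@le_trans _ _ (path_weight c1 (j l1) + path_weight c2 (j l2))); last by lra.
rewrite /set_cost /path_weight [\sum_(v | below t c1 v && _) _]big_mkcond.
rewrite [\sum_(v | below t c2 v && _) _]big_mkcond -big_split; apply: ler_sum => u _ /=.
have E := inhabitants_exchange t j u l1o l2o.
have ER : (N o u)%:R - (N (l2 |: (o :\ l1)) u)%:R = (below t u (j l1))%:R - (below t u (j l2))%:R :> R.
  by have : (N (l2 |: (o :\ l1)) u + below t u (j l1))%:R = (N o u + below t u (j l2))%:R :> R;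
    [rewrite E|rewrite !natrD; lra].
rewrite ER.
have side c c' l l' : child t q c -> child t q c' -> below t c (j l) -> below t c' (j l') ->
    below t u (j l) -> ~~ below t u (j l') -> below t c u.
  move=> qc qc' cl c'l' ul ul'; case/orP: (below_chain cl ul) => // uc.
  have [->|ne] := eqVneq u c; first exact: below_refl.
  case/negP: ul'; apply: below_trans c'l'; apply: below_trans (child_below qc').
  by case/andP: qc => _ /eqP <-; exact: below_parent_of.
have [u1|u1] := boolP (below t u (j l1)); have [u2|u2] := boolP (below t u (j l2)) => /=.
- by rewrite subrr normr0 mulr0 addr_ge0 //; case: ifP.
- by rewrite subr0 normr1 mulr1 (side c1 c2 l1 l2) // andbF addr0.
- by rewrite sub0r normrN normr1 mulr1 (side c2 c1 l2 l1) // andbF add0r.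
- by rewrite subrr normr0 mulr0 !andbF addr0.
Qed.

(** How to take a server below [u] from a set [a] with maximal count there, so that in the end [x]
    loses mass. Descend towards [x]. If at the next child [u'] the maximum is attained only by other
    sets, let [b] be one: at some sibling [c] of [u'] the set [a] has more points than [b]. Then [a]
    gives up a point [l] below [c], [b] trades a point below [u'] for [l], and the descent continues
    with [b]. Each level costs at most one exchange. *)
Lemma down S x y u a : balanced S -> below t u (j x) -> ~~ below t u (j y) -> a \in S ->
  (forall b, b \in S -> (N b u <= N a u)%N) -> (exists2 b, b \in S & x \in b) ->
  exists l L, [/\ l \in a, below t u (j l),
    forall v, below t u v -> below t v (j l) ->
      if below t v (j x) then forall b, b \in S -> (N b v <= N a v)%N
      else exists2 b, b \in S & (N b v < N a v)%N &
    [/\ forall m, m \in L -> good_move S x y m, forall z, net L z = (z == l)%:R - (z == x)%:R &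
      moves_cost L <= 2 * K * \sum_(v | [&& below t u v, v != u & below t v (j x)]) om v]].
Proof.
move=> Sb; have [n] := ubnP (depth t (j x) - depth t u); elim: n u a => // n IH u a un ux uy aS amax xS.
have K0 : 0 <= 2 * K by rewrite mulr_ge0 // divr_ge0 ?subr_ge0 ?ltW // (lt_trans ltr01).
have [ju|ju] := eqVneq (j x) u.
  have xa : x \in a.
    have [b bS xb] := xS; have := amax b bS; rewrite -ju !inhabitants_leaf // xb.
    by case: (x \in a).
  exists x, [::]; split=> //; last first.
    split=> // [z|]; first by rewrite /net big_nil subrr.
    by rewrite /moves_cost big_nil mulr_ge0 // sumr_ge0.
  move=> v uv vx; rewrite vx; suff -> : v = u by [].
  by apply: (below_anti _ uv); rewrite -ju.
have [u' uu' u'x] := child_toward ux ju.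
have u'y : ~~ below t u' (j y) by apply: contra uy; exact: below_trans (child_below uu').
have [u'r /eqP u'p] := andP uu'.
have un' : (depth t (j x) - depth t u' < n)%N.
  have : (depth t u' <= depth t (j x))%N by exact: below_depth_le.
  have du : depth t u' = (depth t u).+1 by rewrite (depth_parent u'r) u'p.
  by rewrite du => le; move: un le; clear; lia.
have sumle : om u' + \sum_(v | [&& below t u' v, v != u' & below t v (j x)]) om v <=
    \sum_(v | [&& below t u v, v != u & below t v (j x)]) om v.
  rewrite [leRHS](bigD1 u') /=; last first.
    rewrite (child_below uu') u'x andbT /=; apply/eqP => uE.
    by have := par_below_neq u'r; rewrite u'p uE below_refl.
  rewrite lerD2l big_mkcond [leRHS]big_mkcond; apply: ler_sum => v _ /=.
  case: ifP => [/and3P[u'v vu' vx]|_]; last by case: ifP.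
  rewrite (below_trans (child_below uu') u'v) vx vu' /= !andbT ifT //.
  apply: contraTneq u'v => ->; rewrite -u'p par_below_neq //.
have [/forall_inP amax'|/forall_inPn[b0 b0S b0P]] :=
    boolP [forall b in S, (N b u' <= N a u')%N].
  have [l [L [la u'l lP [Lg Ln Lc]]]] := IH u' a un' u'x u'y aS amax' xS.
  exists l, L; split=> //; first exact: below_trans (child_below uu') u'l.
    move=> v uv vl; have [->|vu] := eqVneq v u; first by rewrite ux.
    have [c uc cv] := child_toward uv vu.
    have cE : c = u' by apply: child_unique uc uu' (below_trans cv vl) u'l.
    by apply: lP vl; rewrite -cE.
  split=> //; apply: le_trans Lc _; rewrite ler_wpM2l //; apply: le_trans sumle.
  by rewrite lerDr.
have [b bS bmax] := arg_maxnP (fun b => N b u') b0S.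
have ab : (N a u' < N b u')%N by apply: leq_trans (bmax _ b0S); rewrite ltnNge.
have [c uc ca] : exists2 c, child t u c && (c != u') & (N b c < N a c)%N.
  apply: lt_sum_child; have := amax b bS.
  rewrite !(inhabitants_children leafX _ uu') (bigD1 u') //= [X in (_ <= X)%N](bigD1 u') //=.
  by move: ab; clear; lia.
have {uc} [uc cu'] := andP uc.
have [l [la lb cl lP]] := separating_site leafX j_inj ca.
have [l2 [L [l2b u'l2 l2P [Lg Ln Lc]]]] := IH u' b un' u'x u'y bS bmax xS.
have cx v : below t c v -> ~~ below t v (j x).
  move=> cv; apply: contra cu' => vx; apply/eqP.
  exact: child_unique uc uu' (below_trans cv vx) u'x.
have side d d' k k' : child t u d -> child t u d' -> below t d (j k) -> below t d' (j k') ->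
    forall v, below t v (j k) -> ~~ below t v (j k') -> below t d v.
  move=> ud ud' dk d'k' v vk vk'; case/orP: (below_chain dk vk) => // vd.
  have [->|ne] := eqVneq v d; first exact: below_refl.
  case/negP: vk'; apply: below_trans d'k'; apply: below_trans (child_below ud').
  by case/andP: ud => _ /eqP <-; exact: below_parent_of.
have yv v : below t u v -> ~~ below t v (j y) by move=> uv; apply: contra uy; exact: below_trans.
exists l, ((b, l |: (b :\ l2)) :: L); split=> //.
- exact: below_trans (child_below uc) cl.
- move=> v uv vl; have [->|vu] := eqVneq v u; first by rewrite ux.
  have [c' uc' c'v] := child_toward uv vu.
  have cE : c' = c by apply: child_unique uc' uc (below_trans c'v vl) cl.
  rewrite (negbTE (cx v _)) -?cE //; exists b => //; apply: lP vl; by rewrite -cE.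
split.
- move=> m; rewrite inE => /predU1P[->|/Lg//]; apply: good_exchange => // v.
    move=> vl2 vl; have u'v := side u' c l2 l uu' uc u'l2 cl v vl2 vl.
    split; first by apply: yv; exact: below_trans (child_below uu') u'v.
    exact: l2P.
  move=> vl vl2; have cv := side c u' l l2 uc uu' cl u'l2 v vl vl2.
  split; first exact: cx.
  rewrite (negbTE (yv v _)); last exact: below_trans (child_below uc) cv.
  by exists a => //; apply: lP.
- move=> z; rewrite /net big_cons -/(net L z) Ln /= !inE.
  have [->|zl] := eqVneq z l.
    have ll2 : l != l2 by apply: contraNneq lb => ->.
    by rewrite (negbTE lb) (negbTE ll2) /=; ring.
  have [->|zl2] := eqVneq z l2; first by rewrite l2b /=; lra.
  by rewrite /= subrr; lra.
rewrite /moves_cost big_cons -/(moves_cost L); apply: le_trans (ler_wpM2l K0 sumle).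
by rewrite mulrDr; apply: lerD => //; exact: exchange_cost uu' uc u'l2 cl l2b lb.
Qed.

Section Complement.
Variable S : {set {set X}}.
Let S' : {set {set X}} := [set ~: b | b in S].

Lemma inhabitants_compl a u : (N (~: a) u + N a u = N [set: X] u)%N.
Proof.
rewrite !inhabitantsE [in RHS](bigID (mem a)) /= addnC; congr (_ + _)%N.
  by apply: eq_bigl => x; rewrite !inE.
by apply: eq_bigl => x; rewrite !inE.
Qed.

Lemma mem_compl b : (~: b \in S') = (b \in S).
Proof.
apply/imsetP/idP => [[b' b'S /(congr1 (fun A => ~: A))]|bS]; last by exists b.
by rewrite !finset.setCK => ->.
Qed.

Lemma balanced_compl : balanced S -> balanced S'.
Proof.
move=> Sb a b u; rewrite -[a]finset.setCK -[b]finset.setCK !mem_compl => aS bS.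
have := Sb _ _ u bS aS; have := inhabitants_compl (~: a) u; have := inhabitants_compl (~: b) u.
by rewrite !finset.setCK; clear; lia.
Qed.

Lemma good_move_compl x y m : good_move S' y x m -> good_move S x y (~: m.1, ~: m.2).
Proof.
case: m => o n [/= oS' cn sl]; split=> /=; first by rewrite -mem_compl finset.setCK.
  by rewrite [LHS]cardsCs [RHS]cardsCs !finset.setCK cn.
have inS b : b \in S' -> ~: b \in S by rewrite -mem_compl finset.setCK.
move=> u; have := sl u; rewrite /slack; have cN := inhabitants_compl n u.
case: ifP => c1; case: ifP => c2; rewrite ?c1 ?c2 /=.
- by case/andP: c1 c2 => -> /negbTE ->.
- move=> [[b /inS bS h1] h2]; split.
    by exists (~: b) => //; have := inhabitants_compl b u; move: h1 cN; clear; lia.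
  move=> b' b'S; have := h2 (~: b'); rewrite mem_compl => /(_ b'S).
  by have := inhabitants_compl b' u; move: cN; clear; lia.
- move=> [[b /inS bS h1] h2]; split.
    by exists (~: b) => //; have := inhabitants_compl b u; move: h1 cN; clear; lia.
  move=> b' b'S; have := h2 (~: b'); rewrite mem_compl => /(_ b'S).
  by have := inhabitants_compl b' u; move: cN; clear; lia.
- move=> [[b /inS bS h1] [b' /inS b'S h2]]; split.
    by exists (~: b') => //; have := inhabitants_compl b' u; move: h2 cN; clear; lia.
  by exists (~: b) => //; have := inhabitants_compl b u; move: h1 cN; clear; lia.
Qed.

(** Adding a point is removing one from the complement: [down] applies to the complements with [x]
    and [y] interchanged. *)
Lemma up x y u a : balanced S -> below t u (j y) -> ~~ below t u (j x) -> a \in S ->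
  (forall b, b \in S -> (N a u <= N b u)%N) -> (exists2 b, b \in S & y \notin b) ->
  exists l L, [/\ l \notin a, below t u (j l),
    forall v, below t u v -> below t v (j l) ->
      if below t v (j y) then forall b, b \in S -> (N a v <= N b v)%N
      else exists2 b, b \in S & (N a v < N b v)%N &
    [/\ forall m, m \in L -> good_move S x y m, forall z, net L z = (z == y)%:R - (z == l)%:R &
      moves_cost L <= 2 * K * \sum_(v | [&& below t u v, v != u & below t v (j y)]) om v]].
Proof.
move=> Sb uy ux aS amin [b0 b0S yb0].
have [|||l [L [la ul lP [Lg Ln Lc]]]] := @down S' y x u (~: a) (balanced_compl Sb) uy ux.
- by rewrite mem_compl.
- move=> b; rewrite -[b]finset.setCK mem_compl => bS; have := amin _ bS.
  have := inhabitants_compl a u; have := inhabitants_compl (~: b) u; rewrite !finset.setCK; clear; lia.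
- by exists (~: b0); rewrite ?mem_compl // inE.
have netC m (z : X) : ((z \in ~: m.2)%:R - (z \in ~: m.1)%:R : R) = - ((z \in m.2)%:R - (z \in m.1)%:R).
  by rewrite !inE; case: (z \in m.2); case: (z \in m.1); rewrite /=; ring.
exists l, [seq (~: m.1, ~: m.2) | m <- L]; rewrite inE in la; split=> //.
  move=> v uv vl; have := lP v uv vl; case: ifP => _.
    move=> h b bS; have := h (~: b); rewrite mem_compl => /(_ bS).
    by have := inhabitants_compl a v; have := inhabitants_compl b v; clear; lia.
  move=> [b]; rewrite -[b]finset.setCK mem_compl => bS lt; exists (~: b) => //.
  by have := inhabitants_compl a v; have := inhabitants_compl (~: b) v; move: lt; clear; lia.
split.
- by move=> _ /mapP[m mL ->]; apply: good_move_compl; exact: Lg.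
- move=> z; rewrite /net big_map /=; under eq_bigr do rewrite netC.
  by rewrite sumrN -/(net L z) Ln opprB.
- apply: le_trans Lc; rewrite /moves_cost big_map /= le_eqVlt; apply/orP; left; apply/eqP.
  apply: eq_bigr => m _; apply: eq_bigr => u' _; congr (_ * _); rewrite distrC; congr (`|_|).
  have h c : (N (~: c) u')%:R = (N [set: X] u')%:R - (N c u')%:R :> R.
    by rewrite -(inhabitants_compl c u') natrD addrK.
  by rewrite !h; ring.
Qed.

End Complement.

(** Let [u] and [v] be the children of the lowest common ancestor [p] towards [x] and [y]. A set
    with maximal count below [u] and minimal count below [v] can exchange directly. Otherwise sets
    [a] and [b] attaining the maximum and the minimum satisfy [N b < N a] at both [u] and [v], and
    balance at [p] yields a third child [c] where [b] has more. A point [l] below [c] then passes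
    from [b] to [a] as an intermediate stop. *)
Lemma exchange_step S x y k : balanced S -> (forall a, a \in S -> #|a| = k) -> x != y ->
  (exists2 b, b \in S & x \in b) -> (exists2 b, b \in S & y \notin b) ->
  exists L, [/\ forall m, m \in L -> good_move S x y m,
    forall z, net L z = (z == y)%:R - (z == x)%:R &
    moves_cost L <= 2 * K * tree_dist t j om x y].
Proof.
move=> Sb Sk xy xS yS.
have K0 : 0 <= 2 * K by rewrite mulr_ge0 // divr_ge0 ?subr_ge0 ?ltW // (lt_trans ltr01).
pose Q p := below t p (j x) && below t p (j y).
have Qr : Q r by rewrite /Q !below_root.
have [p /andP[px py] pmax] := arg_maxnP (depth t) Qr.
have jxp : j x != p.
  apply: contraNneq xy => pE; apply/eqP/j_inj; rewrite pE; apply/esym/eqP; apply: contraT => jyp.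
  by have [c pc _] := child_toward py jyp; have := leafX x c; rewrite pE pc.
have jyp : j y != p.
  apply: contraNneq xy => pE; apply/eqP/j_inj; rewrite pE; apply/eqP; apply: contraT => jx.
  by have [c pc _] := child_toward px jx; have := leafX y c; rewrite pE pc.
have [u pu ux] := child_toward px jxp; have [v pv vy] := child_toward py jyp.
have deeper c : child t p c -> ~~ Q c.
  move=> /andP[cr /eqP cp]; apply/negP => /pmax; rewrite /= (depth_parent cr) cp.
  by rewrite /geq /= ltnn.
have uy : ~~ below t u (j y) by have := deeper u pu; rewrite /Q ux.
have vx : ~~ below t v (j x) by have := deeper v pv; rewrite /Q vy andbT.
have uv : u != v by apply: contraNneq uy => ->.
have distE : om u + \sum_(c | [&& below t u c, c != u & below t c (j x)]) om c +
    (om v + \sum_(c | [&& below t v c, c != v & below t c (j y)]) om c) <= tree_dist t j om x y.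
  have lem z (c : V) : below t c (j z) -> om c + \sum_(d | [&& below t c d, d != c & below t d (j z)]) om d =
      \sum_(d | below t c d && below t d (j z)) om d.
    move=> cz; rewrite [RHS](bigD1 c) ?below_refl //=; congr (_ + _); apply: eq_bigl => d.
    by rewrite andbAC andbA.
  rewrite !lem // big_mkcond [X in _ + X]big_mkcond -big_split; apply: ler_sum => c _ /=.
  have [uc|uc] := boolP (below t u c).
    have ncy : ~~ below t c (j y) by apply: contra uy; exact: below_trans.
    rewrite (negbTE ncy) andbF addr0 /=; case: (below t c (j x)); rewrite ?mulr1 ?mulr0 //.
  rewrite add0r; have [vc|vc] /= := boolP (below t v c); last by rewrite mulr_ge0.
  have ncx : ~~ below t c (j x) by apply: contra vx; exact: below_trans.
  by rewrite (negbTE ncx); case: (below t c (j y)); rewrite ?mulr1 ?mulr0.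
have [a0 a0S _] := xS.
have [a aS amax] := arg_maxnP (fun b => N b u) a0S.
have [b bS bmin] := arg_minnP (fun b => N b v) a0S.
have side d d' k' k'' : child t p d -> child t p d' -> below t d (j k') -> below t d' (j k'') ->
    forall v, below t v (j k') -> ~~ below t v (j k'') -> below t d v.
  move=> pd pd' dk d'k' c vk vk'; case/orP: (below_chain dk vk) => // vd.
  have [->|ne] := eqVneq c d; first exact: below_refl.
  case/negP: vk'; apply: below_trans d'k'; apply: below_trans (child_below pd').
  by case/andP: pd => _ /eqP <-; exact: below_parent_of.
have notx c : below t v c -> ~~ below t c (j x) by move=> vc; apply: contra vx; exact: below_trans.
have noty c : below t u c -> ~~ below t c (j y) by move=> uc; apply: contra uy; exact: below_trans.
have omuv := om_siblings pu pv.
have direct o : o \in S -> (forall b, b \in S -> (N b u <= N o u)%N) ->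
    (forall b, b \in S -> (N o v <= N b v)%N) -> exists L, [/\ forall m, m \in L -> good_move S x y m,
    forall z, net L z = (z == y)%:R - (z == x)%:R & moves_cost L <= 2 * K * tree_dist t j om x y].
  move=> oS omax omin.
  have [l1 [L1 [l1o ul1 l1P [Lg1 Ln1 Lc1]]]] := down Sb ux uy oS omax xS.
  have [l2 [L2 [l2o vl2 l2P [Lg2 Ln2 Lc2]]]] := up Sb vy vx oS omin yS.
  exists ((o, l2 |: (o :\ l1)) :: L1 ++ L2); split.
  - move=> m; rewrite inE mem_cat => /orP[/eqP ->|/orP[/Lg1//|/Lg2//]].
    apply: good_exchange => // c cl cl'.
      have uc := side u v l1 l2 pu pv ul1 vl2 c cl cl'; split; first exact: noty.
      exact: l1P.
    have vc := side v u l2 l1 pv pu vl2 ul1 c cl cl'; split; first exact: notx.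
    exact: l2P.
  - move=> z; rewrite /net big_cons big_cat -/(net L1 z) -/(net L2 z) Ln1 Ln2 /= !inE.
    have [->|zl2] := eqVneq z l2.
      have l21 : l2 != l1 by apply: contraNneq l2o => ->.
      by rewrite (negbTE l2o) (negbTE l21) /=; lra.
    have [->|zl1] := eqVneq z l1; first by rewrite l1o /=; lra.
    by rewrite /= subrr; lra.
  rewrite /moves_cost big_cons big_cat /= -/(moves_cost L1) -/(moves_cost L2).
  apply: le_trans (ler_wpM2l K0 distE); have := exchange_cost pu pv ul1 vl2 l1o l2o.
  have := mulr_ge0 K0 (om_ge0 v); rewrite !mulrDr; move: (2 * K) Lc1 Lc2 => K2; lra.
have [/forall_inP amin|/forall_inPn[b' b'S nb']] := boolP [forall b in S, (N a v <= N b v)%N].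
  exact: direct aS amax amin.
have ba : (N b v < N a v)%N by apply: leq_ltn_trans (bmin _ b'S) _; rewrite ltnNge.
have [/forall_inP bmax|/forall_inPn[b'' b''S nb'']] := boolP [forall o in S, (N o u <= N b u)%N].
  exact: direct bS bmax bmin.
have bu : (N b u < N a u)%N by apply: leq_trans (amax _ b''S); rewrite ltnNge.
have [c] : exists2 c, [&& child t p c, c != u & c != v] & (N a c < N b c)%N.
  apply: lt_sum_child; have := Sb a b p aS bS.
  rewrite !(inhabitants_children leafX _ pu).
  rewrite (bigD1 u) //= (bigD1 v) /=; last by rewrite pv eq_sym.
  rewrite [X in (_ <= X.+1)%N](bigD1 u) //= [X in (_ <= (_ + X).+1)%N](bigD1 v) /=; last by rewrite pv eq_sym.
  rewrite (eq_bigl (fun c => [&& child t p c, c != u & c != v])); last by move=> c; rewrite andbA.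
  rewrite [X in (_ <= (_ + (_ + X)).+1)%N](eq_bigl (fun c => [&& child t p c, c != u & c != v])); last by move=> c; rewrite andbA.
  exact: lt_rest.
move=> /and3P[pc cu cv] abc.
have [l [lb la cl lP]] := separating_site leafX j_inj abc.
have [l1 [L1 [l1a ul1 l1P [Lg1 Ln1 Lc1]]]] := down Sb ux uy aS amax xS.
have [l2 [L2 [l2b vl2 l2P [Lg2 Ln2 Lc2]]]] := up Sb vy vx bS bmin yS.
have cnx d : below t c d -> ~~ below t d (j x).
  by move=> cd; apply: contra cu => dx; apply/eqP; exact: child_unique pc pu (below_trans cd dx) ux.
have cny d : below t c d -> ~~ below t d (j y).
  by move=> cd; apply: contra cv => dy; apply/eqP; exact: child_unique pc pv (below_trans cd dy) vy.
exists ((a, l |: (a :\ l1)) :: (b, l2 |: (b :\ l)) :: L1 ++ L2); split.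
- move=> m; rewrite !inE mem_cat => /or3P[/eqP ->|/eqP ->|/orP[/Lg1//|/Lg2//]].
    apply: good_exchange => // d dl dl'.
      have ud := side u c l1 l pu pc ul1 cl d dl dl'; split; first exact: noty.
      exact: l1P.
    have cd := side c u l l1 pc pu cl ul1 d dl dl'; split; first exact: cnx.
    by rewrite (negbTE (cny d cd)); exists b => //; exact: lP.
  apply: good_exchange => // d dl dl'.
    have cd := side c v l l2 pc pv cl vl2 d dl dl'; split; first exact: cny.
    by rewrite (negbTE (cnx d cd)); exists a => //; exact: lP.
  have vd := side v c l2 l pv pc vl2 cl d dl dl'; split; first exact: notx.
  exact: l2P.
- move=> z; rewrite /net !big_cons big_cat -/(net L1 z) -/(net L2 z) Ln1 Ln2 /= !inE.
  have ll1 : l != l1 by apply: contraNneq la => ->.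
  have ll2 : l != l2 by apply: contraTneq lb => ->.
  have l12 : l1 != l2.
    apply: contraNneq uv => E; apply/eqP; apply: child_unique pu pv ul1 _.
    by rewrite E.
  have [->|zl] := eqVneq z l.
    by rewrite (negbTE la) lb (negbTE ll1) (negbTE ll2) /=; ring.
  have [->|zl1] := eqVneq z l1.
    by rewrite l1a (negbTE l12) /=; case: (l1 \in b) => /=; ring.
  have [->|zl2] := eqVneq z l2.
    by rewrite (negbTE l2b) /=; case: (l2 \in a) => /=; ring.
  by case: (z \in a); case: (z \in b) => /=; ring.
rewrite /moves_cost !big_cons big_cat /= -/(moves_cost L1) -/(moves_cost L2).
apply: le_trans (ler_wpM2l K0 distE).
have := exchange_cost pu pc ul1 cl l1a la; have := exchange_cost pc pv cl vl2 lb l2b.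
rewrite -(om_siblings pv pc) !mulrDr; move: (2 * K) Lc1 Lc2 => K2; lra.
Qed.

End Tokens.

Lemma mul_continuous (R : realType) (T : topologicalType) (F G : T -> R) :
  continuous F -> continuous G -> continuous (fun z => F z * G z).
Proof. by move=> cF cG z; apply: cvgM; [exact: cF | exact: cG]. Qed.

Lemma add_continuous' (R : realType) (T : topologicalType) (F G : T -> R) :
  continuous F -> continuous G -> continuous (fun z => F z + G z).
Proof. by move=> cF cG z; apply: cvgD; [exact: cF | exact: cG]. Qed.

Lemma sum0_each (R : realType) (I : finType) (F : I -> R) :
  (forall i, 0 <= F i) -> \sum_i F i = 0 -> forall i, F i = 0.
Proof.
move=> F0 s0 i; apply/eqP; rewrite eq_le F0 andbT -s0 (bigD1 i) //= lerDl.
exact: sumr_ge0.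
Qed.

(** * Following the fractional solution by balanced laws *)

Section Coupling.
Context {R : realType} {V X : finType} (t : rooted_tree V) (j : X -> V).
Variables (om : V -> R) (tau : R) (k : nat).
Notation r := (root t).
Notation par := (parent t).
Notation K := (tau / (tau - 1)).
Notation N a u := (inhabitants t j a u).
Notation dist := (tree_dist t j om).
Implicit Types (mu nu : {set X} -> R) (F : X -> R) (A B : {set X}).

Hypothesis leafX : forall x c, ~~ child t (j x) c.
Hypothesis j_inj : injective j.
Hypothesis om_ge0 : forall u, 0 <= om u.
Hypothesis tau_gt1 : 1 < tau.
Hypothesis om_siblings : forall p c c', child t p c -> child t p c' -> om c = om c'.
Hypothesis om_par : forall v, v != r -> par v != r -> tau * om v <= om (par v).

Definition support mu : {set {set X}} := [set A | (0 < mu A)%R].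

Definition mean mu x : R := \sum_A mu A * (x \in A)%:R.

Definition balanced_law F mu := [/\ forall A, 0 <= mu A, \sum_A mu A = 1, mean mu =1 F,
  forall A, A \in support mu -> #|A| = k & balanced t j (support mu)].

Lemma inside_mean mu u : inside t j (mean mu) u = \sum_A mu A * (N A u)%:R.
Proof.
rewrite /inside exchange_big; apply: eq_bigr => A _ /=; rewrite -mulr_sumr; congr (_ * _).
rewrite inhabitantsE natr_sum big_mkcond [RHS]big_mkcond; apply: eq_bigr => x _ /=.
by case: (below _ _ _); case: (x \in A).
Qed.

Lemma sum_mean mu : \sum_A mu A = 1 -> (forall A, mu A != 0 -> #|A| = k) -> \sum_x mean mu x = k%:R.
Proof.
move=> mu1 muk; rewrite /mean exchange_big /=.
have -> : k%:R = (\sum_A mu A) * k%:R :> R by rewrite mu1 mul1r.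
rewrite mulr_suml; apply: eq_bigr => A _.
rewrite -mulr_sumr; have [->|/muk <-] := eqVneq (mu A) 0; first by rewrite !mul0r.
by rewrite -natr_sum -sum1_card [in RHS]big_mkcond.
Qed.

Lemma slack_width S x y u m n : balanced t j S -> slack t j S x y u m -> slack t j S x y u n -> (m <= n.+1)%N.
Proof.
move=> Sb; rewrite /slack; case: ifP => _; [|case: ifP => _].
- by move=> [[b bS mb] _] [_ /(_ b bS)]; exact: leq_trans.
- by move=> [_ h] [[b bS bn] _]; apply: leq_trans (h b bS) _.
- move=> [_ [b bS mb]] [[b' b'S b'n] _]; apply: leq_trans mb _; apply: leq_trans (Sb _ _ u bS b'S) _.
  by rewrite ltnS.
Qed.

Lemma set_cost_triangle A B D : set_cost t j om A D <= set_cost t j om A B + set_cost t j om B D.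
Proof.
rewrite /set_cost -big_split; apply: ler_sum => u _ /=; rewrite -mulrDr ler_wpM2l //.
have -> : (N A u)%:R - (N D u)%:R = ((N A u)%:R - (N B u)%:R) + ((N B u)%:R - (N D u)%:R) :> R by ring.
exact: ler_normD.
Qed.

Lemma set_costxx A : set_cost t j om A A = 0.
Proof. by apply: big1 => u _; rewrite subrr normr0 mulr0. Qed.

Definition fraction_gap F F' : R := \sum_u om u * `|inside t j F u - inside t j F' u|.

Section Improve.
Variables (mu : {set X} -> R) (F' : X -> R) (z : {set X} -> {set X} -> R).
Let nu B := \sum_A z A B.
Hypothesis z_ge0 : forall A B, 0 <= z A B.
Hypothesis z_mu : forall A, \sum_B z A B = mu A.
Hypothesis mu1 : \sum_A mu A = 1.
Hypothesis nuk : forall B, B \in support nu -> #|B| = k.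
Hypothesis nub : balanced t j (support nu).
Hypothesis F'01 : forall x, 0 <= F' x <= 1.
Hypothesis F'k : \sum_x F' x = k%:R.
Hypothesis gap : exists x, mean nu x != F' x.

Let nu_ge0 B : 0 <= nu B. Proof. exact: sumr_ge0. Qed.

Let nu1 : \sum_B nu B = 1.
Proof. by rewrite exchange_big /= -mu1; apply: eq_bigr => A _; exact: z_mu. Qed.

(** An amount [e] of probability is moved along the pairs of [exchange_step] between a surplus point
    [x] and a deficit point [y] separated as deep as possible. The gap to [F'] drops by at least
    [e * dist x y], and the coupling cost rises by at most [2 * K] times as much. [e] is small
    enough not to overshoot at [x] or [y] and not to exhaust any set. *)
Lemma improve : exists z' : {set X} -> {set X} -> R, [/\ forall A B, 0 <= z' A B, forall A, \sum_B z' A B = mu A,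
  forall B, B \in support (fun B => \sum_A z' A B) -> #|B| = k,
  balanced t j (support (fun B => \sum_A z' A B)) &
  \sum_A \sum_B z' A B * set_cost t j om A B + 2 * K * fraction_gap (mean (fun B => \sum_A z' A B)) F' <=
  \sum_A \sum_B z A B * set_cost t j om A B + 2 * K * fraction_gap (mean nu) F' /\
  \sum_x `|mean (fun B => \sum_A z' A B) x - F' x| < \sum_x `|mean nu x - F' x|].
Proof.
have K0 : 0 <= 2 * K by rewrite mulr_ge0 // divr_ge0 ?subr_ge0 ?ltW // (lt_trans ltr01).
pose S := support nu; have nukS B : B \in S -> #|B| = k by exact: nuk.
have nubS : balanced t j S by exact: nub.
have inS B : (B \in S) = (0 < nu B)%R by rewrite inE.
have offS B : B \notin S -> nu B = 0.
  by rewrite inS -leNgt => le; apply/eqP; rewrite eq_le le nu_ge0.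
have Mk : \sum_x mean nu x = \sum_x F' x.
  by rewrite F'k; apply: sum_mean nu1 _ => A A0; apply: nukS; rewrite inS lt_def A0 nu_ge0.
have [x [y [Mx My ux uy]]] := surplus_pair t j Mk gap.
have xy : x != y by apply: contraTneq Mx => ->; rewrite -leNgt ltW.
have xS : exists2 b, b \in S & x \in b.
  apply/exists_inP; apply: contraTT Mx => /exists_inPn no; rewrite -leNgt.
  have -> : mean nu x = 0; last by case/andP: (F'01 x).
  apply: big1 => B _; have [BS|/offS ->] := boolP (B \in S); last by rewrite mul0r.
  by rewrite (negbTE (no B BS)) mulr0.
have yS : exists2 b, b \in S & y \notin b.
  apply/exists_inP; apply: contraTT My => /exists_inPn no; rewrite -leNgt.
  have -> : mean nu y = 1; last by case/andP: (F'01 y).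
  rewrite -nu1; apply: eq_bigr => B _; have [BS|/offS ->] := boolP (B \in S); last by rewrite mul0r.
  by have := no B BS; rewrite negbK => ->; rewrite mulr1.
have [L [Lg Ln Lc]] := exchange_step leafX j_inj om_ge0 tau_gt1 om_siblings om_par nubS nukS xy xS yS.
have [e1 e10 e1P] : exists2 e1, 0 < e1 & forall s, 0 < s <= e1 ->
    forall B : {set X}, B \in S -> s * (size L)%:R <= nu B.
  apply: small_eta => B; have [BS|BS] := boolP (B \in S); last by exists 1.
  exists (nu B / (size L).+1%:R); first by rewrite divr_gt0 // -inS.
  move=> s /andP[s0]; rewrite ler_pdivlMr // => le _; apply: le_trans le.
  by rewrite ler_pM2l // ler_nat.
pose e := Num.min e1 (Num.min (mean nu x - F' x) (F' y - mean nu y)).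
have e0 : 0 < e by rewrite !lt_min e10 !subr_gt0 Mx My.
have ex : e <= mean nu x - F' x by rewrite !ge_min lexx orbT.
have ey : e <= F' y - mean nu y by rewrite !ge_min lexx !orbT.
have eS B : B \in S -> e * (size L)%:R <= nu B by apply: e1P; rewrite e0 ge_min lexx.
(* The conditional law of the old set given the current one; probability moved away from a set is
   taken from its sources in these proportions. *)
pose rho A B := z A B / nu B.
have rho0 A B : 0 <= rho A B by rewrite divr_ge0.
have rho1 B : B \in S -> \sum_A rho A B = 1.
  by rewrite inS => B0; rewrite -mulr_suml divff // gt_eqF.
pose dlt A B := \sum_(m <- L) rho A m.1 * ((B == m.2)%:R - (B == m.1)%:R).
pose z' A B := z A B + e * dlt A B.
have sumd (P : {set X} -> R) (B0 : {set X}) : \sum_B (B == B0)%:R * P B = P B0.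
  rewrite (bigD1 B0) //= eqxx mul1r big1 ?addr0 // => B /negbTE ->.
  by rewrite mul0r.
have dltP A (P : {set X} -> R) : \sum_B dlt A B * P B = \sum_(m <- L) rho A m.1 * (P m.2 - P m.1).
  rewrite /dlt; under eq_bigr do rewrite mulr_suml.
  rewrite exchange_big; apply: eq_bigr => m _ /=.
  under eq_bigr do rewrite -mulrA mulrBl.
  by rewrite -mulr_sumr sumrB !sumd.
have dlt_sum B : \sum_A dlt A B = \sum_(m <- L) ((B == m.2)%:R - (B == m.1)%:R).
  rewrite /dlt exchange_big; apply: eq_big_seq => m mL /=.
  by rewrite -mulr_suml rho1 ?mul1r //; have [] := Lg m mL.
have z'0 A B : 0 <= z' A B.
  have lower : - ((size L)%:R * rho A B) <= dlt A B.
    have : forall m, m \in L -> - rho A B <= rho A m.1 * ((B == m.2)%:R - (B == m.1)%:R).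
      move=> m _; have := rho0 A m.1; have := rho0 A B.
      by case: eqVneq => [->|_]; case: eqVneq => [->|_] /=; lra.
    rewrite /dlt; elim: (L) => [|m L' IH] h; first by rewrite big_nil mul0r oppr0.
    rewrite big_cons /= -natr1 mulrDl mul1r opprD addrC; apply: lerD; first by apply: h; rewrite mem_head.
    by apply: IH => m' m'L; apply: h; rewrite inE m'L orbT.
  have [BS|BS] := boolP (B \in S).
    have h : e * (size L)%:R * rho A B <= z A B.
      have := ler_wpM2r (rho0 A B) (eS B BS); rewrite [nu B * _]mulrC divfK //.
      by rewrite gt_eqF // -inS.
    have := ler_wpM2l (ltW e0) lower; rewrite /z'; lra.
  have zAB : z A B = 0.
    apply/eqP; rewrite eq_le z_ge0 andbT -(offS B BS) /nu (bigD1 A) //= lerDl.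
    by apply: sumr_ge0.
  rewrite /z' zAB add0r mulr_ge0 ?(ltW e0) // /dlt big_seq; apply: sumr_ge0 => m mL.
  have mB : B != m.1 by apply: contraNneq BS => ->; have [] := Lg m mL.
  by rewrite (negbTE mB) subr0 mulr_ge0.
have sumz (P : {set X} -> R) A : \sum_B z' A B * P B = \sum_B z A B * P B + e * \sum_B dlt A B * P B.
  by rewrite mulr_sumr -big_split; apply: eq_bigr => B _; rewrite mulrDl mulrA.
have z'mu A : \sum_B z' A B = mu A.
  have := sumz (fun=> 1) A; rewrite dltP [X in _ = _ + e * X]big1 ?mulr0 ?addr0; last first.
    by move=> m _; rewrite subrr mulr0.
  by under eq_bigr do rewrite mulr1; under [X in _ = X -> _]eq_bigr do rewrite mulr1; rewrite z_mu.
pose nu' B := \sum_A z' A B.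
have nu'E B : nu' B = nu B + e * \sum_(m <- L) ((B == m.2)%:R - (B == m.1)%:R).
  by rewrite /nu' big_split /= -mulr_sumr dlt_sum.
have sumnu' (P : {set X} -> R) : \sum_B nu' B * P B = \sum_B nu B * P B + e * \sum_(m <- L) (P m.2 - P m.1).
  under eq_bigr do rewrite nu'E mulrDl.
  rewrite big_split /=; congr (_ + _); under eq_bigr do rewrite -mulrA.
  transitivity (e * \sum_B (\sum_(m <- L) ((B == m.2)%:R - (B == m.1)%:R)) * P B); first by rewrite mulr_sumr.
  congr (_ * _).
  rewrite (eq_bigr (fun B => \sum_(m <- L) ((B == m.2)%:R - (B == m.1)%:R) * P B)); last by move=> B _; rewrite mulr_suml.
  rewrite exchange_big; apply: eq_bigr => m _ /=; under eq_bigr do rewrite mulrBl.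
  by rewrite sumrB !sumd.
have M'E v : mean nu' v = mean nu v + e * ((v == y)%:R - (v == x)%:R).
  by rewrite /mean sumnu' -(Ln v).
have supp' B : B \in support nu' -> B \in S \/ exists2 m, m \in L & B = m.2.
  rewrite inE => B0; have [BS|BS] := boolP (B \in S); first by left.
  right; have [/hasP[m mL /eqP mB]|/hasPn no] := boolP (has (fun m => m.2 == B) L); first by exists m.
  move: B0; rewrite nu'E offS // add0r big_seq big1 ?mulr0 ?ltxx // => m mL.
  have mB : B != m.1 by apply: contraNneq BS => ->; have [] := Lg m mL.
  by have := no m mL; rewrite /= eq_sym => /negbTE ->; rewrite (negbTE mB) subrr.
have slk B u : B \in support nu' -> slack t j S x y u (N B u).
  by move=> /supp'[BS|[m mL ->]]; [exact: slack_self|have [] := Lg m mL].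
exists z'; split=> //.
- move=> B /supp'[/nukS//|[m mL ->]]; have [mS -> _] := Lg m mL; exact: nukS.
- by move=> A B u AS BS; apply: slack_width (slk A u AS) (slk B u BS).
split.
  have c1 : \sum_A \sum_B z' A B * set_cost t j om A B <=
      \sum_A \sum_B z A B * set_cost t j om A B + e * moves_cost t j om L.
    under eq_bigr do rewrite sumz dltP.
    rewrite big_split /= lerD2l -mulr_sumr ler_wpM2l ?(ltW e0) // exchange_big /= /moves_cost.
    rewrite big_seq [leRHS]big_seq; apply: ler_sum => m mL.
    have [mS _ _] := Lg m mL; rewrite -[leRHS]mul1r -(rho1 m.1 mS) mulr_suml; apply: ler_sum => A _.
    by rewrite ler_wpM2l // lerBlDl; exact: set_cost_triangle.
  have c2 : fraction_gap (mean nu') F' + e * dist x y <= fraction_gap (mean nu) F'.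
    rewrite /fraction_gap /tree_dist mulr_sumr -big_split; apply: ler_sum => u _ /=.
    rewrite mulrCA -mulrDr ler_wpM2l //.
    have insE : inside t j (mean nu') u = inside t j (mean nu) u +
        e * ((below t u (j y))%:R - (below t u (j x))%:R).
      rewrite /inside; under eq_bigr do rewrite M'E.
      rewrite big_split /= -mulr_sumr; congr (_ + _ * _); rewrite sumrB.
      have one w0 : \sum_(v | below t u (j v)) (v == w0)%:R = (below t u (j w0))%:R :> R.
        rewrite big_mkcond (bigD1 w0) //= eqxx big1 ?addr0; first by case: (below _ _ _).
        by move=> v /negbTE ->; case: ifP.
      by rewrite !one.
    rewrite insE; have [bx|bx] := boolP (below t u (j x)); have [bY|bY] := boolP (below t u (j y)) => /=.
    + by rewrite subrr !mulr0 !addr0.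
    + have le : mean nu x - F' x <= inside t j (mean nu) u - inside t j F' u.
        rewrite /inside -sumrB (bigD1 x) //= lerDl sumr_ge0 // => v /andP[uv _].
        by rewrite subr_ge0; exact: (ux u bx bY).
      by rewrite !ger0_norm; lra.
    + have le : inside t j (mean nu) u - inside t j F' u <= mean nu y - F' y.
        rewrite /inside -sumrB (bigD1 y) //= gerDl sumr_le0 // => v /andP[uv _].
        by rewrite subr_le0; exact: (uy u bY bx).
      by rewrite !ler0_norm; lra.
    + by rewrite subrr !mulr0 !addr0.
  have := ler_wpM2l K0 c2; have := ler_wpM2l (ltW e0) Lc; rewrite -/nu'.
  rewrite !mulrDr; move: c1; move: (2 * K) (dist x y) => K2 dd; lra.
rewrite -/nu' (bigD1 x) //= (bigD1 y) /=; last by rewrite eq_sym.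
rewrite [ltRHS](bigD1 x) //= [X in _ < _ + X](bigD1 y) /=; last by rewrite eq_sym.
rewrite (eq_bigr (fun v => `|mean nu v - F' v|)); last first.
  by move=> v /andP[/negbTE vx /negbTE vy]; rewrite M'E vx vy subrr mulr0 addr0.
rewrite !M'E !eqxx (negbTE xy) [y == x]eq_sym (negbTE xy) /=.
have h1 : 0 <= mean nu x - F' x by rewrite subr_ge0 ltW.
have h2 : mean nu y - F' y <= 0 by rewrite subr_le0 ltW.
rewrite (ger0_norm h1) (ler0_norm h2) ger0_norm; last by lra.
by rewrite ler0_norm; lra.
Qed.

End Improve.

(** Among the couplings whose cost plus [2 * K] times the remaining gap does not exceed the initial
    gap term, one whose mean is closest to [F'] is chosen. By [improve] its distance is 0. The
    diagonal coupling shows that there are candidates. *)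
Lemma transition F F' mu : balanced_law F mu -> (forall x, 0 <= F' x <= 1) -> \sum_x F' x = k%:R ->
  exists z : {set X} -> {set X} -> R, [/\ forall A B, 0 <= z A B, forall A, \sum_B z A B = mu A,
    balanced_law F' (fun B => \sum_A z A B) &
    \sum_A \sum_B z A B * set_cost t j om A B <= 2 * K * fraction_gap F F'].
Proof.
move=> [mu0 mu1 muF muk mub] F'01 F'k.
pose E := ({set X} * {set X})%type.
pose T : topologicalType := prod_topology (fun _ : E => (R : topologicalType)).
pose bad (e e' : E) := [exists u, (N e'.2 u).+1 < N e.2 u]%N.
pose J (f : T) : R := \sum_(e : E) set_cost t j om e.1 e.2 * f e +
  2 * K * \sum_u om u * `|\sum_(e : E) (N e.2 u)%:R * f e - inside t j F' u|.
pose J0 := 2 * K * fraction_gap F F'.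
(* Conditions on the support are not visibly closed; here they become the vanishing of continuous
   sums, with a product [f e * f e'] for each pair of incompatible sets. *)
pose viol (f : T) : R := \sum_A `|\sum_B f (A, B) - mu A| + (\sum_(e : E) (#|e.2| != k)%:R * f e +
  \sum_(e : E) \sum_(e' : E) (bad e e')%:R * (f e * f e')).
pose g (b : bool) (f : T) : R := if b then 0 - viol f else J0 - J f.
pose obj (f : T) : R := \sum_x `|\sum_(e : E) (x \in e.2)%:R * f e - F' x|.
have coord e : continuous (fun f : T => f e) by exact: coordinate_continuous.
have cg b : continuous (g b).
  case: b; rewrite /g; apply: sub_continuous; try exact: cst_continuous'.
    apply: add_continuous'; first apply: sum_continuous => A.
      apply: norm_continuous'; apply: sub_continuous; last exact: cst_continuous'.
      by apply: sum_continuous => B; exact: coord.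
    apply: add_continuous'; apply: sum_continuous => e; first by apply: mulc_continuous; exact: coord.
    apply: sum_continuous => e'; apply: mulc_continuous; apply: mul_continuous; exact: coord.
  apply: add_continuous'; first by apply: sum_continuous => e; apply: mulc_continuous; exact: coord.
  apply: mulc_continuous; apply: sum_continuous => u; apply: mulc_continuous.
  apply: norm_continuous'; apply: sub_continuous; last exact: cst_continuous'.
  by apply: sum_continuous => e; apply: mulc_continuous; exact: coord.
have cobj : continuous obj.
  apply: sum_continuous => x; apply: norm_continuous'; apply: sub_continuous; last exact: cst_continuous'.
  by apply: sum_continuous => e; apply: mulc_continuous; exact: coord.
have JE (z : {set X} -> {set X} -> R) : J (fun e => z e.1 e.2) =
    \sum_A \sum_B z A B * set_cost t j om A B + 2 * K * fraction_gap (mean (fun B => \sum_A z A B)) F'.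
  rewrite /J /fraction_gap; congr (_ + _ * _).
    by rewrite pair_bigA; apply: eq_bigr => e _; rewrite mulrC.
  apply: eq_bigr => u _; congr (_ * `|_ - _|); rewrite inside_mean.
  rewrite (eq_bigr (fun B => \sum_A z A B * (N B u)%:R)); last by move=> B _; rewrite mulr_suml.
  by rewrite exchange_big pair_bigA; apply: eq_bigr => e _; rewrite mulrC.
have objE (z : {set X} -> {set X} -> R) : obj (fun e => z e.1 e.2) =
    \sum_x `|mean (fun B => \sum_A z A B) x - F' x|.
  apply: eq_bigr => x _; congr (`|_ - _|); rewrite /mean.
  rewrite [RHS](eq_bigr (fun B => \sum_A z A B * (x \in B)%:R)); last by move=> B _; rewrite mulr_suml.
  by rewrite exchange_big pair_bigA; apply: eq_bigr => e _; rewrite mulrC.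
have muT A : mu A <= 1 by rewrite -mu1 (bigD1 A) //= lerDl sumr_ge0.
have inbox (z : {set X} -> {set X} -> R) : (forall A B, 0 <= z A B) -> (forall A, \sum_B z A B = mu A) ->
    (forall B, B \in support (fun B => \sum_A z A B) -> #|B| = k) ->
    balanced t j (support (fun B => \sum_A z A B)) -> J (fun e => z e.1 e.2) <= J0 ->
    (forall e : E, 0 <= z e.1 e.2 <= 1) /\ forall b, 0 <= g b (fun e => z e.1 e.2).
  move=> z0 zmu zk zb zJ.
  have zsupp A B : z A B != 0 -> B \in support (fun B => \sum_A z A B).
    move=> zAB; rewrite inE (bigD1 A) //=; apply: ltr_wpDr; first exact: sumr_ge0.
    by rewrite lt_def zAB z0.
  split=> [[A B]|[]] /=.
  - by rewrite z0 (le_trans _ (muT A)) // -zmu (bigD1 B) //= lerDl sumr_ge0.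
  - rewrite sub0r oppr_ge0 /viol !big1 ?addr0 // => [[A B] _|[A B] _|A _].
    + apply: big1 => -[A' B'] _ /=; have [->|/zsupp BS] := eqVneq (z A B) 0; first by rewrite mul0r mulr0.
      have [->|/zsupp B'S] := eqVneq (z A' B') 0; first by rewrite !mulr0.
      rewrite (_ : bad _ _ = false) ?mul0r //; apply/negbTE/existsPn => u.
      by rewrite -leqNgt; exact: zb.
    + have [->|/zsupp/zk /= ->] := eqVneq (z A B) 0; first by rewrite mulr0.
      by rewrite eqxx mul0r.
    + by rewrite zmu subrr normr0.
  - by rewrite subr_ge0.
pose z0 (A B : {set X}) : R := (B == A)%:R * mu A.
have z0nu : (fun B => \sum_A z0 A B) = mu.
  apply: funext => B; rewrite /z0 (bigD1 B) //= eqxx mul1r big1 ?addr0 // => A.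
  by rewrite eq_sym => /negbTE ->; rewrite mul0r.
have z00 A B : 0 <= z0 A B by rewrite mulr_ge0.
have z0mu A : \sum_B z0 A B = mu A.
  rewrite /z0 (bigD1 A) //= eqxx mul1r big1 ?addr0 // => B /negbTE ->.
  by rewrite mul0r.
have meanF : mean mu = F by apply: funext.
have [|f [f01 fg] fmin] := box_min (B := 1) cg cobj.
  exists (fun e => z0 e.1 e.2); apply: inbox => //; rewrite ?z0nu // JE z0nu meanF -/J0.
  rewrite big1 ?add0r // => A _; apply: big1 => B _; rewrite /z0.
  by case: eqVneq => [->|_]; rewrite ?set_costxx ?mulr0 // !mul0r.
pose z A B := f (A, B).
have fE : f = fun e => z e.1 e.2 by apply: funext => -[A B].
have zz0 A B : 0 <= z A B by case/andP: (f01 (A, B)).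
have := fg true; have := fg false; rewrite /= subr_ge0 sub0r oppr_ge0 => fJ fv.
have v1 : 0 <= \sum_A `|\sum_B f (A, B) - mu A| by apply: sumr_ge0.
have f0 e : 0 <= f e by case/andP: (f01 e).
have v2 : 0 <= \sum_(e : E) (#|e.2| != k)%:R * f e by apply: sumr_ge0 => e _; rewrite mulr_ge0.
have v3' (e e' : E) : 0 <= (bad e e')%:R * (f e * f e') by rewrite !mulr_ge0.
have v3 : 0 <= \sum_(e : E) \sum_(e' : E) (bad e e')%:R * (f e * f e').
  by do 2!(apply: sumr_ge0 => ? _).
have zmu A : \sum_B z A B = mu A.
  have h : \sum_A `|\sum_B f (A, B) - mu A| = 0.
    by apply/eqP; rewrite eq_le v1 andbT; move: fv; rewrite /viol; lra.
  by have := sum0_each (fun A => normr_ge0 _) h A => /eqP; rewrite normr_eq0 subr_eq0 => /eqP.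
have pos B : B \in support (fun B => \sum_A z A B) -> exists A, 0 < z A B.
  rewrite inE => B0; apply/existsP; apply: contraTT B0 => /existsPn no; rewrite -leNgt.
  by apply: sumr_le0 => A _; rewrite leNgt.
have zk B : B \in support (fun B => \sum_A z A B) -> #|B| = k.
  move=> /pos[A zAB]; have h : \sum_(e : E) (#|e.2| != k)%:R * f e = 0.
    by apply/eqP; rewrite eq_le v2 andbT; move: fv; rewrite /viol; lra.
  have := sum0_each (fun e : E => mulr_ge0 (ler0n R (#|e.2| != k)) (f0 e)) h (A, B) => /=.
  by case: eqVneq => // _ /eqP; rewrite mul1r gt_eqF.
have zb : balanced t j (support (fun B => \sum_A z A B)).
  move=> B B' u /pos[A zAB] /pos[A' zAB']; rewrite leqNgt; apply/negP => lt.
  have h : \sum_(e : E) \sum_(e' : E) (bad e e')%:R * (f e * f e') = 0.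
    by apply/eqP; rewrite eq_le v3 andbT; move: fv; rewrite /viol; lra.
  have h1 := sum0_each (fun e : E => sumr_ge0 _ (fun e' _ => v3' e e')) h (A, B).
  have := sum0_each (fun e' : E => v3' (A, B) e') h1 (A', B').
  rewrite (_ : bad _ _ = true); last by apply/existsP; exists u.
  by move/eqP; rewrite mul1r mulf_eq0 !gt_eqF.
exists z; split=> //.
  split=> //; first by move=> B; apply: sumr_ge0.
    by rewrite exchange_big /= -mu1; apply: eq_bigr => A _; exact: zmu.
  move=> x; apply/eqP; apply: contraT => ne.
  have gap : exists x, mean (fun B => \sum_A z A B) x != F' x by exists x.
  have [z' [z'0 z'mu z'k z'b [z'J z'o]]] := improve zz0 zmu mu1 zk zb F'01 F'k gap.
  have zJ' : J (fun e => z' e.1 e.2) <= J0 by rewrite JE; apply: le_trans z'J _; rewrite -JE -fE.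
  by have := fmin _ (inbox z' z'0 z'mu z'k z'b zJ'); rewrite fE !objE leNgt z'o.
move: fJ; rewrite fE JE; apply: le_trans; rewrite lerDl mulr_ge0 //.
  by rewrite mulr_ge0 // divr_ge0 ?subr_ge0 ?ltW // (lt_trans ltr01).
by apply: sumr_ge0 => u _; rewrite mulr_ge0.
Qed.

End Coupling.

(** [m] may drop by more than one, so the depth is recomputed as the number of vertices reachable
    through [par0]. *)
Lemma tree_of_parent (V : finType) (r0 : V) (par0 : V -> V) (m : V -> nat) : par0 r0 = r0 ->
  (forall v, v != r0 -> (m (par0 v) < m v)%N) ->
  exists t : rooted_tree V, root t = r0 /\ parent t = par0.
Proof.
move=> pr pm; pose dep v := #|[set u | fconnect par0 v u]|.
have fE v u : fconnect par0 v u = (v == u) || fconnect par0 (par0 v) u.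
  apply/idP/predU1P => [cvu|[->|]]; last 2 first.
  - exact: connect0.
  - exact: connect_trans (fconnect1 _ _).
  have := iter_findex cvu; case: findex => [/= ->|n]; first by left.
  by rewrite iterSr => <-; right; exact: fconnect_iter.
have mle v u : fconnect par0 v u -> (m u <= m v)%N.
  move=> cvu; rewrite -(iter_findex cvu); elim: (findex _ _ _) => //= n IH.
  apply: leq_trans IH; have [->|vr] := eqVneq (iter n par0 v) r0; first by rewrite pr.
  exact: ltnW (pm _ vr).
have depP v : v != r0 -> dep v = (dep (par0 v)).+1.
  move=> vr; rewrite /dep (_ : [set u | _] = v |: [set u | fconnect par0 (par0 v) u]); last first.
    by apply/setP => u; rewrite !inE fE eq_sym.
  rewrite cardsU1 inE (_ : fconnect _ _ _ = false) //; apply/negbTE/negP => /mle.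
  by rewrite leqNgt pm.
by exists (RootedTree pr depP).
Qed.

Lemma expr_unbounded (R : realType) (tau x : R) : 1 < tau -> exists n, x < tau ^+ n.
Proof.
move=> t1; have bern n : 1 + n%:R * (tau - 1) <= tau ^+ n.
  elim: n => [|n IH]; first by rewrite mul0r addr0 expr0.
  rewrite exprS -natr1; have n0 : 0 <= n%:R :> R by [].
  have := ler_wpM2l (ltW (lt_trans ltr01 t1)) IH; have := mulr_ge0 n0 (sqr_ge0 (tau - 1)).
  by rewrite expr2; move: (n%:R) (tau ^+ n) => a b; lra.
have s0 : 0 < tau - 1 by rewrite subr_gt0.
have y0 : 0 <= `|x| / (tau - 1) by rewrite divr_ge0 // ltW.
exists (Num.bound (`|x| / (tau - 1))); apply: lt_le_trans (bern _).
have := archi_boundP y0; rewrite ltr_pdivrMr // => h.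
by have := ler_norm x; lra.
Qed.

(** * Embedding an HST in a tree whose siblings have equal weights *)

Section ChainTree.
Context {R : realType} {V X : finType} (t : rooted_tree V) (j : X -> V).
Variables (w : V -> R) (tau : R).
Notation r := (root t).
Notation par := (parent t).
Notation K := (tau / (tau - 1)).

Hypothesis leafX : forall x c, ~~ child t (j x) c.
Hypothesis j_inj : injective j.
Hypothesis j_root : forall x, j x != r.
Hypothesis w_ge0 : forall u, 0 <= w u.
Hypothesis tau_gt1 : 1 < tau.
Hypothesis w_geo : forall v, v != r -> par v != r -> w (par v) = tau * w v.

Let tau0 : 0 < tau. Proof. exact: lt_trans ltr01 _. Qed.

(* The weights of the children of the root are unrelated; they are sorted into
   classes of geometrically decreasing weights. *)
Lemma weight_classes : exists (n : nat) (cl : V -> nat) (kap : nat -> R),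
  [/\ forall v, (cl v <= n)%N, forall v, w v <= kap (cl v) <= tau * w v,
      forall i, 0 <= kap i & forall i, tau * kap i.+1 <= kap i].
Proof.
pose W := 1 + \sum_v w v; have W0 : 0 < W by rewrite ltr_pwDl // sumr_ge0.
have powE i : W / tau ^+ i = tau * (W / tau ^+ i.+1).
  by rewrite exprS; field; rewrite !gt_eqF // exprn_gt0.
have wW v : w v <= W.
  by rewrite /W (bigD1 v) //=; have : 0 <= \sum_(i | i != v) w i by [apply: sumr_ge0]; lra.
have /choice[cl0 cl0P] : forall v, exists i, 0 < w v -> W / tau ^+ i.+1 < w v <= W / tau ^+ i.
  move=> v; have [wv|wv] := ltP 0 (w v); last by exists 0%N.
  have [n nP] := expr_unbounded (W / w v) tau_gt1.
  have tn i : 0 < tau ^+ i by rewrite exprn_gt0.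
  have exP : exists i, W / tau ^+ i < w v.
    by exists n; rewrite ltr_pdivrMr // mulrC -ltr_pdivrMr.
  have [[|i] iP imin] := ex_minnP exP.
    by move: iP; rewrite expr0 divr1 ltNge wW.
  exists i => _; rewrite iP leNgt /=; apply/negP => /imin; by rewrite ltnn.
pose n := (\max_v cl0 v).+1.
(* Edges of length 0 form a last class, with [kap] equal to 0. *)
pose cl v := if w v == 0 then n else cl0 v.
have cl0n v : (cl0 v < n)%N by rewrite ltnS; exact: leq_bigmax.
exists n, cl, (fun i => if (i < n)%N then W / tau ^+ i else 0); split.
- by move=> v; rewrite /cl; case: ifP => // _; exact: ltnW.
- move=> v; rewrite /cl; have [->|wv] := eqVneq (w v) 0; first by rewrite ltnn mulr0 lexx.
  have wv0 : 0 < w v by rewrite lt_def wv w_ge0.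
  rewrite cl0n; have /andP[lt ->] := cl0P v wv0; rewrite /=.
  by rewrite powE ler_wpM2l ?(ltW tau0) // ltW.
- by move=> i; case: ifP => // _; rewrite divr_ge0 ?exprn_ge0 // ltW.
- move=> i; case: ifP => [lt|_].
    by rewrite (ltnW lt) (powE i).
  by rewrite mulr0; case: ifP => // _; rewrite divr_ge0 ?exprn_ge0 // ltW.
Qed.

(** The root is replaced by a path of vertices [inr i], and a child [v] of the root is hung at
    [inr (cl v)] with weight [kap (cl v)], the weight of the next path edge. Two children in
    different classes are joined along the path; the part from the class of the heavier one on is a
    geometric series bounded by [K * tau] times its weight. *)
Lemma chain_tree : exists (V' : finType) (t' : rooted_tree V') (j' : X -> V') (om : V' -> R),
  [/\ (forall x c, ~~ child t' (j' x) c) /\ injective j', forall u, 0 <= om u,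
    forall p c c', child t' p c -> child t' p c' -> om c = om c',
    forall v, v != root t' -> parent t' v != root t' -> tau * om v <= om (parent t' v) &
    forall x y, tree_dist t j w x y <= tree_dist t' j' om x y <= (tau + K * tau) * tree_dist t j w x y].
Proof.
have [n [cl [kap [cln clP kap0 kapS]]]] := weight_classes.
pose V' := (V + 'I_n.+1)%type; pose top : V' := inr ord0.
pose par' (u : V') : V' := match u with
  | inl v => if v == r then top else if par v == r then inr (inord (cl v)) else inl (par v)
  | inr i => inr (inord i.-1) end.
pose m (u : V') : nat := match u with inl v => (n.+1 + depth t v)%N | inr i => nat_of_ord i end.
pose om (u : V') : R := match u with
  | inl v => if v == r then kap 0%N else if par v == r then kap (cl v) else w v
  | inr i => kap i.-1 end.
have [t' [rt pt]] : exists t' : rooted_tree V', root t' = top /\ parent t' = par'.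
  apply: (tree_of_parent (m := m)).
    by rewrite /par' /top /=; congr inr; apply: val_inj; rewrite /= inordK.
  move=> [v|i]; rewrite /par' /m.
    have [->//|vr] := eqVneq v r; have [_|pr] := eqVneq (par v) r.
      by move=> _; rewrite inordK ltnS // (leq_trans (cln v)) // leq_addr.
    by rewrite ltn_add2l (depth_parent vr).
  case: i => -[|i] ilt ine; first by case/eqP: ine; congr inr; exact: val_inj.
  by rewrite inordK //= ltnW.
pose j' x : V' := inl (j x).
have ch p c : child t' p c = (c != top) && (par' c == p) by rewrite /child rt pt.
have bE u v : below t' u v = (v == u) || ((v != top) && below t' u (par' v)) by rewrite belowE rt pt.
have toptop : par' top = top by rewrite -pt -rt parent_root.
have b_top u : below t' u top = (top == u) by rewrite bE eqxx orbF.
have b_inr i k : (k < n.+1)%N -> below t' (inr i) (inr (inord k)) = (i <= k)%N.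
  elim: k => [|k IH] kn.
    have -> : inr (inord 0) = top :> V' by congr inr; apply: val_inj; rewrite /= inordK.
    by rewrite b_top leqn0 /top; apply/eqP/eqP => [[<-]//|i0]; congr inr; apply: val_inj.
  rewrite bE /= inordK //= IH ?(ltnW kn) // [(i <= k.+1)%N]leq_eqVlt ltnS.
  have -> : (inr (inord k.+1) == inr i :> V') = (i == k.+1 :> nat).
    by apply/eqP/eqP => [[<-]|iE]; [rewrite inordK|congr inr; apply: val_inj; rewrite /= inordK].
  have -> // : inr (inord k.+1) != top :> V'.
  by apply/eqP => -[] /(congr1 val); rewrite /= inordK.
have b_no u k : (k < n.+1)%N -> below t' (inl u) (inr (inord k)) = false.
  elim: k => [|k IH] kn.
    have -> : inr (inord 0) = top :> V' by congr inr; apply: val_inj; rewrite /= inordK.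
    by rewrite b_top.
  by rewrite bE /= inordK //= IH ?(ltnW kn) // andbF.
have cl1 v : (cl v < n.+1)%N by rewrite ltnS.
have b_inl u v : v != r -> below t' (inl u) (inl v) = if u == r then false else below t u v.
  elim/(below_ind (t := t)): v => [|v vr IH _]; first by rewrite eqxx.
  rewrite bE /= (negbTE vr) (belowE t) vr /=.
  have -> : (inl v == inl u :> V') = (v == u) by apply/eqP/eqP => [[]|->].
  have [pr|pr] := eqVneq (par v) r.
    rewrite b_no // orbF; have [ur|ur] := eqVneq u r; first by rewrite ur (negbTE vr).
    rewrite pr (_ : below t u r = false) ?orbF //; apply/negbTE; apply: contra ur => /below_of_root ->.
    by rewrite eqxx.
  by rewrite IH //; have [->|//] := eqVneq u r; rewrite (negbTE vr).
have b_cl v : v != r -> exists a, [/\ child t r a, below t a v & forall i, below t' (inr i) (inl v) = (i <= cl a)%N].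
  elim/(below_ind (t := t)): v => [|v vr IH _]; first by rewrite eqxx.
  have [pr|pr] := eqVneq (par v) r.
    exists v; rewrite below_refl /child vr pr eqxx; split=> // i.
    by rewrite bE /= (negbTE vr) pr eqxx b_inr.
  have [a [ra av aP]] := IH pr; exists a; split=> //; first exact: below_trans (below_par _ _).
  by move=> i; rewrite bE /= (negbTE vr) (negbTE pr) aP.
have om0 u : 0 <= om u by case: u => [v|i] /=; [do 2!case: ifP => // _|].
have kapsum a l : (a <= l)%N -> \sum_(i < l.+1) (a < i)%N%:R * kap i.-1 + K * kap l <= K * kap a.
  have t1 : 0 < tau - 1 by rewrite subr_gt0.
  elim: l => [|l IH].
    by rewrite leqn0 => /eqP ->; rewrite big_ord_recl big_ord0 /= mul0r addr0 add0r.
  rewrite leq_eqVlt => /predU1P[->|].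
    rewrite big1 ?add0r // => i _; rewrite ltnNge -ltnS ltn_ord mul0r //.
  move=> al1; have al : (a <= l)%N by rewrite -ltnS.
  rewrite big_ord_recr /= al1 mul1r; have := IH al.
  have h : K * kap l.+1 <= kap l / (tau - 1).
    by rewrite mulrAC ler_pM2r ?invr_gt0.
  have -> : K * kap l = kap l + kap l / (tau - 1) by field; rewrite gt_eqF.
  lra.
exists V', t', j', om; split=> //.
- split=> [x c|x x' [/j_inj//]]; rewrite ch; case: c => [v|i]; last by rewrite /par' andbF.
  apply/negP => /andP[_ /eqP]; rewrite /par'; case: eqVneq => // vr; case: eqVneq => // pr [vx].
  by have := leafX x v; rewrite /child vr vx eqxx.
- have main p c : child t' p c -> om c = match p with inl u => w u / tau | inr i => kap i end.
    rewrite ch; case: c => [v|i] /andP[ct /eqP <-] /=.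
      case: eqVneq => [//|vr]; case: eqVneq => [pr|pr]; first by rewrite inordK.
      by rewrite w_geo // mulrAC divff ?mul1r // gt_eqF.
    by rewrite inordK // (leq_ltn_trans (leq_pred _)).
  by move=> p c c' /main -> /main ->.
- rewrite rt pt => -[v|i] /=.
    have [vE|vr] := eqVneq v r; first by rewrite /= ?eqxx.
    have [pr|pr] := eqVneq (par v) r => _ ct.
      rewrite /= inordK //; case: (cl v) ct (cln v) => [|c] ct cn /=; last exact: kapS.
      by case/eqP: ct; congr inr; apply: val_inj; rewrite /= inordK.
    rewrite /= (negbTE pr) -w_geo //; have [_|_] := eqVneq (par (par v)) r => //.
    by case/andP: (clP (par v)).
  case: i => -[|[|i]] ilt ct /=.
  + by case/eqP: ct; congr inr; exact: val_inj.
  + by move=> ct2; case/eqP: ct2; congr inr; apply: val_inj; rewrite /= inordK.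
  + by move=> _; rewrite inordK ?(ltnW ilt) //=; exact: kapS.
move=> x y; rewrite [tree_dist t' _ _ _ _]/tree_dist big_sumType /=.
have inl_part u : u != r -> w u <= om (inl u) <= tau * w u.
  move=> ur; rewrite /= (negbTE ur); case: eqVneq => [_|_]; first exact: clP.
  by rewrite lexx /= ler_peMl // ltW.
have sep u : (below t' (inl u) (j' x) != below t' (inl u) (j' y)) =
    (u != r) && (below t u (j x) != below t u (j y)).
  rewrite /j' (b_inl u _ (j_root x)) (b_inl u _ (j_root y)); by case: (u == r).
apply/andP; split.
  rewrite -[leLHS]addr0; apply: lerD; last by apply: sumr_ge0 => i _; rewrite mulr_ge0.
  apply: ler_sum => u _; rewrite sep; have /= := inl_part u.
  have [->|ur] := eqVneq u r; first by rewrite !below_root eqxx /= !mulr0.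
  by move=> /(_ isT) /andP[h _]; apply: ler_wpM2r.
rewrite mulrDl; apply: lerD.
  rewrite /tree_dist mulr_sumr; apply: ler_sum => u _; rewrite [leRHS]mulrA sep; have /= := inl_part u.
  have [->|ur] := eqVneq u r; first by rewrite /= mulr0 mulr_ge0 // mulr_ge0 // ltW.
  by move=> /(_ isT) /andP[_ h]; apply: ler_wpM2r.
have [a [ra ax aP]] := b_cl (j x) (j_root x); have [b [rb bY bP]] := b_cl (j y) (j_root y).
have d0 : 0 <= K * tau * tree_dist t j w x y.
  rewrite !mulr_ge0 ?tree_dist_ge0 //; do ?[exact: ltW]; by rewrite invr_ge0 subr_ge0 ltW.
have half c c' z z' : child t r c -> child t r c' -> below t c (j z) -> below t c' (j z') -> (cl c < cl c')%N ->
    \sum_(i < n.+1) (cl c < i)%N%:R * kap i.-1 <= K * tau * tree_dist t j w z z'.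
  move=> rc rc' cz cz' lt; have := kapsum (cl c) n (cln c).
  have K0 : 0 <= K by apply: divr_ge0; [exact: ltW|rewrite subr_ge0; exact: ltW].
  have : 0 <= K * kap n by rewrite mulr_ge0.
  have : K * kap (cl c) <= K * tau * tree_dist t j w z z'.
    rewrite -[leRHS]mulrA; apply: ler_wpM2l => //; have /andP[_ le] := clP c; apply: le_trans le _.
    rewrite ler_wpM2l ?(ltW tau0) // /tree_dist (bigD1 c) //= cz.
    have -> : below t c (j z') = false.
      by apply/negbTE/negP => cz2; move: lt; rewrite (child_unique rc rc' cz2 cz') ltnn.
    by rewrite /= mulr1 lerDl; apply: sumr_ge0 => u _; rewrite mulr_ge0.
  lra.
have [lt|gt|eq] := ltngtP (cl a) (cl b).
- apply: le_trans (half a b x y ra rb ax bY lt); apply: ler_sum => i _; rewrite aP bP mulrC ler_wpM2r // ler_nat.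
  by have := lt; case: (leqP i (cl a)) => h1; case: (leqP i (cl b)) => h2 //=; lia.
- rewrite tree_distC; apply: le_trans (half b a y x rb ra bY ax gt); apply: ler_sum => i _; rewrite aP bP mulrC ler_wpM2r // ler_nat.
  by have := gt; case: (leqP i (cl a)) => h1; case: (leqP i (cl b)) => h2 //=; lia.
- by rewrite big1 // => i _; rewrite aP bP eq eqxx mulr0.
Qed.

End ChainTree.

(** * Random choices on the unit interval *)

Local Open Scope classical_set_scope.

Section FiniteValued.
Context {R : realType} (dO : measure_display) (Om : measurableType dO) (P : probability Om R).

Definition prob (E : set Om) : R := fine (P E).

Lemma probE E : measurable E -> P E = (prob E)%:E.
Proof. by move=> mE; rewrite fineK // fin_num_measure. Qed.

Lemma prob_ge0 E : 0 <= prob E.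
Proof. by rewrite fine_ge0. Qed.

Lemma probU A B : measurable A -> measurable B -> A `&` B = set0 -> prob (A `|` B) = prob A + prob B.
Proof.
move=> mA mB AB; rewrite /prob measureU // fineD //; exact: fin_num_measure.
Qed.

Lemma prob0 : prob set0 = 0.
Proof. by rewrite /prob measure0. Qed.

Lemma prob_setT : prob setT = 1.
Proof. by rewrite /prob probability_setT. Qed.

Variable I : finType.

Lemma expectation_finite (D : Om -> I) (f : I -> R) : (forall i, 0 <= f i) ->
  (forall i, measurable [set w | D w = i]) ->
  measurable_fun setT (fun w => f (D w)) /\
  (\int[P]_w (f (D w))%:E)%E = (\sum_i f i * prob [set w | D w = i])%:E.
Proof.
move=> f0 mD; pose E i := [set w | D w = i].
have fE w : f (D w) = \sum_i f i * \1_(E i) w.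
  rewrite (bigD1 (D w)) //= indicE mem_set // mulr1 big1 ?addr0 // => i iD.
  by rewrite indicE memNset ?mulr0 //= => /esym/eqP; rewrite (negbTE iD).
have mf : measurable_fun setT (fun w => f (D w)).
  rewrite (_ : (fun w => f (D w)) = fun w => \sum_i f i * \1_(E i) w); last exact: funext.
  apply: measurable_sum => i; apply: measurable_funM; first exact: measurable_cst.
  by apply: measurable_indic; exact: mD.
split=> //.
have -> : (\int[P]_w (f (D w))%:E)%E = (\int[P]_w (\sum_i ((f i)%:E * (\1_(E i) w)%:E)))%E.
  apply: eq_integral => w _; rewrite fE -sumEFin.
  by apply: eq_bigr => i _; rewrite EFinM.
have m1 i : measurable_fun setT (fun w => (\1_(E i) w)%:E : \bar R).
  by apply/measurable_EFinP; apply: measurable_indic; exact: mD.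
rewrite ge0_integral_sum //.
- rewrite -sumEFin; apply: eq_bigr => i _; rewrite ge0_integralZl //.
    have mEi : measurable (E i) by exact: mD.
    rewrite integral_indic // setIT EFinM; congr (_ * _)%E; exact: probE.
  by rewrite lee_fin.
- by move=> i; apply: emeasurable_funM => //; exact: measurable_cst.
- by move=> i w _; rewrite mule_ge0 // lee_fin.
Qed.

End FiniteValued.

Section Splitting.
Context {R : realType} (dO : measure_display) (Om : measurableType dO) (P : probability Om R).
Notation prob := (prob P).

(** The defining property of an atomless probability, in Sierpinski's form: events can be split in
    any proportion. *)
Definition divisible := forall E c, measurable E -> 0 <= c <= prob E ->
  exists E1, [/\ measurable E1, E1 `<=` E & prob E1 = c].

Hypothesis divP : divisible.

Lemma split_set (I : finType) (p : I -> R) (E : set Om) (s : seq I) : measurable E -> uniq s -> (0 < size s)%N ->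
  (forall i, 0 <= p i) -> \sum_(i <- s) p i = prob E ->
  exists f : Om -> I, (forall w, f w \in s) /\
    forall i, measurable (E `&` [set w | f w = i]) /\ prob (E `&` [set w | f w = i]) = (i \in s)%:R * p i.
Proof.
move=> + + + p0; elim: s E => // i [|i' s] IH E mE us _ sE.
  exists (fun=> i); split=> [w|i2]; first exact: mem_head.
  rewrite inE; have [->|ne] := eqVneq i2 i.
    have -> : E `&` [set w | i = i] = E by apply/seteqP; split => w /=; [case|].
    by split=> //; rewrite mul1r -sE big_seq1.
  have -> : E `&` [set w | i = i2] = set0.
    by apply/seteqP; split => w //= [_ iE]; rewrite iE eqxx in ne.
  by split=> //; rewrite prob0 mul0r.
have [E1 [mE1 sub pE1]] : exists E1, [/\ measurable E1, E1 `<=` E & prob E1 = p i].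
  by apply: divP => //; rewrite p0 -sE big_cons lerDl sumr_ge0.
have mE2 : measurable (E `\` E1) by exact: measurableD.
have pE : prob E = prob E1 + prob (E `\` E1).
  rewrite -probU //; first by congr prob; rewrite setDUK.
  by apply/seteqP; split => w //= [E1w [_]].
have [||f [fs fP]] := IH (E `\` E1) mE2 _ isT.
  by case/andP: us.
  by move: pE; rewrite -sE big_cons pE1; lra.
exists (fun w => if w \in E1 then i else f w); split.
  by move=> w; rewrite inE; case: ifP => _; rewrite ?eqxx // fs orbT.
move=> i2; have [mf pf] := fP i2.
have -> : E `&` [set w | (if w \in E1 then i else f w) = i2] =
    (if i2 == i then E1 else set0) `|` ((E `\` E1) `&` [set w | f w = i2]).
  apply/seteqP; split => w /=.
    move=> [Ew]; case: ifPn => [/set_mem E1w <-|/negP nE1 fw]; first by rewrite eqxx; left.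
    by right; split=> //; split=> // E1w; apply: nE1; exact: mem_set.
  move=> [|[[Ew nE1] fw]]; last by split=> //; rewrite memNset.
  by case: eqVneq => // -> E1w; split; [exact: sub|rewrite mem_set].
have mif : measurable (if i2 == i then E1 else set0) by case: ifP.
split; first exact: measurableU.
rewrite probU //; last first.
  by apply/seteqP; split=> w //= [] ; case: ifP => // _ E1w [[_ /(_ E1w)]].
rewrite pf; have [->|ne] := eqVneq i2 i.
  by have /andP[/negbTE -> _] := us; rewrite mem_head mul0r addr0 mul1r.
by rewrite prob0 add0r [in RHS]inE (negbTE ne).
Qed.

(* Outcomes of probability zero are avoided on the whole sample space, not only
   almost surely. *)
Lemma realize_coupling (I : finType) (D : Om -> I) (z : I -> I -> R) :
  (forall i, measurable [set w | D w = i]) -> (forall i i', 0 <= z i i') ->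
  (forall i, prob [set w | D w = i] = \sum_i' z i i') -> (forall w, 0 < prob [set w' | D w' = D w]) ->
  exists D' : Om -> I, (forall w, 0 < z (D w) (D' w)) /\
    forall i i', measurable [set w | (D w, D' w) = (i, i')] /\ prob [set w | (D w, D' w) = (i, i')] = z i i'.
Proof.
move=> mD z0 zD Dpos.
pose s i := [seq i' <- enum I | (0 < z i i')%R].
have zs i i' : (i' \in s i) = (0 < z i i')%R by rewrite mem_filter mem_enum andbT.
have sumS i : \sum_(i' <- s i) z i i' = \sum_i' z i i'.
  rewrite big_filter big_enum_cond /= [RHS](bigID (fun i' => 0 < z i i')%R) /=.
  rewrite [X in _ = _ + X]big1 ?addr0 // => i' ; rewrite -leNgt => le.
  by apply/eqP; rewrite eq_le le z0.
have /choice[f fP] : forall i, exists f : Om -> I, (exists w, D w = i) ->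
    (forall w, f w \in s i) /\ forall i', measurable ([set w | D w = i] `&` [set w | f w = i']) /\
      prob ([set w | D w = i] `&` [set w | f w = i']) = z i i'.
  move=> i; have [[w wi]|no] := pselect (exists w, D w = i); last by exists (fun=> i) => /no.
  have [|||f [fs fP]] := @split_set I (z i) [set w | D w = i] (s i) (mD i) _ _ (z0 i).
  - by rewrite filter_uniq // enum_uniq.
  - rewrite lt0n; apply/negP => /eqP/size0nil s0; have := Dpos w.
    by rewrite wi zD -sumS s0 big_nil ltxx.
  - by rewrite sumS zD.
  exists f => _; split=> // i'; have [m1 p1] := fP i'; split=> //; rewrite p1 zs.
  case: ltP => [_|le]; first by rewrite mul1r.
  by rewrite mul0r; apply/eqP; rewrite eq_le le z0.
exists (fun w => f (D w) w); split.
  by move=> w; rewrite -zs; apply: (fP (D w) _).1; exists w.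
move=> i i'; have E : [set w | (D w, f (D w) w) = (i, i')] = [set w | D w = i] `&` [set w | f i w = i'].
  by apply/seteqP; split => w /=; [move=> [<- <-]|move=> [-> ->]].
rewrite E; have [ex|no] := pselect (exists w, D w = i); first exact: (fP i ex).2.
have -> : [set w | D w = i] = set0 by apply/seteqP; split=> w //= wi; apply: no; exists w.
rewrite set0I prob0; split=> //.
have s0 : \sum_i' z i i' = 0.
  rewrite -zD (_ : [set w | D w = i] = set0) ?prob0 //.
  by apply/seteqP; split=> w //= wi; apply: no; exists w.
have : z i i' <= \sum_i' z i i' by rewrite (bigD1 i') //= lerDl sumr_ge0.
by rewrite s0 => le; apply/esym/eqP; rewrite eq_le le z0.
Qed.

End Splitting.

(** * Splitting events under the uniform law *)

Section UniformDivisible.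
Context {R : realType}.
Local Notation U := (@uniform_prob R 0 1 ltr01).
Local Notation mu := (@lebesgue_measure R).

Lemma uniform_itv_le (x y : R) : x <= y -> (U (`]x, y]%classic) <= (y - x)%:E)%E.
Proof.
move=> xy; apply: (@le_trans _ _ (\int[mu]_(z in `]x, y]) (1 : \bar R))%E).
  apply: ge0_le_integral => //=.
  - by move=> z _; rewrite lee_fin uniform_pdf_ge0.
  - by apply/measurable_EFinP/measurable_funTS; exact: measurable_uniform_pdf.
  - by move=> z _; rewrite lee_fin /uniform_pdf subr0 invr1; case: ifP.
rewrite integral_cst //= mul1e lebesgue_measure_itv /= lte_fin.
by case: ltP => [_|yx]; rewrite ?EFinB // lee_fin subr_ge0.
Qed.

(** The probability of [E] up to [x] is a 1-Lipschitz function of [x], so it attains [c] by the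
    intermediate value theorem. *)
Lemma uniform_divisible : divisible U.
Proof.
move=> E c mE /andP[c0 cE].
pose f x := prob U (E `&` `]-oo, x]).
have mEi (i : interval R) : measurable (E `&` [set` i]) by apply: measurableI => //; exact: measurable_itv.
have fD x y : x <= y -> f y = f x + prob U (E `&` `]x, y]).
  move=> xy; rewrite -probU //.
    congr prob; apply/seteqP; split=> z /=; rewrite !in_itv /=.
      by move=> [Ez zy]; have [zx|zx] := leP z x; [left|right]; rewrite ?zx ?zy.
    by move=> [[Ez zx]|[Ez /andP[_ zy]]]; split=> //; exact: le_trans zx xy.
  apply/seteqP; split=> z //= [[_]]; rewrite !in_itv /= => zx [_ /andP[xz _]].
  by have := lt_le_trans xz zx; rewrite ltxx.
have fL x y : x <= y -> 0 <= f y - f x <= y - x.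
  move=> xy; rewrite (fD x y xy) addrAC subrr add0r prob_ge0 /=.
  rewrite -lee_fin -probE //; apply: le_trans (uniform_itv_le xy).
  by apply: le_measure; rewrite ?inE //; exact: measurable_itv.
have cf : continuous f.
  move=> x; apply/cvgrPdist_lt => e e0; near=> y.
  have d : `|x - y| < e by near: y; apply: cvgr_dist_lt.
  apply: le_lt_trans d; have [xy|yx] := leP x y.
    have := fL _ _ xy => /andP[h1 h2].
    by rewrite distrC [leRHS]distrC !ger0_norm // subr_ge0.
  have := fL _ _ (ltW yx) => /andP[h1 h2].
  by rewrite !ger0_norm // subr_ge0 ltW.
have f0 : f 0 = 0.
  apply/eqP; rewrite eq_le prob_ge0 andbT -lee_fin -probE //.
  rewrite /U /= /uniform_prob integral_uniform_pdf.
  apply: (@le_trans _ _ (\int[mu]_(z in `[0%R, 0%R]) (1 : \bar R))%E).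
    apply: (@le_trans _ _ (\int[mu]_(z in (E `&` `]-oo, 0%R]) `&` `[0%R, 1%R]) (1 : \bar R))%E).
      apply: ge0_le_integral => //=.
      - by apply: measurableI => //; exact: measurable_itv.
      - by move=> z _; rewrite lee_fin uniform_pdf_ge0.
      - by apply/measurable_EFinP/measurable_funTS; exact: measurable_uniform_pdf.
      - by move=> z _; rewrite lee_fin /uniform_pdf subr0 invr1; case: ifP.
    apply: ge0_subset_integral => //=.
    - by apply: measurableI => //; exact: measurable_itv.
    - by move=> z [[_]]; rewrite /= !in_itv /= => z0 /andP[z1 _]; rewrite z0 z1.
  by rewrite integral_cst //= mul1e lebesgue_measure_itv /= ltxx.
have f1 : f 1 = prob U E.
  rewrite /f /prob /U /= /uniform_prob; congr fine.
  rewrite integral_uniform_pdf [RHS]integral_uniform_pdf; congr (integral _ _ _).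
  apply/seteqP; split=> z /=; rewrite !in_itv /=; first by move=> [[]].
  by move=> [Ez /andP[z0 z1]]; rewrite z1; split=> //; rewrite z0.
have [||x _ fx] := @IVT R f 0 1 c ler01.
- exact: continuous_subspaceT.
- by rewrite f0 f1 min_l ?max_r ?prob_ge0 ?c0.
exists (E `&` `]-oo, x]); split=> //; exact: subIsetl.
Unshelve. all: by end_near. Qed.

End UniformDivisible.

Section PlanCost.
Context {R : realType} {V X : finType} (t : rooted_tree V) (j : X -> V) (om : V -> R).
Hypothesis om_ge0 : forall u, 0 <= om u.

(** Any plan carries across the edge above [u] at least the difference of the masses below [u]. *)
Lemma fraction_gap_le (p q : X -> R) g : transport_plan p q g ->
  fraction_gap t j om p q <= plan_cost (tree_dist t j om) g.
Proof.
move=> [g0 gp gq].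
pose b u x : R := (below t u (j x))%:R.
have insideE (f : X -> R) u : inside t j f u = \sum_x b u x * f x.
  rewrite /inside big_mkcond /=; apply: eq_bigr => x _; rewrite /b.
  by case: (below t u (j x)); rewrite ?mul1r ?mul0r.
have gap u : `|inside t j p u - inside t j q u| <=
    \sum_x \sum_y (below t u (j x) != below t u (j y))%:R * g x y.
  have -> : inside t j p u - inside t j q u = \sum_x \sum_y (b u x - b u y) * g x y.
    rewrite !insideE.
    have -> : \sum_x b u x * p x = \sum_x \sum_y b u x * g x y.
      by apply: eq_bigr => x _; rewrite -gp mulr_sumr.
    have -> : \sum_x b u x * q x = \sum_x \sum_y b u y * g x y.
      by rewrite exchange_big /=; apply: eq_bigr => y _; rewrite -gq mulr_sumr.
    rewrite -sumrB; apply: eq_bigr => x _; rewrite -sumrB; apply: eq_bigr => y _.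
    by rewrite mulrBl.
  apply: le_trans (ler_norm_sum _ _ _) _; apply: ler_sum => x _.
  apply: le_trans (ler_norm_sum _ _ _) _; apply: ler_sum => y _.
  rewrite normrM (ger0_norm (g0 x y)) ler_wpM2r // /b.
  by case: (below t u (j x)); case: (below t u (j y)); rewrite /= ?subrr ?subr0 ?sub0r ?normrN ?normr1 ?normr0.
apply: (@le_trans _ _ (\sum_u om u * \sum_x \sum_y (below t u (j x) != below t u (j y))%:R * g x y)).
  by apply: ler_sum => u _; rewrite ler_wpM2l.
rewrite le_eqVlt; apply/orP; left; apply/eqP; rewrite /plan_cost.
under eq_bigr do rewrite mulr_sumr.
rewrite exchange_big /=; apply: eq_bigr => x _.
under eq_bigr do rewrite mulr_sumr.
rewrite exchange_big /=; apply: eq_bigr => y _.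
by rewrite /tree_dist mulr_suml; apply: eq_bigr => u _; rewrite mulrA.
Qed.

Lemma move_cost_ge0 (d : X -> X -> R) (A B : {set X}) : (forall x y, 0 <= d x y) -> 0 <= move_cost d A B.
Proof. by move=> d0; apply: inf_ge0 => _ [f _ <-]; apply: sumr_ge0. Qed.

Lemma move_cost_le_set_cost (d : X -> X -> R) (A B : {set X}) : (forall x y, 0 <= d x y) ->
  (forall x y, d x y <= tree_dist t j om x y) -> #|A| = #|B| ->
  move_cost d A B <= set_cost t j om A B.
Proof.
move=> d0 dle cAB; have [f [fi fAB le]] := tree_matching t j om_ge0 cAB.
apply: le_trans le; apply: (@le_trans _ _ (\sum_(x in A) d x (f x))); last exact: ler_sum.
apply: ge_inf; first by exists 0 => _ [g _ <-]; apply: sumr_ge0.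
by exists f.
Qed.

End PlanCost.

Lemma prob_event {R : realType} (dO : measure_display) (Om : measurableType dO) (P : probability Om R)
    (I : finType) (D : Om -> I) (Q : pred I) : (forall i, measurable [set w | D w = i]) ->
  measurable [set w | Q (D w)] /\
  prob P [set w | Q (D w)] = \sum_i (Q i)%:R * prob P [set w | D w = i].
Proof.
move=> mD.
have [mf intf] := @expectation_finite R dO Om P I D (fun i => (Q i)%:R) (fun i => ler0n _ _) mD.
have mE : measurable [set w | Q (D w)].
  have := mf measurableT [set 1] (measurable_set1 _); rewrite setTI.
  congr measurable; apply/seteqP; split => w /=; case: (Q (D w)) => //.
  by move/eqP; rewrite eq_sym oner_eq0.
split=> //; apply: EFin_inj; rewrite -intf -probE // -[LHS]/(P _).
rewrite -(setIT [set w | Q (D w)]) -integral_indic //; apply: eq_integral => w _.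
rewrite indicE; congr (_%:R%:E); case E : (Q (D w)); first by rewrite mem_set.
by rewrite memNset //= E.
Qed.

(** * The randomized algorithm *)

Section Rounding.
Context {R : realType} {V X : finType} (t : rooted_tree V) (j : X -> V) (om : V -> R) (tau : R) (k : nat).
Hypothesis leafX : forall x c, ~~ child t (j x) c.
Hypothesis j_inj : injective j.
Hypothesis om_ge0 : forall u, 0 <= om u.
Hypothesis tau_gt1 : 1 < tau.
Hypothesis om_siblings : forall p c c', child t p c -> child t p c' -> om c = om c'.
Hypothesis om_par : forall v, v != root t -> parent t v != root t -> tau * om v <= om (parent t v).
Context (dO : measure_display) (Om : measurableType dO) (P : probability Om R).
Hypothesis divP : divisible P.
Variable F : seq X -> X -> R.
Hypothesis F01 : forall s x, 0 <= F s x <= 1.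
Hypothesis sumF : forall s, \sum_x F s x = k%:R.
Hypothesis Fx : forall s x, F (rcons s x) x = 1.
Hypothesis kX : (k <= #|X|)%N.

Notation K := (tau / (tau - 1)).

Let state := ((Om -> {set X}) * ({set X} -> R))%type.

(** The last clause concerns every outcome, because a randomized algorithm has to be valid for each
    [w] and not just almost surely. *)
Definition random_state (f : X -> R) (st : state) :=
  [/\ forall A : {set X}, measurable [set w | st.1 w = A] /\ prob P [set w | st.1 w = A] = st.2 A,
      balanced_law t j k f st.2 & forall w, 0 < st.2 (st.1 w)].

Definition random_step (f f' : X -> R) (st st' : state) :=
  exists z : {set X} -> {set X} -> R,
    [/\ forall A B : {set X}, 0 <= z A B,
        forall A B : {set X}, 0 < z A B -> #|A| = #|B|,
        forall p : {set X} * {set X}, measurable [set w | (st.1 w, st'.1 w) = p] /\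
          prob P [set w | (st.1 w, st'.1 w) = p] = z p.1 p.2
      & \sum_A \sum_B z A B * set_cost t j om A B <= 2 * K * fraction_gap t j om f f'].

Lemma random_next f f' st : random_state f st -> (forall x, 0 <= f' x <= 1) -> \sum_x f' x = k%:R ->
  exists st', random_state f' st' /\ random_step f f' st st'.
Proof.
move=> [mD law pos] f01 sf.
have [z [z0 zA law' zc]] := transition leafX j_inj om_ge0 tau_gt1 om_siblings om_par law f01 sf.
have [|||D' [posD' jD']] := @realize_coupling R dO Om P divP {set X} st.1 z _ z0.
- by move=> A; have [] := mD A.
- by move=> A; have [_ ->] := mD A.
- by move=> w; have [_ ->] := mD (st.1 w).
have lez A B : z A B <= \sum_A z A B by rewrite (bigD1 A) //= lerDl sumr_ge0.
have lez2 A B : z A B <= st.2 A by rewrite -zA (bigD1 B) //= lerDl sumr_ge0.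
have mp (p : {set X} * {set X}) : measurable [set w | (st.1 w, D' w) = p] /\ prob P [set w | (st.1 w, D' w) = p] = z p.1 p.2.
  by case: p => A B; exact: jD'.
exists (D', fun B => \sum_A z A B); split; last first.
  exists z; split=> // A B zAB.
  have [_ _ _ c1 _] := law; have [_ _ _ c2 _] := law'.
  rewrite c1 ?inE ?(lt_le_trans zAB) //; apply/esym/c2.
  by rewrite inE (lt_le_trans zAB).
split=> //= [B|w]; last exact: lt_le_trans (posD' w) (lez _ _).
have [m1 p1] := @prob_event R dO Om P _ (fun w => (st.1 w, D' w)) [pred p | p.2 == B] (fun p => (mp p).1).
have E : [set w | [pred p | p.2 == B] (st.1 w, D' w)] = [set w | D' w = B].
  by apply/seteqP; split => w /= /eqP.
rewrite -E; split=> //; rewrite p1.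
rewrite (eq_bigr (fun p : {set X} * {set X} => (p.2 == B)%:R * z p.1 p.2)); last by move=> p _; rewrite (mp p).2.
rewrite -(pair_big xpredT xpredT (fun A B' => (B' == B)%:R * z A B')) /=.
apply: eq_bigr => A _; rewrite (bigD1 B) //= eqxx mul1r big1 ?addr0 // => B' /negbTE ->.
by rewrite mul0r.
Qed.

(** A deterministic set is a balanced law of its own indicator; one [random_next] step turns it into
    a law with mean [F [::]]. *)
Lemma random_start : exists st, random_state (F [::]) st.
Proof.
have [A0 cA0] : exists A0 : {set X}, #|A0| = k.
  have := kX; rewrite -cardsT => /card_geqP[s [us ss _]].
  by exists [set x in s]%SET; rewrite cardsE (card_uniqP us).
pose mu0 (A : {set X}) : R := (A == A0)%:R.
have [] := @random_next (fun x => (x \in A0)%:R) (F [::]) (fun=> A0, mu0) _ (F01 [::]) (sumF [::]); last first.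
  by move=> st [st0 _]; exists st.
have supp A : A \in support mu0 -> A = A0.
  by rewrite inE /mu0; case: eqVneq => //= _; rewrite ltxx.
split=> [A||w] /=; last by rewrite /mu0 eqxx.
  rewrite /mu0; case: (eqVneq A A0) => [->|ne].
    have -> : [set _ : Om | A0 = A0] = setT by apply/seteqP; split.
    by rewrite prob_setT.
  have -> : [set _ : Om | A0 = A] = set0.
    by apply/seteqP; split=> // w /= e; rewrite e eqxx in ne.
  by rewrite prob0.
split.
- by move=> A; rewrite ler0n.
- by rewrite (bigD1 A0) //= /mu0 eqxx big1 ?addr0 // => A /negbTE ->.
- move=> x; rewrite /mean (bigD1 A0) //= /mu0 eqxx mul1r big1 ?addr0 // => A /negbTE ->.
  by rewrite mul0r.
- by move=> A /supp ->.
- by move=> A B u /supp -> /supp ->.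
Qed.

(** The laws are balanced with respect to the tree [t], whose metric need only dominate the metric
    [d] in which costs are measured. Expectations are handled as a sequence [c] of finite numbers
    with bounded increments. *)
Lemma randomized_rounding : exists A : Om -> seq X -> {set X},
  [/\ randomized_algorithm k A, rounding P A F
    & forall d : X -> X -> R, (forall x y, 0 <= d x y) -> (forall x y, d x y <= tree_dist t j om x y) ->
      exists c : seq X -> R,
        [/\ c [::] = 0, forall s, ('E_P[fun w => online_cost (move_cost d) (A w) s])%E = (c s)%:E
          & forall s x, c (rcons s x) <= c s + 2 * K * fraction_gap t j om (F s) (F (rcons s x))]].
Proof.
have [||run [inv step]] := @online_run X state (fun s => random_state (F s)) (fun s x => random_step (F s) (F (rcons s x))).
- exact: random_start.
- by move=> s x st ist; exact: random_next.
exists (fun w s => (run s).1 w); split.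
- split=> [w|s B]; last by have [/(_ B)[]] := inv s.
  split=> [s|s x].
    by have [_ [_ _ _ c _] pos] := inv s; apply: c; rewrite inE.
  have [_ [mu0 mu1 mn _ _] pos] := inv (rcons s x).
  (* The mean is 1 at the request, so a set of positive probability cannot miss it. *)
  apply/negPn/negP => xA; set mu := (run _).2 in mu0 mu1 mn pos; set A := (run _).1 w in xA.
  have : \sum_B mu B * (x \in B)%:R < \sum_B mu B.
    rewrite (bigD1 A) //= (negbTE xA) mulr0 add0r [ltRHS](bigD1 A) //=.
    rewrite ltr_pwDl //; first exact: pos.
    by apply: ler_sum => B _; rewrite ler_piMr // lern1 leq_b1.
  by rewrite mu1 -/(mean mu x) mn Fx ltxx.
- move=> s x; have [mA [_ _ mn _ _] _] := inv s.
  have [m1 p1] := @prob_event R dO Om P _ (run s).1 [pred A : {set X} | x \in A] (fun A => (mA A).1).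
  rewrite probE // p1 -mn; congr (_%:E); apply: eq_bigr => A _.
  by rewrite (mA A).2 mulrC.
move=> d d0 dle; pose Y s w := online_cost (move_cost d) (fun s => (run s).1 w) s.
have mc0 := fun A B => move_cost_ge0 A B d0.
have incr s x : exists2 r, measurable_fun setT (fun w => move_cost d ((run s).1 w) ((run (rcons s x)).1 w)) /\
    (\int[P]_w (move_cost d ((run s).1 w) ((run (rcons s x)).1 w))%:E)%E = r%:E &
    r <= 2 * K * fraction_gap t j om (F s) (F (rcons s x)).
  have [z [z0 zc mz le]] := step s x.
  have [||m1 i1] := @expectation_finite R dO Om P _ (fun w => ((run s).1 w, (run (rcons s x)).1 w)) (fun p => move_cost d p.1 p.2).
  - by move=> p.
  - by move=> p; have [] := mz p.
  eexists; first by split; [exact: m1|exact: i1].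
  rewrite (eq_bigr (fun p : {set X} * {set X} => z p.1 p.2 * move_cost d p.1 p.2)); last by move=> p _; rewrite (mz p).2 mulrC.
  rewrite -(pair_big xpredT xpredT (fun A B => z A B * move_cost d A B)) /=.
  apply: le_trans le; apply: ler_sum => A _; apply: ler_sum => B _.
  have := z0 A B; rewrite le_eqVlt => /predU1P[<-|zAB]; first by rewrite !mul0r.
  by rewrite ler_pM2l //; apply: move_cost_le_set_cost => //; exact: zc zAB.
have Y0 s w : 0 <= Y s w by apply: sumr_ge0 => i _; exact: mc0.
have Yr s x w : Y (rcons s x) w = Y s w + move_cost d ((run s).1 w) ((run (rcons s x)).1 w).
  exact: online_cost_rcons.
have intY s x : measurable_fun setT (Y s) -> measurable_fun setT (Y (rcons s x)) /\
    exists2 r, (\int[P]_w (Y (rcons s x) w)%:E = \int[P]_w (Y s w)%:E + r%:E)%E &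
    r <= 2 * K * fraction_gap t j om (F s) (F (rcons s x)).
  move=> mY; have [r [mm im] le] := incr s x.
  have YE : Y (rcons s x) = (fun w => Y s w + move_cost d ((run s).1 w) ((run (rcons s x)).1 w)) by exact: funext.
  split; first by rewrite YE; exact: measurable_funD.
  exists r => //; rewrite YE -im; under eq_integral do rewrite EFinD.
  rewrite ge0_integralD //.
  - by move=> w _; rewrite lee_fin.
  - exact/measurable_EFinP.
  - by move=> w _; rewrite lee_fin.
  - exact/measurable_EFinP.
have Y_nil w : Y [::] w = 0 by exact: online_cost_nil.
have mY s : measurable_fun setT (Y s).
  elim/last_ind: s => [|s x IH]; last exact: (intY s x IH).1.
  by rewrite (_ : Y [::] = fun=> 0); [exact: measurable_cst|exact: funext].
have fY s : (\int[P]_w (Y s w)%:E)%E \is a fin_num.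
  elim/last_ind: s => [|s x IH].
    by under eq_integral do rewrite Y_nil; rewrite integral0.
  by have [_ [r -> _]] := intY s x (mY s); rewrite fin_numD IH.
exists (fun s => fine (\int[P]_w (Y s w)%:E)%E); split.
- by under eq_integral do rewrite Y_nil; rewrite integral0.
- by move=> s; rewrite fineK //; rewrite expectation.unlock.
- move=> s x; have [_ [r -> le]] := intY s x (mY s).
  by rewrite fineD //= lerD2l.
Qed.

End Rounding.

(** * The bound on the light depth in terms of [ln k] *)

Section DepthConstant.
Context {R : realType}.

Lemma ln2_ge : 2^-1 <= ln (2 : R).
Proof.
have : ln (1 + - 2^-1 : R) <= - 2^-1 by apply: le_ln1Dx; lra.
have -> : 1 + - 2^-1 = 2^-1 :> R by field.
by rewrite lnV ?posrE // lerN2.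
Qed.

Variables (eta : R).
Hypothesis eta_gt0 : 0 < eta.
Hypothesis eta_le1 : eta <= 1.

(* Below depth about [ln k] the subtrees are so light that they can be cut off. *)
Lemma depth_constant : exists2 c0 : R, 0 < c0 & forall (D k H : nat), (0 < D)%N -> (1 < k)%N -> (H < k)%N ->
  let C := c0 * Num.min D%:R (ln k%:R) in
  8 <= C /\ ((forall m : nat, (m <= D)%N -> m.+1%:R <= C / 8) \/
             (forall n : nat, eta / (2 * C) <= H%:R * (1 - eta) ^+ n -> n.+2%:R <= C / 8)).
Proof.
have g0 : 0 < eta ^+ 2 / 64%:R by rewrite divr_gt0 ?exprn_gt0.
have lng : ln (eta ^+ 2 / 64%:R) <= 0.
  apply: ln_le0; rewrite ler_pdivrMr // mul1r; apply: le_trans (_ : 1 <= _); last by rewrite ler1n.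
  by rewrite exprn_ile1 // ltW.
pose l := - ln (eta ^+ 2 / 64%:R) / eta.
have l0 : 0 <= l by rewrite divr_ge0 ?oppr_ge0 // ltW.
pose c0 := 16%:R * (4 + 2 * l + 2 / eta).
have e20 : 0 < 2 / eta by rewrite divr_gt0.
have c0_64 : 64%:R <= c0 by rewrite /c0; move: l0 e20; generalize (2 / eta) l => a b; lra.
have c0E : c0 / 16%:R + 2 * l + 2 / eta + 4 = c0 / 8 by rewrite /c0; field; rewrite gt_eqF.
clearbody c0; exists c0; first by apply: lt_le_trans c0_64.
move=> D k H D0 k1 Hk C.
have lnk : 2^-1 <= ln (k%:R : R).
  by apply: le_trans ln2_ge _; rewrite ler_ln ?posrE ?ltr0n ?ler_nat // (ltn_trans _ k1).
have D1 : 1 <= D%:R :> R by rewrite ler1n.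
have M12 : 2^-1 <= Num.min D%:R (ln (k%:R : R)) by rewrite le_min lnk andbT; lra.
have C8 : 8 <= C.
  rewrite /C; have : c0 * 2^-1 <= c0 * Num.min D%:R (ln (k%:R : R)) by rewrite ler_wpM2l //; lra.
  by move: c0_64; lra.
split=> //; have [Dk|kD] := leP (D%:R : R) (ln k%:R).
  left=> m mD; rewrite /C min_l //.
  have : (m.+1%:R : R) <= 2 * D%:R by rewrite -natrM ler_nat; move: mD D0; clear; lia.
  have : 64%:R * D%:R <= c0 * D%:R by rewrite ler_wpM2r.
  by lra.
right=> n; move: C8; rewrite /C min_r ?(ltW kD) // {C M12}; set M := ln k%:R in lnk *.
move=> C8 le.
have M0 : 0 < M by apply: lt_le_trans lnk; lra.
have c00 : 0 < c0 by apply: lt_le_trans c0_64.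
have k0 : 0 < k%:R :> R by rewrite ltr0n (ltn_trans _ k1).
pose y := 2 * c0 / eta.
have y0 : 0 < y by rewrite divr_gt0 // mulr_gt0.
have yE : y = 2 * c0 / eta by [].
clearbody y.
(* By [1 - eta <= exp (- eta)] the hypothesis bounds [n * eta] by [ln y + ln M + M], where
   [M = ln k]. *)
have ex : expR (n%:R * eta) <= y * M * k%:R.
  have e1 : (1 - eta) ^+ n <= expR (- (n%:R * eta)).
    rewrite -mulrN expRM_natl; apply: lerXn2r; rewrite ?nnegrE ?expR_ge0 ?subr_ge0 //.
    exact: expR_ge1Dx.
  have e2 : eta / (2 * (c0 * M)) <= k%:R * expR (- (n%:R * eta)).
    apply: le_trans le _; apply: ler_pM => //; rewrite ?exprn_ge0 ?subr_ge0 //.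
    by rewrite ler_nat ltnW.
  move: e2; rewrite expRN ler_pdivrMr ?mulr_gt0 // => e2.
  have E0 := expR_gt0 (n%:R * eta).
  have : eta * expR (n%:R * eta) <= k%:R * (2 * (c0 * M)).
    have -> : k%:R * (2 * (c0 * M)) = (k%:R / expR (n%:R * eta) * (2 * (c0 * M))) * expR (n%:R * eta).
      by field; rewrite gt_eqF.
    by rewrite ler_pM2r.
  move=> e3; rewrite -(ler_pM2l eta_gt0); apply: le_trans e3 _.
  rewrite le_eqVlt; apply/orP; left; apply/eqP; rewrite yE; field; by rewrite gt_eqF.
have lnex : n%:R * eta <= ln y + ln M + M.
  rewrite -[leLHS]expRK; apply: le_trans (_ : ln (y * M * k%:R) <= _).
    by rewrite ler_ln ?posrE ?expR_gt0 // !mulr_gt0.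
  by rewrite lnM ?posrE ?mulr_gt0 // lnM ?posrE.
have lnM1 : ln M <= M - 1.
  have : ln (1 + (M - 1)) <= M - 1 by apply: le_ln1Dx; lra.
  by rewrite (_ : 1 + (M - 1) = M) //; ring.
(* [c0] occurs in the logarithm that it has to dominate. A tangent bound for [ln] with slope
   [eta ^+ 2 / 64] gives it the small coefficient [eta / 32], which breaks the circle. *)
have lny : ln y <= eta * (c0 / 32%:R) - 1 + l * eta.
  have : ln (1 + (eta ^+ 2 / 64%:R * y - 1)) <= eta ^+ 2 / 64%:R * y - 1.
    by apply: le_ln1Dx; rewrite -subr_gt0 opprK addrNK mulr_gt0.
  rewrite (_ : 1 + (eta ^+ 2 / 64%:R * y - 1) = eta ^+ 2 / 64%:R * y); last by ring.
  rewrite lnM ?posrE //.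
  have -> : eta ^+ 2 / 64%:R * y = eta * (c0 / 32%:R) by rewrite yE; field; rewrite gt_eqF.
  have -> : l * eta = - ln (eta ^+ 2 / 64%:R) by rewrite /l divfK // gt_eqF.
  by move=> h; lra.
have n_le : n%:R <= (c0 / 16%:R + 2 * l + 2 / eta) * M.
  rewrite -(ler_pM2r eta_gt0).
  have q0 : 0 <= c0 / 32%:R + l by rewrite addr_ge0 // divr_ge0 // ltW.
  have h1 : (c0 / 32%:R + l) * eta <= (c0 / 32%:R + l) * eta * (2 * M).
    by rewrite ler_peMr ?mulr_ge0 ?(ltW eta_gt0) //; move: lnk; generalize M => M'; lra.
  have -> : (c0 / 16%:R + 2 * l + 2 / eta) * M * eta = (c0 / 32%:R + l) * eta * (2 * M) + 2 * M.
    by field; rewrite gt_eqF.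
  by clearbody M l; move: lnex lnM1 lny h1; clear; lra.
have M1 : 2 <= 4 * M by move: lnk; generalize M => M'; lra.
have -> : c0 * M / 8 = c0 / 8 * M by rewrite mulrAC.
rewrite -c0E mulrDl -[n.+2]addn2 natrD lerD //.
Qed.


End DepthConstant.

(** * The rooted tree of an HST *)

Section HstTree.
Context {R : realType} {V : finType} (tau : R) (e : rel V) (len : V -> V -> R) (r : V).
Hypothesis hst : is_HST tau e len r.
Variable t : rooted_tree V.
Hypothesis tr : root t = r.
Hypothesis e_par : forall v, v != r -> e v (parent t v).
Hypothesis e_only : forall a b, e a b -> a != r /\ b = parent t a \/ b != r /\ a = parent t b.

Let symE : symmetric e. Proof. by case: hst => [[]]. Qed.

Lemma edge_child a b : child t a b -> e a b.
Proof. by rewrite /child tr => /andP[br /eqP <-]; rewrite symE e_par. Qed.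

Lemma leafP v : reflect (forall c, ~~ child t v c) (leaf e r v).
Proof.
apply: (iffP idP) => [lv c|noc].
  apply/negP => vc; have ev := edge_child vc; move: lv; rewrite /leaf.
  case: (eqVneq v r) ev => [->|vr] ev /=.
    by rewrite leqn0 => /eqP/card0_eq/(_ c); rewrite -topredE /= ev.
  move=> le; have : (#|[set c; parent t v]%SET| <= 1)%N.
    apply: leq_trans le; apply: subset_leq_card; apply/fintype.subsetP => u.
    by rewrite !inE => /orP[] /eqP ->; rewrite -topredE /= ?ev ?e_par.
  rewrite cards2; case: eqVneq => // cp.
  move: vc => /andP[cr /eqP pc]; have := depth_parent cr; rewrite pc.
  by rewrite -tr in vr; rewrite (depth_parent vr) -cp => /eqP; clear; lia.
rewrite /leaf; move: noc; have [->|vr] := eqVneq v r => noc /=.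
  rewrite leqn0; apply/eqP/eq_card0 => b; apply/negP; rewrite -topredE /= => eb.
  have [[]|[br ra]] := e_only eb; first by rewrite eqxx.
  by have := noc b; rewrite /child tr br -ra eqxx.
rewrite -(card1 (parent t v)); apply: subset_leq_card; apply/fintype.subsetP => b; rewrite -topredE /= => eb.
have [[_ ->]|[br vb]] := e_only eb; first by rewrite inE.
by have := noc b; rewrite /child tr br -vb eqxx.
Qed.

Lemma root_path v : exists p, [/\ path e r p, last r p = v, uniq (r :: p) & forall u, u \in r :: p -> (depth t u <= depth t v)%N].
Proof.
have [n] := ubnP (depth t v); elim: n v => // n IH v vn.
have [->|vr] := eqVneq v r.
  by exists [::]; split=> // u; rewrite inE => /eqP ->.
have vt : v != root t by rewrite tr.
have dv := depth_parent vt; have [|p [ep lp up dp]] := IH (parent t v); first by rewrite -dv.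
exists (rcons p v); split.
- by rewrite rcons_path ep lp symE e_par.
- by rewrite last_rcons.
- rewrite -rcons_cons rcons_uniq up andbT; apply/negP => /dp; rewrite dv; clear; lia.
- move=> u; rewrite -rcons_cons mem_rcons inE => /predU1P[->//|/dp]; rewrite dv; clear; lia.
Qed.

(** The edges above [parent t v] and above [v] are the last two of a simple path from the root,
    where the definition of an HST compares them. *)
Lemma hst_weight v : v != root t -> parent t v != root t ->
  edge_weight len t (parent t v) = tau * edge_weight len t v.
Proof.
move=> vr pr; rewrite /edge_weight (negbTE vr) (negbTE pr).
have dp := depth_parent pr; have dv := depth_parent vr.
set a := parent t v in pr dp dv *; set b := parent t a in dp *.
have eab : e a b by apply: e_par; rewrite -tr.
have eva : e v a by apply: e_par; rewrite -tr.
have [p [ep lp up hp]] := root_path b.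
have [_ _ +] := hst; move=> /(_ (p ++ [:: a; v])).
have up2 : uniq (r :: p ++ [:: a; v]).
  rewrite -cat_cons cat_uniq up /= !inE orbF andbT.
  apply/andP; split; last by apply/negP => /eqP av; move: dv; rewrite -av; clear; lia.
  by rewrite -!(in_cons r) negb_or; apply/andP; split; apply/negP => /hp; rewrite ?dv dp; clear; lia.
move=> /(_ _ up2); rewrite cat_path ep lp /= (symE b) (symE a v) eab eva => /(_ isT).
by rewrite pairmap_cat lp => /cat_sorted2[_] /=; rewrite andbT => /eqP.
Qed.

(** A root that is a leaf has no neighbour, so by connectedness there would be no second vertex. *)
Lemma root_not_leaf (x y : {v : V | leaf e r v}) : x != y -> val x != root t.
Proof.
move=> xy; apply/negP => /eqP xr; have yr : val y != r by apply/eqP => yr; case/eqP: xy; apply: val_inj; exact: etrans xr (etrans tr (esym yr)).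
have [[_ _ con _] _ _] := hst; have /connectP[p] := con r (val y).
case: p => [|a p] /=; first by move=> _ /eqP; apply/negP.
move=> /andP[ra _] _; have /leafP nc := valP x; have [[]|[ar re]] := e_only ra; first by rewrite eqxx.
by have := nc a; rewrite xr /child tr ar -re eqxx.
Qed.

End HstTree.

(** * The bounds for HSTs *)

Section HstPart.
Context {R : realType} {V : finType} (tau : R) (e : rel V) (len : V -> V -> R) (r : V).
Hypothesis tau_gt1 : 1 < tau.
Hypothesis hst : is_HST tau e len r.
Notation X := {v : V | leaf e r v}.
Notation K := (tau / (tau - 1)).
Variables (h H k : nat) (C d0 : R).
Hypothesis C_ge8 : 8 <= C.
Hypothesis depth_ok : (forall m : nat, (m <= hop_diameter e)%N -> m.+1%:R <= C / 8) \/
  (forall n : nat, (16%:R * K)^-1 / (2 * C) <= H%:R * (1 - (16%:R * K)^-1) ^+ n -> n.+2%:R <= C / 8).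
Hypothesis d0_01 : 0 < d0 <= 2^-1.
Hypothesis h_gt0 : (0 < h)%N.
Hypothesis hH : (h <= H)%N.
Hypothesis Hk : (H < k)%N.
Hypothesis kX : (k <= #|{: X}|)%N.
Hypothesis scale : k%:R / H%:R * (1 - d0) = 1.
Let a := k%:R / H%:R * (C * (4 * K)) * ln ((1 + d0 / 4) / (d0 / 4)).
Hypothesis a_gt0 : 0 < a.

Lemma leaf_metric_ge0 (x y : X) : 0 <= leaf_metric e len r x y.
Proof.
have [[sy _ _ _] lenP _] := hst; apply: inf_ge0 => _ [p [+ _] <-]; rewrite /path_length.
elim: p (val x) => [|b p IH] z /=; first by rewrite big_nil.
by move=> /andP[ezb pb]; rewrite big_cons addr_ge0 ?IH //; case: (lenP _ _ ezb).
Qed.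

(** Rounding loses [2 * K] for following the mean by balanced laws and [tau + K * tau] for the
    distortion of [chain_tree]. *)
Lemma hst_competitive : exists F : seq X -> X -> R,
  [/\ fractional_algorithm k F,
      competitive (leaf_metric e len r) h a (fun s => (online_cost (earthmover (leaf_metric e len r)) F s)%:E)
    & exists (A : measurableTypeR R -> seq X -> {set X}),
        [/\ randomized_algorithm k A, rounding (@uniform_prob R 0 1 ltr01) A F
          & competitive (leaf_metric e len r) h (2 * K * (tau + K * tau) * a)
              (fun s => ('E_(@uniform_prob R 0 1 ltr01)[fun w => online_cost (move_cost (leaf_metric e len r)) (A w) s])%E)]].
Proof.
have [tree lenP _] := hst; have [symE _ _ _] := tree.
have [t [tr e_par e_only dep]] := rooted_at r tree.
pose w := edge_weight len t; pose j (x : X) := val x.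
have t1 : 0 < tau - 1 by rewrite subr_gt0.
have tau0 : 0 < tau by exact: lt_trans tau_gt1.
have K0 : 0 < K by rewrite divr_gt0.
have dE : leaf_metric e len r = tree_dist t j w.
  apply/funext => x; apply/funext => y; rewrite /leaf_metric (shortest_path_tree lenP symE (t := t)) //.
  by rewrite tr.
  by rewrite tr.
have d_ge0 := leaf_metric_ge0; rewrite dE in d_ge0 *.
have w0 : forall u, 0 <= w u by apply: (edge_weight_ge0 (e := e) lenP symE) => v; rewrite tr; exact: e_par.
have wgeo := @hst_weight R V tau e len r hst t tr e_par.
have jl (x : X) c : ~~ child t (j x) c by apply/(leafP hst tr e_par e_only); exact: valP.
have lj v : (forall c, ~~ child t v c) -> exists x : X, j x = v.
  by move=> /(leafP hst tr e_par e_only) lv; exists (exist _ v lv).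
have ji : injective j by exact: val_inj.
have dok : (forall v, (depth t v).+1%:R <= C / 8) \/
    (forall n : nat, (16%:R * K)^-1 / (2 * C) <= H%:R * (1 - (16%:R * K)^-1) ^+ n -> n.+2%:R <= C / 8).
  by case: depth_ok => [D|]; [left=> v; exact: D|right].
have eta0 : 0 < (16%:R * K)^-1 by rewrite invr_gt0 mulr_gt0.
have etaK : (16%:R * K)^-1 * K = 16%:R^-1 by rewrite invfM -mulrA mulVf ?mulr1 // gt_eqF.
have [F [B [F01 sumF Fx plan comp]]] :=
  hst_algorithm w0 tau_gt1 wgeo C_ge8 eta0 etaK d0_01 jl lj ji dok h_gt0 hH Hk kX scale.
have Ffrac : fractional_algorithm k F.
  by split=> // s x; case/andP: (F01 s x).
have [V' [t' [j' [om [[jl' ji'] om0 oms omp dd]]]]] : exists (V' : finType) (t' : rooted_tree V') (j' : X -> V') (om : V' -> R),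
  [/\ (forall (x : X) (c : V'), ~~ child t' (j' x) c) /\ injective j', forall u : V', 0 <= om u,
      forall p c c' : V', child t' p c -> child t' p c' -> om c = om c',
      forall v : V', v != root t' -> parent t' v != root t' -> tau * om v <= om (parent t' v)
    & forall x y : X, tree_dist t j w x y <= tree_dist t' j' om x y <= (tau + K * tau) * tree_dist t j w x y].
  apply: chain_tree => // x.
  have : (1 < #|{: X}|)%N by apply: leq_trans kX; apply: leq_ltn_trans Hk; exact: leq_trans hH.
  move=> /card_gt1P[y [z [_ _ yz]]]; have [xy|xy] := eqVneq x y.
    by rewrite xy; exact: (root_not_leaf hst tr e_par e_only yz).
  exact: (root_not_leaf hst tr e_par e_only xy).
have [A [Aalg Around Acost]] := @randomized_rounding R V' _ t' j' om tau k jl' ji' om0 tau_gt1 oms omp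
  _ _ (@uniform_prob R 0 1 ltr01) uniform_divisible F F01 sumF Fx kX.
exists F; split=> //.
  have [|||||c cP] := comp 1 a (online_cost (earthmover (tree_dist t j w)) F); rewrite ?mul1r //.
  - by rewrite online_cost_nil.
  - move=> s x; rewrite online_cost_rcons lerD2l mul1r; have [g pg le] := plan s x.
    by apply: le_trans le; exact: earthmover_le.
  by exists c => s; rewrite lee_fin.
exists A; split=> //.
have [|c [c0 cE cs]] := Acost (tree_dist t j w) d_ge0; first by move=> x y; case/andP: (dd x y).
have b0 : 0 < tau + K * tau by rewrite addr_gt0 // mulr_gt0.
have beta0 : 0 < 2 * K * (tau + K * tau) by rewrite mulr_gt0 // mulr_gt0.
have [|||||c' cP] := comp (2 * K * (tau + K * tau)) (2 * K * (tau + K * tau) * a) c => //.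
- by rewrite mulr_gt0.
- by rewrite c0.
- move=> s x; apply: le_trans (cs s x) _; rewrite lerD2l -[leRHS]mulrA ler_pM2l; last exact: mulr_gt0.
  have [g pg le] := plan s x; apply: le_trans (fraction_gap_le t' j' om0 pg) _.
  apply: (@le_trans _ _ ((tau + K * tau) * plan_cost (tree_dist t j w) g)); last by rewrite ler_pM2l.
  rewrite /plan_cost mulr_sumr; apply: ler_sum => y _; rewrite mulr_sumr; apply: ler_sum => z _.
  by have [g0 _ _] := pg; rewrite mulrA ler_wpM2r //; case/andP: (dd y z).
by exists c' => s; rewrite cE lee_fin.
Qed.

End HstPart.

Lemma hst_part (R : realType) (tau : R) : 1 < tau ->
     exists2 C : R, 0 < C &
     forall (V : finType) (e : rel V) (len : V -> V -> R) (r : V)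
            (h k : nat) (eps : R),
       is_HST tau e len r ->
       (0 < h <= k)%N -> (k <= #|{: {v : V | leaf e r v}}|)%N ->
       0 < eps -> k%:R / h%:R = 1 + eps ->
       let X := {v : V | leaf e r v} in
       let d : X -> X -> R := leaf_metric e len r in
       let alpha :=
         C * (Num.min (hop_diameter e)%:R (ln k%:R) * log_inv eps) in
       exists F : seq X -> X -> R,
         [/\ fractional_algorithm k F,
             competitive d h alpha
               (fun s => (online_cost (earthmover d) F s)%:E)
           & exists (dO : measure_display) (Omega : measurableType dO)
                    (P : probability Omega R)
                    (A : Omega -> seq X -> {set X}),
               [/\ randomized_algorithm k A,
                   rounding P A F
                 & competitive d h alpha
                     (fun s => ('E_P[fun w =>
                        online_cost (move_cost d) (A w) s])%E)]].
Proof.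
move=> tau1; have t1 : 0 < tau - 1 by rewrite subr_gt0.
have tau0 : 0 < tau by exact: lt_trans tau1.
have K1 : 1 <= tau / (tau - 1) by rewrite ler_pdivlMr // mul1r gerBl.
have [c0 c00 depthP] : exists2 c0 : R, 0 < c0 & forall (D k H : nat), (0 < D)%N -> (1 < k)%N -> (H < k)%N ->
  let C := c0 * Num.min D%:R (ln k%:R) in
  8 <= C /\ ((forall m : nat, (m <= D)%N -> m.+1%:R <= C / 8) \/
    (forall n : nat, (16%:R * (tau / (tau - 1)))^-1 / (2 * C) <= H%:R * (1 - (16%:R * (tau / (tau - 1)))^-1) ^+ n -> n.+2%:R <= C / 8)).
  apply: depth_constant; first by rewrite invr_gt0 mulr_gt0 // (lt_le_trans _ K1).
  by rewrite invf_le1; move: K1; move: (tau / _) => K; lra.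
pose beta := 2 * (tau / (tau - 1)) * (tau + tau / (tau - 1) * tau).
have beta1 : 1 <= beta.
  rewrite /beta; move: K1; move: (tau / _) => K K1.
  have : 1 <= K * tau by rewrite mulr_ege1 // ltW.
  have : 1 <= tau + K * tau -> 1 <= K * (tau + K * tau) by move=> ?; rewrite mulr_ege1.
  by rewrite -mulrA; lra.
(* The factors are the bound on [k / H], the constant [c0] of the light depth, the [4 * K] of the
   movement accounting, and 13 from [augmentation]. *)
pose c1 := 2 * (c0 * (4 * (tau / (tau - 1)))) * 13%:R.
have c10 : 0 < c1.
  by rewrite mulr_gt0 // mulr_gt0 // mulr_gt0 // mulr_gt0 // (lt_le_trans _ K1).
have beta0 : 0 < beta by exact: lt_le_trans beta1.
exists (beta * c1); first exact: mulr_gt0.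
move=> V e len r h k eps hst hk kX eps0 ratio X d alpha.
have [H [d0 [/andP[h0 hH] Hk scale [kH /andP[d00 d01] lnd]]]] := augmentation hk eps0 ratio.
have k1 : (1 < k)%N by apply: leq_ltn_trans Hk; exact: leq_trans hH.
have [tree _ _] := hst.
have V1 : (1 < #|V|)%N.
  by apply: leq_trans k1 _; apply: leq_trans kX _; rewrite card_sig; exact: max_card.
have [C8 depth_ok] := depthP _ _ _ (hop_diameter_gt0 tree V1) k1 Hk.
set M := Num.min _ _ in C8 depth_ok alpha *.
have H0 : (0 : R) < H%:R by rewrite ltr0n (leq_trans h0).
have k0 : (0 : R) < k%:R by rewrite ltr0n (ltn_trans _ k1).
have kH0 : 0 < k%:R / H%:R :> R by rewrite divr_gt0.
have d0_half : 0 < d0 <= 2^-1.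
  rewrite d00 /=; have : k%:R / H%:R * (1 - d0) <= 2 * (1 - d0) by rewrite ler_wpM2r // subr_ge0.
  by rewrite scale; clear; lra.
have ln0 : 0 < ln ((1 + d0 / 4) / (d0 / 4)).
  by rewrite ln_gt0 // ltr_pdivlMr ?mul1r ?divr_gt0 // ltrDr.
have C0 : 0 < c0 * M by apply: lt_le_trans C8.
have K4 : 0 < 4 * (tau / (tau - 1)) by rewrite mulr_gt0 // (lt_le_trans _ K1).
pose a := k%:R / H%:R * (c0 * M * (4 * (tau / (tau - 1)))) * ln ((1 + d0 / 4) / (d0 / 4)).
have a0 : 0 < a by rewrite /a mulr_gt0 // mulr_gt0 // mulr_gt0.
have ale : beta * a <= alpha.
  rewrite /alpha -mulrA ler_pM2l //.
  have -> : c1 * (M * log_inv eps) = 2 * (c0 * M * (4 * (tau / (tau - 1)))) * (13%:R * log_inv eps).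
    by rewrite /c1; ring.
  have W0 : 0 < c0 * M * (4 * (tau / (tau - 1))) by exact: mulr_gt0.
  rewrite /a; move: W0 lnd ln0 kH kH0; clear.
  move: (c0 * M * _) (ln _) (k%:R / _) (13%:R * _) => W L q G W0 LG L0 q2 q0.
  by apply: ler_pM => //; [apply: ltW; exact: mulr_gt0|exact: ltW|rewrite ler_pM2r].
have ale1 : a <= alpha by apply: le_trans ale; rewrite ler_peMl // ltW.
have [F [Ff Fc [A [Aa Ar Ac]]]] := hst_competitive tau1 hst C8 depth_ok d0_half h0 hH Hk kX scale a0.
have d_ge0 := leaf_metric_ge0 hst.
exists F; split=> //; first exact: competitive_le d_ge0 ale1 Fc.
exists _, (measurableTypeR R), (@uniform_prob R 0 1 ltr01), A; split=> //.
exact: competitive_le d_ge0 ale Ac.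
Qed.

Local Open Scope ring_scope.

Theorem mainTheorem4 (R : realType) :
  (exists2 C : R, 0 < C &
     forall (V : finType) (e : rel V) (len : V -> V -> R) (h k : nat) (eps : R),
       is_tree e -> edge_lengths e len ->
       (0 < h <= k)%N -> (k <= #|V|)%N ->
       0 < eps -> k%:R / h%:R = 1 + eps ->
       let d := shortest_path e len in
       exists2 F : seq V -> V -> R,
         fractional_algorithm k F &
         competitive d h (C * ((hop_diameter e)%:R * log_inv eps))
           (fun s => (online_cost (earthmover d) F s)%:E))
  /\
  (forall tau : R, 1 < tau ->
     exists2 C : R, 0 < C &
     forall (V : finType) (e : rel V) (len : V -> V -> R) (r : V)
            (h k : nat) (eps : R),
       is_HST tau e len r ->
       (0 < h <= k)%N -> (k <= #|{: {v : V | leaf e r v}}|)%N ->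
       0 < eps -> k%:R / h%:R = 1 + eps ->
       let X := {v : V | leaf e r v} in
       let d : X -> X -> R := leaf_metric e len r in
       let alpha :=
         C * (Num.min (hop_diameter e)%:R (ln k%:R) * log_inv eps) in
       exists F : seq X -> X -> R,
         [/\ fractional_algorithm k F,
             competitive d h alpha
               (fun s => (online_cost (earthmover d) F s)%:E)
           & exists (dO : measure_display) (Omega : measurableType dO)
                    (P : probability Omega R)
                    (A : Omega -> seq X -> {set X}),
               [/\ randomized_algorithm k A,
                   rounding P A F
                 & competitive d h alpha
                     (fun s => ('E_P[fun w =>
                        online_cost (move_cost d) (A w) s])%E)]]).
Proof. by split=> [|tau]; [exact: tree_part|exact: hst_part]. Qed.
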